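(* Let $(M,\omega)$ be a compact, connected, quantizable symplectic manifold with prequantum bundle $(L,D)$, and let $\psi=\{\psi_t\}_{t\in[0,1]}$ be a closed Hamiltonian isotopy of $M$ ($\psi_0=\psi_1=\mathrm{id}$). Then $\kappa(\psi)$ is the holonomy of the transport $\mathcal{T}_\psi$ of sections along $\psi$; that is, for every section $\tau$ one has $\tau_1=\kappa(\psi)\,\tau$, where $\tau_t=F_t\circ\tau\circ\psi_t^{-1}$.
   Context: Let $\dim M=2n$. Quantizable means $[\omega]$ is integral; a prequantum bundle is a Hermitian line bundle $\pi:L\to M$ with connection $D$ of curvature $-2\pi i\omega$. $L^\times=L\setminus\{\text{zero section}\}$. The isotopy $\psi_t$ is determined by $\frac{d\psi_t(x)}{dt}=X_t(\psi_t(x))$, $\psi_0=\mathrm{id}$, $\iota_{X_t}\omega=-df_t$, with $f_t$ normalized by $\int_M f_t\omega^n=0$. For a function $f$ on $M$, $W_f$ is the vertical vector field on $L^\times$ whose value at $p$ is tangent at $t=0$ to $t\mapsto p\cdot e^{2\pi i t f(\pi(p))}$, and $X^\sharp$ denotes the horizontal lift of $X$. $F_t$ (with $F_0=\mathrm{id}$) is the isotopy of $L^\times$ generated by $X_t^\sharp-W_{f_t}$; it covers $\psi_t$ and preserves the connection. The transport $\mathcal{T}_\psi$ along $\psi$ is the family of maps $\tau\mapsto\tau_t:=F_t\circ\tau\circ\psi_t^{-1}$. The action integral is $\kappa(\psi)=\kappa_x(\psi):=\exp\big(2\pi i\int_S\omega-2\pi i\int_0^1 f_t(\psi_t(x))dt\big)$,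 where $S$ is any $2$-chain with boundary the (nullhomologous) closed curve $\{\psi_t(x)\}_t$; it is independent of $S$ and of $x\in M$. *)

(* Defs.v *)
From HB Require Import structures.
From mathcomp Require Import all_boot all_order all_fingroup all_algebra.
From mathcomp Require Import all_classical all_reals all_analysis.
From mathcomp Require Import complex.

Set Implicit Arguments.
Unset Strict Implicit.
Unset Printing Implicit Defensive.

Import Order.TTheory GRing.Theory Num.Theory.
Import numFieldNormedType.Exports.

Local Open Scope classical_set_scope.
Local Open Scope complex_scope.
Local Open Scope ring_scope.

Fixpoint Ck (R : realType) (m k : nat) (U : set 'rV[R]_m)
    (f : 'rV[R]_m -> R) : Prop :=
  (forall u, U u -> {for u, continuous f}) /\
  if k is k'.+1 then
    forall v, (forall u, U u -> derivable f u v) /\ Ck k' U (fun u => 'D_v f u)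
  else True.

(* On an arbitrary subset, smooth means that f extends smoothly locally around
   each point; for open A this is the usual notion.  It is used on open sets, on
   [0, 1] x (open set) and on the closed 2-simplex. *)
Definition smooth_on (R : realType) (m : nat) (A : set 'rV[R]_m)
    (f : 'rV[R]_m -> R) : Prop :=
  forall u, A u -> exists (V : set 'rV[R]_m) (g : 'rV[R]_m -> R),
    [/\ open V, V u, (forall k, Ck k V g) &
        forall w, A w -> V w -> f w = g w].

(* Velocity at time t, in local coordinates coord defined on dom, of a curve c
   parametrized by J (one-sided at the endpoints of J); in particular c stays in
   dom for the times of J close to t. *)
Definition has_velocity (R : realType) (T : Type) (k : nat) (dom : set T)
    (coord : T -> 'rV[R]_k) (J : set R) (c : R -> T) (t : R) (v : 'rV[R]_k) :
    Prop :=
  (\forall s \near t, J s -> dom (c s)) /\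
  (fun s => (s - t)^-1 *: (coord (c s) - coord (c t))) @ within J (t^') --> v.

Definition expi (R : realType) (a : R) : R[i] := cos a +i* sin a.

Definition I01 (R : realType) : set R := [set t : R | 0 <= t <= 1].
Arguments I01 {R}.

Record chart (R : realType) (m : nat) (M : topologicalType) := Chart {
  cdom : set M;
  cmap : M -> 'rV[R]_m;
  cinv : 'rV[R]_m -> M;
  cdom_open : open cdom;
  ccod_open : open (cmap @` cdom);
  cmapK : forall x, cdom x -> cinv (cmap x) = x;
  cmap_cont : {within cdom, continuous cmap};
  cinv_cont : {within cmap @` cdom, continuous cinv} }.

Definition ccod (R : realType) (m : nat) (M : topologicalType)
  (c : chart R m M) : set 'rV[R]_m := cmap c @` cdom c.

(* chart_at chooses a chart of the atlas around each point.  The tangent space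
   at x is identified with R^m through chart_at x, so that every tangent vector
   at x is a row vector, to be read in the chart chart_at x. *)
Record manifold (R : realType) (m : nat) (M : topologicalType) := Manifold {
  atlas : set (chart R m M);
  chart_at : M -> chart R m M;
  chart_atP : forall x, atlas (chart_at x);
  chart_at_dom : forall x, cdom (chart_at x) x;
  atlas_compat : forall c c' : chart R m M, atlas c -> atlas c' ->
    forall i, smooth_on (cmap c @` (cdom c `&` cdom c'))
                        (fun u => cmap c' (cinv c u) 0 i);
  manifold_hausdorff : hausdorff_space M;
  manifold_countable : @second_countable M }.

Section Manifolds.
Context {R : realType} {m : nat} {M : topologicalType} (A : manifold R m M).

Definition smooth_fun (U : set M) (f : M -> R) : Prop :=
  forall c, atlas A c ->
    smooth_on (cmap c @` (cdom c `&` U)) (fun u => f (cinv c u)).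

Definition smooth_cfun (U : set M) (h : M -> R[i]) : Prop :=
  smooth_fun U (fun x => complex.Re (h x)) /\
  smooth_fun U (fun x => complex.Im (h x)).

Definition smooth_into (k : nat) (B : set 'rV[R]_k) (g : 'rV[R]_k -> M) : Prop :=
  {within B, continuous g} /\
  forall c, atlas A c -> forall i,
    smooth_on (B `&` g @^-1` cdom c) (fun u => cmap c (g u) 0 i).

(* The cylinder [0, 1] x (chart image), with time as first coordinate. *)
Definition cyl (c : chart R m M) : set 'rV[R]_(1 + m) :=
  [set w | I01 (lsubmx w 0 0) /\ ccod c (rsubmx w)].

Definition smooth_time_fun (f : R -> M -> R) : Prop :=
  forall c, atlas A c ->
    smooth_on (cyl c) (fun w => f (lsubmx w 0 0) (cinv c (rsubmx w))).

Definition smooth_time_map (psi : R -> M -> M) : Prop :=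
  forall c, atlas A c ->
    smooth_into (cyl c) (fun w => psi (lsubmx w 0 0) (cinv c (rsubmx w))).

Definition mdiff (V : normedModType R) (g : M -> V) (x : M) (v : 'rV[R]_m) : V :=
  'D_v (g \o cinv (chart_at A x)) (cmap (chart_at A x) x).

(* The tangent vector at the point of coordinates u in the chart c whose
   components in c are a. *)
Definition tvec (c : chart R m M) (u a : 'rV[R]_m) : 'rV[R]_m :=
  'D_a (cmap (chart_at A (cinv c u)) \o cinv c) u.

Definition has_mvelocity (J : set R) (c : R -> M) (t : R) (v : 'rV[R]_m) : Prop :=
  has_velocity (cdom (chart_at A (c t))) (cmap (chart_at A (c t))) J c t v.

Definition smooth_vfield (U : set M) (X : M -> 'rV[R]_m) : Prop :=
  forall c, atlas A c -> forall i,
    smooth_fun (U `&` cdom c) (fun x => mdiff (cmap c) x (X x) 0 i).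

Definition lie_bracket (X Y : M -> 'rV[R]_m) (x : M) : 'rV[R]_m :=
  mdiff (fun y => mdiff (cmap (chart_at A x)) y (Y y)) x (X x) -
  mdiff (fun y => mdiff (cmap (chart_at A x)) y (X y)) x (Y x).

(* Component function, in the chart c, of the two-form om on the constant
   coordinate fields a and b. *)
Definition form_coef (om : M -> 'rV[R]_m -> 'rV[R]_m -> R)
    (c : chart R m M) (a b u : 'rV[R]_m) : R :=
  om (cinv c u) (tvec c u a) (tvec c u b).

Definition is_two_form (om : M -> 'rV[R]_m -> 'rV[R]_m -> R) : Prop :=
  [/\ forall x (k : R) u v w, om x (k *: u + v) w = k * om x u w + om x v w,
      forall x u v, om x u v = - om x v u &
      forall c, atlas A c -> forall a b, smooth_on (ccod c) (form_coef om c a b)].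

Definition closed_form (om : M -> 'rV[R]_m -> 'rV[R]_m -> R) : Prop :=
  forall c, atlas A c -> forall a b e u, ccod c u ->
    'D_a (form_coef om c b e) u + 'D_b (form_coef om c e a) u +
    'D_e (form_coef om c a b) u = 0.

Definition symplectic (om : M -> 'rV[R]_m -> 'rV[R]_m -> R) : Prop :=
  [/\ is_two_form om, closed_form om &
      forall x v, (forall w, om x v w = 0) -> v = 0].

Definition pt2 (a b : R) : 'rV[R]_2 := row_mx (a%:M : 'M[R]_1) (b%:M : 'M[R]_1).

Definition simplex2 : set 'rV[R]_2 :=
  [set w | exists a b, [/\ w = pt2 a b, 0 <= a, 0 <= b & a + b <= 1]].

Definition smooth_chain2 (S : seq (int * ('rV[R]_2 -> M))) : Prop :=
  all (fun p => `[< smooth_into simplex2 p.2 >]) S.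

(* The vertices of the standard simplex are (0,0), (1,0), (0,1), in this order. *)
Definition boundary (S : seq (int * ('rV[R]_2 -> M))) : seq (int * (R -> M)) :=
  flatten [seq [:: (p.1, fun t => p.2 (pt2 (1 - t) t));
                   (- p.1, fun t => p.2 (pt2 0 t));
                   (p.1, fun t => p.2 (pt2 t 0))] | p <- S].

(* Equality in the free abelian group on the 1-simplices [0, 1] -> M. *)
Definition chain_coef (C : seq (int * (R -> M))) (g : R -> M) : int :=
  \sum_(p <- C | `[< forall t, I01 t -> p.2 t = g t >]) p.1.

Definition chain_eq (C C' : seq (int * (R -> M))) : Prop :=
  forall g, chain_coef C g = chain_coef C' g.

Definition simplex_diff (sg : 'rV[R]_2 -> M) (w d : 'rV[R]_2) : 'rV[R]_m :=
  'D_d (cmap (chart_at A (sg w)) \o sg) w.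

Definition simplex_int (om : M -> 'rV[R]_m -> 'rV[R]_m -> R)
    (sg : 'rV[R]_2 -> M) : R :=
  (\int[lebesgue_measure]_(a in [set a : R | 0 < a < 1])
    (\int[lebesgue_measure]_(b in [set b : R | 0 < b < 1 - a])
      om (sg (pt2 a b)) (simplex_diff sg (pt2 a b) (pt2 1 0))
                        (simplex_diff sg (pt2 a b) (pt2 0 1))))%R.

Definition chain_int (om : M -> 'rV[R]_m -> 'rV[R]_m -> R)
    (S : seq (int * ('rV[R]_2 -> M))) : R :=
  \sum_(p <- S) p.1%:~R * simplex_int om p.2.

(* The de Rham class of om is integral: its periods are integers. *)
Definition integral_class (om : M -> 'rV[R]_m -> 'rV[R]_m -> R) : Prop :=
  forall S, smooth_chain2 S -> chain_eq (boundary S) [::] ->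
    exists z : int, chain_int om S = z%:~R.

Record frame (fib : M -> lmodType R[i]) := Frame {
  fdom : set M;
  fvec : forall x, fib x;
  fcoord : forall x, fib x -> R[i];
  fdom_open : open fdom;
  fvecK : forall x (v : fib x), fdom x -> fcoord v *: fvec x = v;
  fcoordK : forall x (z : R[i]), fdom x -> fcoord (z *: fvec x) = z }.

(* frame_at plays for the fibres the same role as chart_at for the tangent
   spaces. *)
Record hermitian_line_bundle := HermitianLineBundle {
  fib : M -> lmodType R[i];
  frames : set (frame fib);
  frame_at : M -> frame fib;
  frame_atP : forall x, frames (frame_at x);
  frame_at_dom : forall x, fdom (frame_at x) x;
  frames_compat : forall e e', frames e -> frames e' ->
    smooth_cfun (fdom e `&` fdom e') (fun x => fcoord e (fvec e' x));
  herm : forall x, fib x -> fib x -> R[i];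
  herm_linear : forall x (z : R[i]) (u v w : fib x),
    herm (z *: u + v) w = z * herm u w + herm v w;
  herm_sym : forall x (u v : fib x), herm v u = ((herm u v)^*)%C;
  herm_pos : forall x (u : fib x), u != 0 -> 0 < herm u u;
  herm_smooth : forall e, frames e ->
    smooth_cfun (fdom e) (fun x => herm (fvec e x) (fvec e x)) }.

Section Bundle.
Context (L : hermitian_line_bundle).

Definition smooth_section (U : set M) (s : forall x, fib L x) : Prop :=
  forall e, frames e -> smooth_cfun (U `&` fdom e) (fun x => fcoord e (s x)).

(* A covariant derivative, as a sheaf morphism: cov x v s is D_v s for v in
   T_x M and s smooth near x (the values at other s are irrelevant). *)
Record connection := Connection {
  cov : forall x, 'rV[R]_m -> (forall y, fib L y) -> fib L x;
  cov_local : forall (U : set M) x v s s', open U -> U x ->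
    smooth_section U s -> smooth_section U s' ->
    (forall y, U y -> s y = s' y) -> cov x v s = cov x v s';
  cov_linear : forall (U : set M) x (k : R) v w s, open U -> U x ->
    smooth_section U s ->
    cov x (k *: v + w) s = (k%:C)%C *: cov x v s + cov x w s;
  cov_additive : forall (U : set M) x v s s', open U -> U x ->
    smooth_section U s -> smooth_section U s' ->
    cov x v (fun y => s y + s' y) = cov x v s + cov x v s';
  cov_leibniz : forall (U : set M) x v (h : M -> R[i]) s, open U -> U x ->
    smooth_cfun U h -> smooth_section U s ->
    cov x v (fun y => h y *: s y) =
      (mdiff (fun y => complex.Re (h y) : R) x v +i*
       mdiff (fun y => complex.Im (h y) : R) x v) *: s x + h x *: cov x v s;
  cov_smooth : forall (U : set M) X s, open U ->
    smooth_vfield U X -> smooth_section U s ->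
    smooth_section U (fun y => cov y (X y) s) }.

Definition prequantum (om : M -> 'rV[R]_m -> 'rV[R]_m -> R) (D : connection) :
    Prop :=
  forall (U : set M) X Y s x, open U -> U x ->
    smooth_vfield U X -> smooth_vfield U Y -> smooth_section U s ->
    cov D x (X x) (fun y => cov D y (Y y) s) -
    cov D x (Y x) (fun y => cov D y (X y) s) -
    cov D x (lie_bracket X Y x) s =
      (0 +i* (- (2 * pi * om x (X x) (Y x)))) *: s x.

Definition tot_space : Type := {x : M & fib L x}.

Definition slit (p : tot_space) : Prop := projT2 p != 0.

Definition section_map (s : forall x, fib L x) : M -> tot_space :=
  fun x => existT _ x (s x).

Definition tscale (z : R[i]) (p : tot_space) : tot_space :=
  existT _ (projT1 p) (z *: projT2 p).

(* Local coordinates on the total space above chart_at x and frame_at x; the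
   tangent space at p is read in the coordinates attached to its base point. *)
Definition tdom (x : M) : set tot_space :=
  [set p | cdom (chart_at A x) (projT1 p) /\ fdom (frame_at L x) (projT1 p)].

Definition tcoord (x : M) (p : tot_space) : 'rV[R]_(m + 2) :=
  let z := fcoord (frame_at L x) (projT2 p) in
  row_mx (cmap (chart_at A x) (projT1 p)) (pt2 (complex.Re z) (complex.Im z)).

Definition has_tvelocity (J : set R) (c : R -> tot_space) (t : R)
    (v : 'rV[R]_(m + 2)) : Prop :=
  has_velocity (tdom (projT1 (c t))) (tcoord (projT1 (c t))) J c t v.

(* h is the horizontal lift at p of v: h = ds(v) for a local section s through p
   with D_v s = 0. *)
Definition horizontal_lift (D : connection) (p : tot_space) (v : 'rV[R]_m)
    (h : 'rV[R]_(m + 2)) : Prop :=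
  exists (U : set M) (s : forall x, fib L x),
    [/\ open U, U (projT1 p), smooth_section U s, s (projT1 p) = projT2 p &
        cov D (projT1 p) v s = 0 /\
        h = mdiff (fun y => tcoord (projT1 p) (section_map s y)) (projT1 p) v].

(* w is the value at p of the vertical field W_f. *)
Definition vertical_field (f : M -> R) (p : tot_space) (w : 'rV[R]_(m + 2)) : Prop :=
  has_tvelocity setT (fun t => tscale (expi (2 * pi * t * f (projT1 p))) p) 0 w.

(* F is the isotopy of the complement of the zero section generated by
   X_t^sharp - W_(f_t); F t is only relevant on this complement. *)
Definition lift_isotopy (D : connection) (X : R -> M -> 'rV[R]_m)
    (f : R -> M -> R) (F : R -> tot_space -> tot_space) : Prop :=
  forall p, slit p ->
    F 0 p = p /\
    forall t, I01 t ->
      slit (F t p) /\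
      exists h w, [/\ horizontal_lift D (F t p) (X t (projT1 (F t p))) h,
        vertical_field (f t) (F t p) w &
        has_tvelocity I01 (fun s => F s p) t (h - w)].

(* Since the bundle may have no global nowhere vanishing section, F_t is extended
   to the zero section by the zero vector over psi_t. *)
Definition extend0 (psi : R -> M -> M) (F : R -> tot_space -> tot_space) (t : R)
    (p : tot_space) : tot_space :=
  if projT2 p == 0 then section_map (fun=> 0) (psi t (projT1 p)) else F t p.

Definition transport (psi psiV : R -> M -> M) (F : R -> tot_space -> tot_space)
    (tau : M -> tot_space) (t : R) : M -> tot_space :=
  extend0 psi F t \o tau \o psiV t.

End Bundle.

Definition isotopy (psi psiV : R -> M -> M) : Prop :=
  [/\ smooth_time_map psi, smooth_time_map psiV, psi 0 = id &
      forall t, I01 t -> cancel (psi t) (psiV t) /\ cancel (psiV t) (psi t)].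

(* dpsi_t/dt = X_t o psi_t and i_(X_t) om = - df_t. *)
Definition hamiltonian_flow (om : M -> 'rV[R]_m -> 'rV[R]_m -> R)
    (f : R -> M -> R) (X : R -> M -> 'rV[R]_m) (psi : R -> M -> M) : Prop :=
  forall t x, I01 t ->
    has_mvelocity I01 (fun s => psi s x) t (X t (psi t x)) /\
    forall v, om x (X t x) v = - mdiff (f t) x v.

Definition action_integral (om : M -> 'rV[R]_m -> 'rV[R]_m -> R)
    (f : R -> M -> R) (psi : R -> M -> M) (x : M)
    (S : seq (int * ('rV[R]_2 -> M))) : R[i] :=
  expi (2 * pi * chain_int om S -
        2 * pi * \int[lebesgue_measure]_(t in I01) (f t (psi t x)))%R.

End Manifolds.

Fact even_index_proof n (i : 'I_n) : (i.*2 < n.*2)%N.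
Proof. by rewrite ltn_double. Qed.

Fact odd_index_proof n (i : 'I_n) : (i.*2.+1 < n.*2)%N.
Proof. by rewrite ltn_Sdouble. Qed.

Section Liouville.
Context {R : realType} {n : nat} {M : topologicalType}.
Context (A : manifold R n.*2 M) (om : M -> 'rV[R]_n.*2 -> 'rV[R]_n.*2 -> R).

(* The n-fold wedge power of om at x on the vectors E, normalized so that
   (a /\ b)(v, w) = a(v) b(w) - a(w) b(v) for one-forms. *)
Definition top_power (x : M) (E : 'I_n.*2 -> 'rV[R]_n.*2) : R :=
  (2 ^+ n)^-1 *
  \sum_(s : 'S_n.*2) (-1) ^+ s *
    \prod_(i < n) om x (E (s (Ordinal (even_index_proof i))))
                       (E (s (Ordinal (odd_index_proof i)))).

Fixpoint iter_int (m : nat) : ('rV[R]_m -> R) -> R :=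
  match m with
  | 0 => fun g => g 0
  | m'.+1 => fun g =>
      (\int[lebesgue_measure]_(a in [set: R])
         iter_int (fun u : 'rV[R]_m' => g (row_mx (a%:M : 'M[R]_1) u)))%R
  end.

(* I is the integral of g om^n over the compact manifold M, computed with a
   finite partition of unity rho subordinate to charts c.  M is oriented by om^n,
   whence the absolute value of the component of om^n in the chart. *)
Definition is_integral (g : M -> R) (I : R) : Prop :=
  exists (N : nat) (c : 'I_N -> chart R n.*2 M) (rho : 'I_N -> M -> R),
    [/\ forall j, atlas A (c j),
        forall j, smooth_fun A setT (rho j) /\ (forall x, 0 <= rho j x),
        forall j, closure [set x | rho j x != 0] `<=` cdom (c j),
        forall x, \sum_j rho j x = 1 &
        I = \sum_j iter_int (fun u : 'rV[R]_n.*2 =>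
              if `[< ccod (c j) u >] then
                let x := cinv (c j) u in
                rho j x * g x *
                `| top_power x (fun i => tvec A (c j) u (delta_mx 0 i)) |
              else 0)].

End Liouville.

(* Main.v *)
Require Import Defs.
From HB Require Import structures.
From mathcomp Require Import all_boot all_order all_fingroup all_algebra.
From mathcomp Require Import all_classical all_reals all_analysis.
From mathcomp Require Import complex.
From mathcomp Require Import ring lra.

Set Implicit Arguments.
Unset Strict Implicit.
Unset Printing Implicit Defensive.

Import Order.TTheory GRing.Theory Num.Theory.
Import numFieldNormedType.Exports.
Local Open Scope classical_set_scope.
Local Open Scope ring_scope.
Local Open Scope complex_scope.

(** Let p be a lift to L of a curve g in M, with values off the zero section.
    Its covariant derivative is w times p for a complex function w, the rate of
    p; in a frame with connection form theta this reads z' = (w - theta(g')) z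
    for the fibre coordinate z.  Two lifts of one curve differ by a scalar
    function whose logarithmic derivative is the difference of the rates
    [ratio_expi].  The curves s |-> F_s(p) are lifts of s |-> psi_s(x) with rate
    - 2 pi i f_s(psi_s(x)) [lift_flow], and horizontal lifts are those of rate 0.
    So F_1(p) is p times the holonomy of the loop t |-> psi_t(x) times
    exp (- 2 pi i \int f_t(psi_t(x)) dt) [flow_lift_loop].  It remains to see
    that this factor is the same at all points x, and that at x0 the holonomy of
    the loop is exp (2 pi i \int_S om).

    Both follow from one variation formula [lift_variation].  Consider a family
    of curves sg(u, .) with lifts r(u, .) of rates i al(u, .).  If the curve
    u |-> r(u, 0) has rate w, then u |-> r(u, 1) has rate
    w + i \int_0^1 (2 pi om(d_u sg, d_v sg) + d_u al) dv.  Locally the lifts are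
    exponentials of integrals of the connection form [variation_local];
    differentiation under the integral and the structure equation
    d theta = - 2 pi i om [curvature, curv_pull] give the formula, and the
    contributions of short segments are added by continuous induction [cousin].

    For the independence of x, take sg(u, t) = psi_t(x_u) and al = - 2 pi f_t.
    The integrand vanishes by Hamilton's equation, so u |-> F_0(p_u) and
    u |-> F_1(p_u), which lie over the same curve as psi_1 = id, have the same
    rate and a constant ratio [flow_holonomy_path].  The factor is thus locally
    constant, and M is connected [flow_holonomy_all].

    For the holonomy of the loop, take al = 0 and for sg a singular 2-simplex
    in coordinates that collapse one side of the square [simplex_hol].  The
    result is that parallel transport around the boundary of a simplex is the
    exponential of 2 pi i times the integral of om over it
    [strip_area_simplex_int].  Holonomy, raised to the coefficients and
    multiplied over the paths of a 1-chain, depends on the chain alone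
    [chain_hol_eq].  As the boundary of S is the loop, its holonomy is the
    product over S of these exponentials [loop_hol]. *)

(** * Functions of class Ck on open sets *)

Section Smooth.
Context {R : realType}.

Lemma eq_continuous_at (T S : topologicalType) (f g : T -> S) (U : set T) u :
  open U -> U u -> (forall x, U x -> f x = g x) ->
  {for u, continuous f} -> {for u, continuous g}.
Proof.
move=> oU Uu fg cf; rewrite /prop_for /continuous_at -(fg _ Uu).
apply: cvg_trans cf; apply: (near_eq_cvg (F := nbhs u)).
by apply: filterS (open_nbhs_nbhs (conj oU Uu)) => x /fg.
Qed.

Lemma Ck_cont m k (U : set 'rV[R]_m) f u :
  Ck k U f -> U u -> {for u, continuous f}.
Proof. by case: k => [|k] [+ _]; apply. Qed.

Lemma Ck_pred m k (U : set 'rV[R]_m) f : Ck k.+1 U f -> Ck k U f.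
Proof.
elim: k f => [|k IH] f [cf hf]; first by split.
by split=> // v; have [dv hv] := hf v; split=> //; exact: IH.
Qed.

Lemma Ck_sub m k (U V : set 'rV[R]_m) f : U `<=` V -> Ck k V f -> Ck k U f.
Proof.
move=> UV; elim: k f => [|k IH] f [cf hf].
  by split=> // u /UV; exact: cf.
split=> [u /UV|v]; first exact: cf.
by have [dv hv] := hf v; split=> [u /UV|]; [exact: dv|exact: IH].
Qed.

Lemma Ck_local m k (U : set 'rV[R]_m) f :
  (forall u, U u -> exists2 V, V u & Ck k V f) -> Ck k U f.
Proof.
elim: k f => [|k IH] f H.
  by split=> // u Uu; have [V Vu /Ck_cont] := H u Uu; apply.
split=> [u Uu|v]; first by have [V Vu /Ck_cont] := H u Uu; apply.
split=> [u Uu|]; first by have [V Vu [_ /(_ v)[+ _]]] := H u Uu; apply.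
by apply: IH => u Uu; have [V Vu [_ /(_ v)[_ h]]] := H u Uu; exists V.
Qed.

Lemma Ck_eq m k (U : set 'rV[R]_m) f g : open U ->
  (forall u, U u -> f u = g u) -> Ck k U f -> Ck k U g.
Proof.
move=> oU; elim: k f g => [|k IH] f g fg [cf hf].
  by split=> // u Uu; exact: (eq_continuous_at oU Uu fg (cf u Uu)).
split=> [u Uu|v]; first exact: (eq_continuous_at oU Uu fg (cf u Uu)).
have [dv hv] := hf v; split=> [u Uu|].
  apply: near_eq_derivable (dv u Uu).
  by apply: filterS (open_nbhs_nbhs (conj oU Uu)) => x /fg.
apply: IH hv => u Uu; apply: near_eq_derive.
by apply: filterS (open_nbhs_nbhs (conj oU Uu)) => x /fg.
Qed.

Lemma Ck_cst m k (U : set 'rV[R]_m) (a : R) : Ck k U (cst a).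
Proof.
elim: k a => [|k IH] a; first by split=> // u _; exact: cst_continuous.
split=> [u _|v]; first exact: cst_continuous.
split=> [u _|]; first exact: derivable_cst.
rewrite (_ : (fun u => _) = cst 0); first exact: IH.
by apply/funext => u; rewrite derive_cst.
Qed.

Lemma Ck_D m k (U : set 'rV[R]_m) f g : open U ->
  Ck k U f -> Ck k U g -> Ck k U (fun u => f u + g u).
Proof.
move=> oU; elim: k f g => [|k IH] f g [cf hf] [cg hg].
  by split=> // u Uu; exact: continuousD (cf u Uu) (cg u Uu).
split=> [u Uu|v]; first exact: continuousD (cf u Uu) (cg u Uu).
have [df hdf] := hf v; have [dg hdg] := hg v.
split=> [u Uu|]; first by apply: derivableD; [exact: df|exact: dg].
apply: Ck_eq (IH _ _ hdf hdg) => // u Uu.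
by rewrite deriveD //; [exact: df|exact: dg].
Qed.

Lemma Ck_M m k (U : set 'rV[R]_m) f g : open U ->
  Ck k U f -> Ck k U g -> Ck k U (fun u => f u * g u).
Proof.
move=> oU; elim: k f g => [|k IH] f g hf hg.
  by split=> // u Uu; exact: continuousM (Ck_cont hf Uu) (Ck_cont hg Uu).
split=> [u Uu|v]; first exact: continuousM (Ck_cont hf Uu) (Ck_cont hg Uu).
have [_ /(_ v)[df hdf]] := hf; have [_ /(_ v)[dg hdg]] := hg.
split=> [u Uu|]; first by apply: derivableM; [exact: df|exact: dg].
apply: Ck_eq (Ck_D oU (IH _ _ (Ck_pred hf) hdg) (IH _ _ (Ck_pred hg) hdf)) => //.
by move=> u Uu; rewrite -[RHS]/('D_v (f * g) u) deriveM //; [exact: df|exact: dg].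
Qed.

Lemma Ck_sum m k (U : set 'rV[R]_m) n (f : 'I_n -> 'rV[R]_m -> R) : open U ->
  (forall i, Ck k U (f i)) -> Ck k U (fun u => \sum_i f i u).
Proof.
move=> oU; elim: n f => [|n IH] f hf.
  rewrite (_ : (fun u => _) = cst 0); first exact: Ck_cst.
  by apply/funext => u; rewrite big_ord0.
rewrite (_ : (fun u => _) =
  fun u => f ord0 u + \sum_(i < n) f (lift ord0 i) u); last first.
  by apply/funext => u; rewrite big_ord_recl.
by apply: Ck_D => //; apply: IH.
Qed.

Lemma Ck_N m k (U : set 'rV[R]_m) f : open U ->
  Ck k U f -> Ck k U (fun u => - f u).
Proof.
move=> oU hf; rewrite (_ : (fun u => _) = fun u => cst (-1) u * f u).
  by apply: Ck_M => //; exact: Ck_cst.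
by apply/funext => u /=; rewrite mulN1r.
Qed.

Lemma is_derive_coord m n (v u : 'M[R]_(m, n)) i j :
  is_derive u v (fun x : 'M[R]_(m, n) => x i j) (v i j).
Proof.
apply: DeriveDef.
  by apply: diff_derivable; exact: differentiable_coord.
rewrite /derive; apply/cvg_lim => //; apply: cvg_near_cst.
near=> h; rewrite /= !mxE addrK [_ *: _]mulrA mulVf ?mul1r //.
by near: h; exact: nbhs_dnbhs_neq.
Unshelve. all: by end_near. Qed.

Lemma Ck_coord m k (U : set 'rV[R]_m) i j : Ck k U (fun u => u i j).
Proof.
case: k => [|k]; first by split=> // u _; exact: coord_continuous.
split=> [u _|v]; first exact: coord_continuous.
split=> [u _|]; first by have [] := is_derive_coord v u i j.
rewrite (_ : (fun u => _) = cst (v i j)); first exact: Ck_cst.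
by apply/funext => u; have [_ ->] := is_derive_coord v u i j.
Qed.

Lemma is_derive_line m (V : normedModType R) (f : 'rV[R]_m -> V) (x v : 'rV[R]_m) (s : R) :
  derivable f (s *: v + x) v ->
  is_derive s 1 (fun r => f (r *: v + x)) ('D_v f (s *: v + x)).
Proof.
move=> df; have E : (fun h : R => h^-1 *: (((fun r => f (r *: v + x)) \o shift s) (h *: 1) - f (s *: v + x)))
  = (fun h : R => h^-1 *: ((f \o shift (s *: v + x)) (h *: v) - f (s *: v + x))).
  by apply/funext => h /=; rewrite [h *: 1]mulr1 scalerDl addrA.
by apply: DeriveDef; rewrite /derivable ?/derive E.
Qed.

Lemma MVT_line m (f : 'rV[R]_m -> R) (x v : 'rV[R]_m) (a : R) :
  (forall s, `|s| <= `|a| -> derivable f (s *: v + x) v) ->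
  exists2 s, `|s| <= `|a| & f (a *: v + x) - f x = a * 'D_v f (s *: v + x).
Proof.
move=> df; pose g r := f (r *: v + x).
have dg (s : R) : `|s| <= `|a| -> is_derive s (1 : R) g ('D_v f (s *: v + x)).
  by move=> sa; apply: is_derive_line; exact: df.
have cg (s : R) : `|s| <= `|a| -> {for s, continuous g}.
  move=> /dg [+ _] => /derivable1_diffP; exact: differentiable_continuous.
have [a0|a0] := leP 0 a.
- have [|||c cI] := @MVT_segment R g (fun s => 'D_v f (s *: v + x)) 0 a.
  + by [].
  + move=> y; rewrite in_itv /= => /andP[y0 ya]; apply: dg.
    by rewrite !ger0_norm ?(ltW ya) // ltW.
  + apply/subspace_continuousP => y /=; rewrite in_itv /= => /andP[y0 ya].
    apply: cvg_within_filter; apply: cg.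
    by rewrite !ger0_norm.
  rewrite /g scale0r add0r subr0 => E; exists c; last by rewrite E mulrC.
  by move: cI; rewrite in_itv /= => /andP[c0 ca]; rewrite !ger0_norm.
- have [|||c cI] := @MVT_segment R g (fun s => 'D_v f (s *: v + x)) a 0.
  + exact: ltW.
  + move=> y; rewrite in_itv /= => /andP[y0 ya]; apply: dg.
    by rewrite !ltr0_norm // lerN2 ltW.
  + apply/subspace_continuousP => y /=; rewrite in_itv /= => /andP[y0 ya].
    apply: cvg_within_filter; apply: cg.
    by rewrite (ltr0_norm a0) ler0_norm // lerN2.
  rewrite /g scale0r add0r sub0r => E; exists c; last first.
    by rewrite -opprB E mulrN opprK mulrC.
  by move: cI; rewrite in_itv /= => /andP[c0 ca]; rewrite (ltr0_norm a0) ler0_norm // lerN2.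
Qed.

Lemma differentiable_of_expand (V : normedModType R) (f : V -> R) (x : V) (L : {linear V -> R}) :
  continuous L ->
  (forall e, 0 < e -> \forall h \near (0 : V), `|f (h + x) - (f x + L h)| <= e * `|h|) ->
  differentiable f x /\ 'd f x = L :> (V -> R).
Proof.
move=> cL H; have E : f \o shift x = cst (f x) + L +o_ 0 id.
  by apply/eqaddoP => e e0; near=> h; exact: (near (H e e0) h).
have dE := diff_unique cL E.
by split=> //; apply/diff_locallyP; rewrite dE.
Unshelve. all: by end_near. Qed.

Lemma diff_expand (V W: normedModType R) (f : V -> W) (x : V) : differentiable f x ->
  forall e, 0 < e -> \forall h \near (0 : V), `|f (h + x) - (f x + 'd f x h)| <= e * `|h|.
Proof. by move=> /diff_locally /eqaddoP H e e0; exact: H e e0. Qed.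

Lemma entry_le_norm m (h : 'rV[R]_m) i : `|h 0 i| <= `|h|.
Proof.
rewrite [leRHS]/Num.Def.normr /= mx_normrE.
exact: (le_bigmax _ (fun i : 'I_1 * 'I_m => `|h i.1 i.2|) (0, i)).
Qed.

Lemma norm_row_le m (h : 'rV[R]_m) (a : R) : 0 <= a ->
  (forall i, `|h 0 i| <= a) -> `|h| <= a.
Proof.
move=> a0 ha; rewrite /Num.Def.normr /= mx_normrE.
by apply: bigmax_le => // -[i j] _; rewrite ord1; exact: ha.
Qed.

Lemma continuous_at_near (T : topologicalType) (V : normedModType R) (f : T -> V) x e :
  {for x, continuous f} -> 0 < e -> \forall y \near x, `|f x - f y| < e.
Proof. by move=> /cvgrPdist_lt cf e0; exact: cf. Qed.

(** Going from x to x + h one coordinate at a time, the mean value theorem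
    turns each step into a partial derivative at a point near x, and the
    partial derivatives are continuous. *)
Lemma C1_differentiable m (U : set 'rV[R]_m) f x :
  open U -> U x -> Ck 1 U f -> differentiable f x.
Proof.
move=> oU Ux [_ C1].
pose D i := 'D_(delta_mx 0 i) f.
pose L (h : 'rV[R]_m) := \sum_i h 0 i * D i x.
have lL : linear L.
  move=> a u v; rewrite /L scaler_sumr -big_split; apply: eq_bigr => i _ /=.
  by rewrite !mxE mulrDl -mulrA.
pose LM := GRing.isLinear.Build _ _ _ _ _ lL.
pose LL : {linear 'rV[R]_m -> R} := HB.pack L LM.
have cL : continuous LL.
  have CL : Ck 0 setT L.
    by apply: Ck_sum => [|i]; [exact: openT|apply: Ck_M; [exact: openT|exact: Ck_coord|exact: Ck_cst]].
  by move=> u; exact: (Ck_cont CL).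
suff H : forall e, 0 < e -> \forall h \near (0 : 'rV[R]_m),
    `|f (h + x) - (f x + LL h)| <= e * `|h| by have [] := differentiable_of_expand cL H.
move=> e' e0'; pose e := e' / m.+1%:R.
have e0 : 0 < e by rewrite divr_gt0 // ltr0n.
have : \forall y \near x, U y /\ forall i, `|D i x - D i y| < e.
  have H i : \forall y \near x, `|D i x - D i y| < e.
    have [_ [cD _]] := C1 (delta_mx 0 i).
    exact: continuous_at_near (cD x Ux) e0.
  near=> y; split; first by near: y; exact: open_nbhs_nbhs.
  by near: y; exact: filter_forall.
move=> /nbhs_ballP[d /= d0 dU]; apply/nbhs_ballP; exists d => // h /=.
rewrite -ball_normE /= sub0r normrN => hd.
have near_x y : `|y| <= `|h| -> U (y + x) /\ forall i, `|D i x - D i (y + x)| < e.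
  move=> yh; apply: dU; rewrite -ball_normE /= opprD addrCA subrr addr0 normrN.
  exact: le_lt_trans hd.
(* hk k is h with the coordinates from k on replaced by zeros. *)
pose hk k : 'rV[R]_m := \row_j (if (j < k)%N then h 0 j else 0).
have hkm : hk m = h by apply/rowP => j; rewrite mxE ltn_ord.
have key k : (k <= m)%N ->
    `|f (hk k + x) - (f x + \sum_(i < m | (i < k)%N) h 0 i * D i x)| <= k%:R * e * `|h|.
  elim: k => [|k IH] km.
    rewrite big_pred0 // (_ : hk 0 = 0) ?add0r ?addr0 ?subrr ?normr0 ?mul0r //.
    by apply/rowP => j; rewrite !mxE.
  pose i := Ordinal km.
  have Si : hk k.+1 = h 0 i *: delta_mx 0 i + hk k.
    apply/rowP => j; rewrite !mxE eqxx /= ltnS leq_eqVlt -val_eqE /=.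
    case: eqP => [E|_] /=; last by rewrite mulr0 add0r.
    by rewrite E ltnn mulr1 addr0; congr (h _ _); apply: val_inj.
  have bnd s : `|s| <= `|h 0 i| -> `|s *: delta_mx 0 i + hk k| <= `|h|.
    move=> sh; apply: norm_row_le => // j; rewrite !mxE eqxx /= -val_eqE /=.
    case: eqP => [E|_] /=.
      by rewrite E ltnn mulr1 addr0 (le_trans sh) // entry_le_norm.
    by rewrite mulr0 add0r; case: ifP => _; rewrite ?normr0 ?entry_le_norm.
  have [|s sh E] := MVT_line (f := f) (x := hk k + x) (v := delta_mx 0 i) (a := h 0 i).
    move=> s /bnd/near_x [Us _]; have [d1 _] := C1 (delta_mx 0 i).
    by apply: d1; rewrite addrA.
  have -> : \sum_(i0 < m | (i0 < k.+1)%N) h 0 i0 * D i0 x =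
     h 0 i * D i x + \sum_(i0 < m | (i0 < k)%N) h 0 i0 * D i0 x.
    rewrite (bigD1 i) //=; congr (_ + _); apply: eq_bigl => j.
    by rewrite ltnS leq_eqVlt -val_eqE /=; case: eqP => [->|_] /=; rewrite ?ltnn ?andbT.
  have -> : f (hk k.+1 + x) - (f x + (h 0 i * D i x + \sum_(i0 < m | (i0 < k)%N) h 0 i0 * D i0 x))
    = h 0 i * (D i (s *: delta_mx 0 i + (hk k + x)) - D i x) +
     (f (hk k + x) - (f x + \sum_(i < m | (i < k)%N) h 0 i * D i x)).
    rewrite mulrBr -E Si -addrA; ring.
  apply: le_trans (ler_normD _ _) _.
  rewrite -natr1 mulrDl mul1r mulrDl addrC; apply: lerD; first by apply: IH; exact: ltnW.
  rewrite normrM mulrC; apply: ler_pM => //; last exact: entry_le_norm.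
  by have /bnd/near_x[_ /(_ i)/ltW] := sh; rewrite distrC addrA.
have := key m (leqnn m); rewrite hkm.
rewrite (eq_bigl xpredT); last by move=> i; rewrite ltn_ord.
move=> /le_trans; apply; apply: ler_wpM2r => //.
by rewrite /e mulrA ler_pdivrMr ?ltr0n // mulrC ler_pM2l // ler_nat.
Unshelve. all: by end_near. Qed.

Lemma nbhs_and3 (T : topologicalType) (x : T) (P Q S : T -> Prop) :
  nbhs x P -> nbhs x Q -> nbhs x S -> nbhs x (fun y => [/\ P y, Q y & S y]).
Proof. by move=> hP hQ; apply: filterS3 hP hQ => y. Qed.

Lemma nbhs_forall (T : topologicalType) (x : T) (I : finType) (P : I -> T -> Prop) :
  (forall i, nbhs x (P i)) -> nbhs x (fun y => forall i, P i y).
Proof. by move=> H; exact: filter_forall. Qed.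

(** The second difference of f over a small parallelogram with sides h a and
    h b is h^2 times a mixed derivative at a nearby point, by the mean value
    theorem used twice, and the two orders of use give the two mixed
    derivatives. *)
Lemma schwarz m (U : set 'rV[R]_m) f x a b : open U -> U x -> Ck 2 U f ->
  'D_a ('D_b f) x = 'D_b ('D_a f) x.
Proof.
move=> oU Ux [_ C2]; apply/eqP; rewrite -subr_eq0 -normr_eq0 eq_le normr_ge0 andbT.
apply/ler_addgt0Pr => e e0; rewrite add0r.
have e20 : 0 < e / 2 by rewrite divr_gt0.
have : \forall y \near x, [/\ U y, `|'D_a ('D_b f) x - 'D_a ('D_b f) y| < e / 2
    & `|'D_b ('D_a f) x - 'D_b ('D_a f) y| < e / 2].
  have [_ [_ Ca]] := C2 a; have [_ [cab _]] := Ca b.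
  have [_ [_ Cb]] := C2 b; have [_ [cba _]] := Cb a.
  have N1 := open_nbhs_nbhs (conj oU Ux).
  have N2 := continuous_at_near (cba x Ux) e20.
  have N3 := continuous_at_near (cab x Ux) e20.
  exact: nbhs_and3 N1 N2 N3.
move=> /nbhs_ballP[d /= d0 dU].
pose h := d / 2 / (`|a| + `|b| + 1).
have c0 : 0 < `|a| + `|b| + 1 by rewrite ltr_wpDl // addr_ge0.
have h0 : 0 < h by rewrite !divr_gt0.
have hh : `|h| <= h by rewrite ger0_norm // ltW.
have bnd s t : `|s| <= h -> `|t| <= h -> ball x d (s *: a + (t *: b + x)).
  move=> sh th; rewrite -ball_normE /= addrA opprD addrCA subrr addr0 normrN.
  apply: le_lt_trans (ler_normD _ _) _; rewrite !normrZ.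
  apply: (@le_lt_trans _ _ (h * `|a| + h * `|b|)).
    by apply: lerD; apply: ler_wpM2r.
  have hc : h * (`|a| + `|b| + 1) = d / 2 by rewrite /h divfK ?gt_eqF.
  rewrite -mulrDr; apply: (@le_lt_trans _ _ (d / 2)); last by lra.
  by rewrite -hc ler_pM2l // lerDl.
have bnd' s t : `|s| <= h -> `|t| <= h -> ball x d (s *: b + (t *: a + x)).
  by move=> sh th; rewrite addrCA; exact: bnd.
have step (p q : 'rV[R]_m) : (forall s t, `|s| <= h -> `|t| <= h -> ball x d (s *: p + (t *: q + x))) ->
   exists s t, [/\ `|s| <= h, `|t| <= h &
   f (h *: p + (h *: q + x)) - f (h *: q + x) - (f (h *: p + x) - f x) =
   h * (h * 'D_q ('D_p f) (s *: p + (t *: q + x)))].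
  move=> B; pose g y := f (h *: q + y) - f y.
  have dg s : `|s| <= h -> is_derive (s *: p + x) p g
     ('D_p f (s *: p + (h *: q + x)) - 'D_p f (s *: p + x)).
    move=> sh; have [d1 _] := C2 p.
    have U1 : U (s *: p + x).
      by have := B s 0 sh; rewrite normr0 scale0r add0r => /(_ (ltW h0)) /dU [].
    have U2 : U (s *: p + (h *: q + x)).
      by have [] := dU _ (B s h sh hh).
    have D1 := derivableP (d1 _ U1).
    have D2 : is_derive (s *: p + x) p (fun y => f (h *: q + y))
       ('D_p f (s *: p + (h *: q + x))).
      have [H1 H2] := derivableP (d1 _ U2).
      have E : (fun k : R => k^-1 *: (((fun y => f (h *: q + y)) \o shift (s *: p + x)) (k *: p) -
          f (h *: q + (s *: p + x)))) = (fun k : R => k^-1 *: ((f \o shift (s *: p + (h *: q + x))) (k *: p) - f (s *: p + (h *: q + x)))).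
        apply/funext => k /=.
        by rewrite [h *: q + (k *: p + _)]addrCA ![h *: q + (s *: p + x)]addrCA.
      by apply: DeriveDef; rewrite /derivable ?/derive E.
    exact: is_deriveB.
  have [|s] := MVT_line (f := g) (x := x) (v := p) (a := h).
    by move=> s; rewrite (ger0_norm (ltW h0)) => /dg [].
  rewrite (ger0_norm (ltW h0)) => sh; have [_ ->] := dg s sh => E.
  have [|t] := MVT_line (f := 'D_p f) (x := s *: p + x) (v := q) (a := h).
    move=> t; rewrite (ger0_norm (ltW h0)) => th.
    have [_ [_ Cp]] := C2 p; have [+ _] := Cp q; apply.
    by have [] := dU _ (B s t sh th); rewrite addrCA.
  rewrite (ger0_norm (ltW h0)) => th E2; exists s, t; split=> //.
  rewrite [s *: p + (t *: q + x)]addrCA -E2 [h *: q + (s *: p + x)]addrCA.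
  rewrite -E /g [h *: q + (h *: p + x)]addrCA; ring.
have [s [t [sh th E1]]] := step a b bnd.
have [s' [t' [sh' th' E2]]] := step b a bnd'.
have E : 'D_b ('D_a f) (s *: a + (t *: b + x)) = 'D_a ('D_b f) (s' *: b + (t' *: a + x)).
  move: E1 E2; rewrite [h *: b + (h *: a + x)]addrCA.
  move: ('D_b ('D_a f) _) ('D_a ('D_b f) _) (f (h *: a + (h *: b + x))).
  move: (f (h *: b + x)) (f (h *: a + x)) (f x) => k1 k2 k3 X Y k4 E1 E2.
  by do 2![apply: (mulfI (lt0r_neq0 h0))]; rewrite -E1 -E2; ring.
have [_ _ A1] := dU _ (bnd s t sh th).
have [_ A2 _] := dU _ (bnd' s' t' sh' th').
rewrite -E in A2.
move: A1 A2; move: ('D_b ('D_a f) (s *: a + _)) ('D_a _ x) ('D_b _ x).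
move=> q r1 r2 A1 A2.
have -> : r1 - r2 = (r1 - q) - (r2 - q) by ring.
apply: le_trans (ler_normB _ _) _.
by clear - A1 A2; lra.
Qed.

Lemma derive_line (V W : normedModType R) (g : V -> W) (u v : V) :
  'D_1 (fun h : R => g (h *: v + u)) (0 : R) = 'D_v g u.
Proof.
rewrite /derive (_ : (fun h : R => h^-1 *: (((fun r : R => g (r *: v + u)) \o shift (0 : R)) _ - _)) =
  (fun h : R => h^-1 *: ((g \o shift u) (h *: v) - g u))) //.
by apply/funext => h /=; rewrite addr0 scale0r add0r [_%:A]mulr1.
Qed.

Lemma is_derive_comp (V W Z : normedModType R) (g : V -> W) (f : W -> Z) u v :
  derivable g u v -> differentiable f (g u) ->
  is_derive u v (f \o g) ('D_('D_v g u) f (g u)).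
Proof.
move=> dg df; pose c (h : R) := g (h *: v + u).
have c0 : c 0 = g u by rewrite /c scale0r add0r.
have dc : differentiable c (0 : R).
  by apply/derivable1_diffP; have /derivable1P := dg.
have df' : differentiable f (c 0) by rewrite c0.
have dfc : differentiable (f \o c) 0 by exact: differentiable_comp.
apply: DeriveDef.
  by apply/derivable1P; have /derivable1_diffP := dfc.
rewrite -derive_line -[LHS]/('D_1 (f \o c) 0) (deriveE _ dfc) (diff_comp dc df') /=.
by rewrite -(deriveE _ dc) c0 -(deriveE _ df) derive_line.
Qed.

Lemma derive_row m (V : normedModType R) (f : 'rV[R]_m -> V) u v :
  differentiable f u -> 'D_v f u = \sum_i v 0 i *: 'D_(delta_mx 0 i) f u.
Proof.
move=> df; rewrite deriveE // {1}(row_sum_delta v) linear_sum.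
by apply: eq_bigr => i _; rewrite linearZ /= -deriveE.
Qed.

Lemma derive_mxE m n (V : normedModType R) (g : V -> 'M[R]_(m, n)) u v i j :
  derivable g u v -> 'D_v g u i j = 'D_v (fun x => g x i j) u.
Proof. by move=> dg; rewrite derive_mx // mxE. Qed.

Lemma derivable_row n (V : normedModType R) (g : V -> 'rV[R]_n) u v :
  (forall i, derivable (fun x => g x 0 i) u v) -> derivable g u v.
Proof. by move=> dg; apply/derivable_mxP => i j; rewrite ord1. Qed.

Lemma continuous_row n (V : topologicalType) (g : V -> 'rV[R]_n) (u : V) :
  (forall i, {for u, continuous (fun x => g x 0 i)}) -> {for u, continuous g}.
Proof.
move=> cg; apply/cvgrPdist_lt => e e0.
have e20 : 0 < e / 2 by rewrite divr_gt0.
have : \forall x \near u, forall i, `|g u 0 i - g x 0 i| < e / 2.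
  by apply: filter_forall => i; exact: continuous_at_near (cg i) e20.
apply: filterS => x gx; apply: (@le_lt_trans _ _ (e / 2)); last by rewrite ltr_pdivrMr // ltr_pMr // ltr1n.
by apply: norm_row_le => [|i]; [exact: ltW|rewrite !mxE; exact: ltW].
Qed.

Definition Ckmap m n k (U : set 'rV[R]_m) (g : 'rV[R]_m -> 'rV[R]_n) :=
  forall i, Ck k U (fun u => g u 0 i).

Lemma Ckmap_cont m n k (U : set 'rV[R]_m) (g : 'rV[R]_m -> 'rV[R]_n) u :
  Ckmap k U g -> U u -> {for u, continuous g}.
Proof. by move=> Cg Uu; apply: continuous_row => i; exact: Ck_cont (Cg i) Uu. Qed.

Lemma Ckmap_derivable m n k (U : set 'rV[R]_m) (g : 'rV[R]_m -> 'rV[R]_n) u v :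
  Ckmap k.+1 U g -> U u -> derivable g u v.
Proof.
by move=> Cg Uu; apply: derivable_row => i; have [_ /(_ v)[+ _]] := Cg i; apply.
Qed.

Lemma Ck_differentiable m k (U : set 'rV[R]_m) f x :
  open U -> U x -> Ck k.+1 U f -> differentiable f x.
Proof.
move=> oU Ux; elim: k => [|k IH]; first exact: C1_differentiable.
by move/Ck_pred; exact: IH.
Qed.

Lemma Ck_derive m k (U : set 'rV[R]_m) f v : Ck k.+1 U f -> Ck k U ('D_v f).
Proof. by move=> [_ /(_ v)[]]. Qed.

Lemma Ck_derivable m k (U : set 'rV[R]_m) f u v :
  Ck k.+1 U f -> U u -> derivable f u v.
Proof. by move=> [_ /(_ v)[+ _]]; apply. Qed.

(** By the chain rule a derivative of f \o g is a sum of products of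
    derivatives of g with derivatives of f composed with g, to which the
    induction hypothesis applies. *)
Lemma Ck_comp m n k (U : set 'rV[R]_m) (W : set 'rV[R]_n) f g :
  open U -> open W -> (forall u, U u -> W (g u)) -> Ck k W f -> Ckmap k U g ->
  Ck k U (f \o g).
Proof.
move=> oU oW gUW; elim: k f g gUW => [|k IH] f g gUW Cf Cg.
  split=> // u Uu; apply: continuous_comp; first exact: Ckmap_cont Cg Uu.
  exact: Ck_cont Cf (gUW _ Uu).
split=> [u Uu|v].
  apply: continuous_comp; first exact: Ckmap_cont Cg Uu.
  exact: Ck_cont Cf (gUW _ Uu).
have D u : U u -> is_derive u v (f \o g)
    (\sum_i 'D_(delta_mx 0 i) f (g u) * 'D_v (fun x => g x 0 i) u).
  move=> Uu; have dg := Ckmap_derivable (v := v) Cg Uu.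
  have df := Ck_differentiable oW (gUW _ Uu) Cf.
  apply: is_derive_eq; first exact: is_derive_comp.
  rewrite derive_row //; apply: eq_bigr => i _.
  by rewrite derive_mxE // mulrC.
split=> [u /D []//|].
pose h u := \sum_i 'D_(delta_mx 0 i) f (g u) * 'D_v (fun x => g x 0 i) u.
have hD u : U u -> h u = 'D_v (f \o g) u by move=> /D [_ ->].
suff Ch : Ck k U h by exact: (Ck_eq oU hD Ch).
apply: Ck_sum => // i; apply: Ck_M => //.
  have Cg' : Ckmap k U g by move=> j; apply: Ck_pred; exact: Cg.
  exact: (IH ('D_(delta_mx 0 i) f) g gUW (Ck_derive (delta_mx 0 i) Cf) Cg').
exact: Ck_derive v (Cg i).
Qed.

Lemma smooth_on_openP m (U : set 'rV[R]_m) f : open U ->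
  smooth_on U f <-> forall k, Ck k U f.
Proof.
move=> oU; split=> [sf k|Cf u Uu]; last by exists U, f; split.
apply: Ck_local => u Uu; have [V [g [oV Vu Cg fg]]] := sf u Uu.
exists (U `&` V) => //; apply: (@Ck_eq _ _ _ g).
- exact: openI.
- by move=> x [Ux Vx]; rewrite fg.
- by apply: Ck_sub (Cg k) => x [].
Qed.

End Smooth.

(** * Derivatives relative to a set of times *)

Section Within.
Context {R : realType}.

(** The limit that occurs in has_velocity.  On the time interval [0, 1] it is
    a derivative, one-sided at the end points; all curves below are
    differentiated in this sense. *)
Definition dwithin (V : normedModType R) (J : set R) (f : R -> V) (t : R) (l : V) :=
  (fun s => (s - t)^-1 *: (f s - f t)) @ within J (t^') --> l.

(** First order expansions, unlike difference quotients, make sense at s = t,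
    which is what chain rules need. *)
Lemma dwithinP (V : normedModType R) J (f : R -> V) t l : dwithin J f t l <->
  forall e, 0 < e -> exists2 d, 0 < d &
    forall s, J s -> `|s - t| < d -> `|f s - f t - (s - t) *: l| <= e * `|s - t|.
Proof.
split=> [H e e0|H].
  have /cvgrPdist_le /(_ e e0) := H.
  rewrite near_withinE => /nbhs_ballP[d /= d0 dH]; exists d => // s Js sd.
  have [->|st] := eqVneq s t; first by rewrite !subrr scale0r subrr !normr0 mulr0.
  have st0 : s - t != 0 by rewrite subr_eq0.
  have := dH s; rewrite -ball_normE /= distrC => /(_ sd st Js) K.
  have -> : f s - f t - (s - t) *: l = - ((s - t) *: (l - (s - t)^-1 *: (f s - f t))).
    by rewrite [in RHS]scalerBr scalerA mulfV // scale1r opprB.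
  by rewrite normrN normrZ mulrC ler_wpM2r.
apply/cvgrPdist_le => e e0; have [d d0 dH] := H e e0.
rewrite near_withinE; apply/nbhs_ballP; exists d => // s /=.
rewrite -ball_normE /= distrC => sd st Js.
have st0 : s - t != 0 by rewrite subr_eq0.
have -> : l - (s - t)^-1 *: (f s - f t) = - ((s - t)^-1 *: (f s - f t - (s - t) *: l)).
  by rewrite [in RHS]scalerBr scalerA mulVf // scale1r opprB.
rewrite normrN normrZ normfV mulrC ler_pdivrMr ?normr_gt0 //.
exact: dH.
Qed.

Lemma subr_split (V : zmodType) (a b c d : V) : a - b - c = a - (b + d) + (d - c).
Proof. by rewrite opprD [RHS]addrA (addrA a) subrK. Qed.

Lemma dw_comp (V W : normedModType R) J (f : R -> V) (g : V -> W) t l :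
  dwithin J f t l -> differentiable g (f t) -> dwithin J (g \o f) t ('D_l g (f t)).
Proof.
move=> /dwithinP df dg; apply/dwithinP => e e0; rewrite deriveE //.
have cd : continuous ('d g (f t)) by exact: diff_continuous.
have [k k0 kd] := linear_lipschitz cd.
pose e1 := e / 2 / (`|l| + 1).
have c0 : 0 < `|l| + 1 by rewrite ltr_wpDl.
have e10 : 0 < e1 by rewrite !divr_gt0.
have e1c : e1 * (`|l| + 1) = e / 2 by rewrite /e1 divfK ?gt_eqF.
have /nbhs_ballP[d1 /= d10 H1] := diff_expand dg e10.
pose e2 := Num.min 1 (e / 2 / k).
have e20 : 0 < e2 by rewrite lt_min ltr01 !divr_gt0.
have [d2 d20 H2] := df e2 e20.
exists (Num.min d2 (d1 / (`|l| + 1))) => [|s Js]; first by rewrite lt_min d20 divr_gt0.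
rewrite lt_min => /andP[sd2 sd1].
have K := H2 s Js sd2; set h := f s - f t in K *.
have hb : `|h| <= `|s - t| * (`|l| + 1).
  rewrite -[h](subrK ((s - t) *: l)) (le_trans (ler_normD _ _)) // normrZ mulrDr mulr1 addrC lerD2l.
  by rewrite (le_trans K) // ler_piMl // ge_min lexx.
have hd : `|h| < d1 by rewrite (le_lt_trans hb) // -ltr_pdivlMr.
have /= G := H1 h; rewrite -ball_normE /= sub0r normrN in G; move/(_ hd) in G.
rewrite subrK in G.
have -> : g (f s) - g (f t) - (s - t) *: 'd g (f t) l =
    (g (f s) - (g (f t) + 'd g (f t) h)) + 'd g (f t) (h - (s - t) *: l).
  have Ed : 'd g (f t) (h - (s - t) *: l) = 'd g (f t) h - (s - t) *: 'd g (f t) l.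
    by rewrite linearB linearZ.
  by rewrite Ed; exact: subr_split.
rewrite (le_trans (ler_normD _ _)) // (splitr e) mulrDl lerD //.
  rewrite (le_trans G) // (le_trans (ler_wpM2l (ltW e10) hb)) //.
  by rewrite mulrCA e1c mulrC.
rewrite (le_trans (kd _)) // (le_trans (ler_wpM2l (ltW k0) K)) // mulrA ler_wpM2r //.
by rewrite -ler_pdivlMl // mulrC ge_min lexx orbT.
Qed.

Lemma dw_derivable (V : normedModType R) J (f : R -> V) t :
  derivable f t 1 -> dwithin J f t ('D_1 f t).
Proof.
move=> df; apply: (@dw_comp _ _ J id f t 1); last exact/derivable1_diffP.
apply/dwithinP => e e0; exists 1 => // s _ _.
by rewrite [_ *: 1]mulr1 subrr normr0 mulr_ge0 // ltW.
Qed.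

Lemma dw_is_derive (V : normedModType R) J (f : R -> V) (t : R) l :
  is_derive t (1 : R) f l -> dwithin J f t l.
Proof. by move=> [df <-]; exact: dw_derivable. Qed.

Lemma dw_cst (V : normedModType R) J (a : V) t : dwithin J (cst a) t 0.
Proof.
apply/dwithinP => e e0; exists 1 => // s _ _.
by rewrite /cst subrr scaler0 subrr normr0 mulr_ge0 // ltW.
Qed.

Lemma dw_eq (V : normedModType R) J (f g : R -> V) t l :
  (\forall s \near t, J s -> f s = g s) -> f t = g t ->
  dwithin J f t l -> dwithin J g t l.
Proof.
move=> /nbhs_ballP[d1 /= d10 fg] fgt /dwithinP df; apply/dwithinP => e e0.
have [d2 d20 H2] := df e e0; exists (Num.min d1 d2) => [|s Js].
  by rewrite lt_min d10.
rewrite lt_min => /andP[s1 s2]; rewrite -fgt -fg //; first exact: H2.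
by rewrite -ball_normE /= distrC.
Qed.

Lemma dw_cvg (V : normedModType R) J (f : R -> V) t l e : 0 < e ->
  dwithin J f t l -> \forall s \near t, J s -> `|f s - f t| < e.
Proof.
move=> e0 /dwithinP df; have [d d0 H] := df 1 ltr01.
have c0 : 0 < `|l| + 1 by rewrite ltr_wpDl.
apply/nbhs_ballP; exists (Num.min d (e / (`|l| + 1))) => /= [|s].
  by rewrite lt_min d0 divr_gt0.
rewrite -ball_normE /= distrC lt_min => /andP[sd se] Js; have := H s Js sd.
rewrite mul1r => K; rewrite -[f s - f t](subrK ((s - t) *: l)).
rewrite (le_lt_trans (ler_normD _ _)) // normrZ.
rewrite (@le_lt_trans _ _ (`|s - t| * (`|l| + 1))) -?ltr_pdivlMr //.
by rewrite mulrDr mulr1 addrC lerD2l.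
Qed.

Lemma dw_uniq (V : normedModType R) J (f : R -> V) t l l' :
  (forall d, 0 < d -> exists2 s, J s & 0 < `|s - t| < d) ->
  dwithin J f t l -> dwithin J f t l' -> l = l'.
Proof.
move=> acc /dwithinP H /dwithinP H'; apply/eqP; rewrite -subr_eq0 -normr_eq0.
rewrite eq_le normr_ge0 andbT; apply/ler_addgt0Pr => e e0; rewrite add0r.
have e20 : 0 < e / 2 by rewrite divr_gt0.
have [d d0 K] := H _ e20; have [d' d0' K'] := H' _ e20.
have [|s Js /andP[s0]] := acc (Num.min d d'); first by rewrite lt_min d0.
rewrite lt_min => /andP[sd sd'].
have A := K s Js sd; have A' := K' s Js sd'.
rewrite -(@ler_pM2l _ `|s - t|) // -normrZ.
have -> : (s - t) *: (l - l') = (f s - f t - (s - t) *: l') - (f s - f t - (s - t) *: l).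
  by rewrite scalerBr opprB [RHS]addrC addrA subrK.
rewrite (le_trans (ler_normB _ _)) // (splitr e) mulrDr lerD // mulrC //.
Qed.

Lemma dw_D (V : normedModType R) J (f g : R -> V) t l k :
  dwithin J f t l -> dwithin J g t k -> dwithin J (fun s => f s + g s) t (l + k).
Proof.
move=> df dg; rewrite /dwithin (_ : (fun s => _) =
  (fun s => (s - t)^-1 *: (f s - f t) + (s - t)^-1 *: (g s - g t))).
  exact: cvgD df dg.
by apply/funext => s; rewrite -scalerDr opprD addrACA.
Qed.

Lemma dw_Z (V : normedModType R) J (f : R -> V) t l (a : R) :
  dwithin J f t l -> dwithin J (fun s => a *: f s) t (a *: l).
Proof.
move=> df; rewrite /dwithin (_ : (fun s => _) = (fun s => a *: ((s - t)^-1 *: (f s - f t)))).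
  exact: cvgZl_tmp df.
by apply/funext => s; rewrite -[in LHS]scalerBr !scalerA mulrC.
Qed.

Lemma dw_row n J (f : R -> 'rV[R]_n) t (l : 'rV[R]_n) :
  (forall i, dwithin J (fun s => f s 0 i) t (l 0 i)) <-> dwithin J f t l.
Proof.
split=> [H|H i].
  apply/cvgrPdist_le => e e0.
  have : \forall s \near within J (t^'), forall i, `|l 0 i - (s - t)^-1 *: (f s 0 i - f t 0 i)| <= e.
    by apply: filter_forall => i; have /cvgrPdist_le := H i; apply.
  apply: filterS => s Hs; apply: norm_row_le => [|i]; first exact: ltW.
  by have := Hs i; rewrite !mxE.
have := dw_comp H (differentiable_coord (f t) 0 i).
by have [_ ->] := is_derive_coord l (f t) 0 i.
Qed.

Lemma dw_M J (f g : R -> R) t l k :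
  dwithin J f t l -> dwithin J g t k ->
  dwithin J (fun s => f s * g s) t (l * g t + f t * k).
Proof.
move=> df dg; have cg : g @ within J t^' --> g t.
  apply/cvgrPdist_lt => e e0; have := dw_cvg e0 dg; rewrite near_withinE.
  move=> /nbhs_ballP[d /= d0 H]; apply/nbhs_ballP; exists d => // s sd _ Js.
  by rewrite distrC; exact: H.
rewrite /dwithin (_ : (fun s => _) = (fun s => (s - t)^-1 *: (f s - f t) * g s + f t * ((s - t)^-1 *: (g s - g t)))).
  by apply: cvgD; [exact: cvgM df cg|exact: cvgZl_tmp dg].
by apply/funext => s; rewrite /GRing.scale /=; ring.
Qed.

(** Continuous induction: a property of segments that is additive and holds
    for the short segments around each point holds for [a, b].  All passages
    from local to global along a curve go through it: constancy, gluing of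
    lifts, addition of infinitesimal variations, uniform continuity. *)
Lemma cousin (P : R -> R -> Prop) a b : a <= b ->
  (forall x y z, a <= x -> x <= y -> y <= z -> z <= b -> P x y -> P y z -> P x z) ->
  (forall t, a <= t <= b -> exists2 d, 0 < d & forall x y, a <= x -> y <= b ->
     x <= t <= y -> t - d < x -> y < t + d -> P x y) ->
  P a b.
Proof.
move=> ab glue loc.
pose E := [set t | a <= t <= b /\ P a t].
have Ea : E a.
  split; first by rewrite lexx.
  have [|d d0] := loc a; first by rewrite lexx.
  by apply; rewrite ?lexx //; lra.
have bE : has_ubound E by exists b => t [/andP[]].
have sE : has_sup E by split => //; exists a.
set s := sup E.
have as_ : a <= s by exact: ub_le_sup.
have sb : s <= b by apply: ge_sup => // [|t [/andP[]//]]; exists a.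
have [|d d0 H] := loc s; first by rewrite as_.
have [t [/andP[at_ tb] Pat] st] := sup_adherent d0 sE.
have ts : t <= s by apply: ub_le_sup => //; split=> //; rewrite at_ tb.
have Ps y : s <= y -> y <= b -> y < s + d -> P a y.
  move=> sy yb yd; apply: (glue a t y) => //; first exact: le_trans sy.
  by apply: H => //; rewrite ts.
have [|bs] := ltP s b; last by apply: Ps => //; lra.
move=> sltb; pose y := Num.min b (s + d / 2).
have sy : s < y by rewrite /y lt_min sltb ltrDl divr_gt0.
have yb : y <= b by rewrite /y ge_min lexx.
have yd : y < s + d by rewrite /y gt_min ltrD2l ltr_pdivrMr // ltr_pMr // ltr1n orbT.
have : y <= s.
  by apply: ub_le_sup => //; split; [rewrite yb (le_trans as_) // ltW|apply: Ps => //; exact: ltW].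
by rewrite leNgt sy.
Qed.

(** Around each point the increments are at most e times the length of the
    segment, and this estimate is additive. *)
Lemma dw_zero_const (V : normedModType R) (J : set R) (f : R -> V) a b : a <= b ->
  (forall t, a <= t <= b -> J t) ->
  (forall t, a <= t <= b -> dwithin J f t 0) -> f a = f b.
Proof.
move=> ab Jab df; apply/eqP; rewrite -subr_eq0 -normr_eq0 eq_le normr_ge0 andbT.
apply/ler_addgt0Pr => e' e0'; rewrite add0r.
pose e := e' / (b - a + 1).
have c0 : 0 < b - a + 1 by rewrite ltr_wpDl // subr_ge0.
have e0 : 0 < e by rewrite divr_gt0.
(* e is e' / (b - a + 1), and not e' / (b - a), to allow a = b. *)
suff H : `|f a - f b| <= e * (b - a).
  by rewrite (le_trans H) // /e mulrAC ler_pdivrMr // ler_pM2l // lerDl.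
apply: (@cousin (fun x y => `|f x - f y| <= e * (y - x)) a b ab).
  move=> x y z _ _ _ _ H1 H2; rewrite -(subrK (f y) (f x)) -addrA.
  rewrite (le_trans (ler_normD _ _)) //; apply: le_trans (lerD H1 H2) _.
  by rewrite -mulrDr; lra.
move=> t tab; have /dwithinP /(_ e e0)[d d0 H] := df t tab.
exists d => // x y ax yb /andP[xt ty] xd yd.
have Jx : J x by apply: Jab; rewrite ax (le_trans xt) // (le_trans ty).
have Jy : J y by apply: Jab; rewrite yb (le_trans ax) // (le_trans xt).
have xd' : `|x - t| < d by rewrite ler0_norm ?subr_le0 //; lra.
have yd' : `|y - t| < d by rewrite ger0_norm ?subr_ge0 //; lra.
have H1 := H x Jx xd'; have H2 := H y Jy yd'; rewrite !scaler0 !subr0 in H1 H2.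
rewrite -(subrK (f t) (f x)) -addrA (le_trans (ler_normD _ _)) //.
rewrite (distrC (f t)); apply: le_trans (lerD H1 H2) _.
rewrite (ler0_norm (_ : x - t <= 0)) ?subr_le0 // (ger0_norm (_ : 0 <= y - t)) ?subr_ge0 //.
by rewrite -mulrDr; lra.
Qed.

Definition cderiv (J : set R) (z : R -> R[i]) (t : R) (l : R[i]) :=
  dwithin J (fun s => complex.Re (z s)) t (complex.Re l) /\
  dwithin J (fun s => complex.Im (z s)) t (complex.Im l).

Lemma cReM (x y : R[i]) : complex.Re (x * y) =
  complex.Re x * complex.Re y - complex.Im x * complex.Im y.
Proof. by case: x y => [a b] [c d]. Qed.

Lemma cImM (x y : R[i]) : complex.Im (x * y) =
  complex.Re x * complex.Im y + complex.Im x * complex.Re y.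
Proof. by case: x y => [a b] [c d]. Qed.

Lemma cReD (x y : R[i]) : complex.Re (x + y) = complex.Re x + complex.Re y.
Proof. by case: x y => [a b] [c d]. Qed.

Lemma cImD (x y : R[i]) : complex.Im (x + y) = complex.Im x + complex.Im y.
Proof. by case: x y => [a b] [c d]. Qed.

Lemma complexP (x y : R[i]) : complex.Re x = complex.Re y ->
  complex.Im x = complex.Im y -> x = y.
Proof. by case: x y => [a b] [c d] /= -> ->. Qed.

Lemma cd_cst (J : set R) (a : R[i]) t : cderiv J (cst a) t 0.
Proof. by split; exact: dw_cst. Qed.

Lemma cd_eq (J : set R) (f g : R -> R[i]) t l : (\forall s \near t, J s -> f s = g s) -> f t = g t ->
  cderiv J f t l -> cderiv J g t l.
Proof.
move=> fg fgt [H1 H2]; split.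
  by apply: dw_eq H1; rewrite ?fgt //; apply: filterS fg => s H /H ->.
by apply: dw_eq H2; rewrite ?fgt //; apply: filterS fg => s H /H ->.
Qed.

Lemma cd_M (J : set R) (f g : R -> R[i]) t l k : cderiv J f t l -> cderiv J g t k ->
  cderiv J (fun s => f s * g s) t (l * g t + f t * k).
Proof.
move=> [f1 f2] [g1 g2]; split.
  rewrite (_ : complex.Re _ = (complex.Re l * complex.Re (g t) + complex.Re (f t) * complex.Re k) +
    (-1) *: (complex.Im l * complex.Im (g t) + complex.Im (f t) * complex.Im k)).
    rewrite (_ : (fun s => _) = (fun s => complex.Re (f s) * complex.Re (g s) + (-1) *: (complex.Im (f s) * complex.Im (g s)))).
      by apply: dw_D; [exact: dw_M|apply: dw_Z; exact: dw_M].
    by apply/funext => s; rewrite cReM scaleN1r.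
  rewrite cReD !cReM scaleN1r; ring.
rewrite (_ : complex.Im _ = (complex.Re l * complex.Im (g t) + complex.Re (f t) * complex.Im k) +
    (complex.Im l * complex.Re (g t) + complex.Im (f t) * complex.Re k)).
  rewrite (_ : (fun s => _) = (fun s => complex.Re (f s) * complex.Im (g s) + (complex.Im (f s) * complex.Re (g s)))).
    by apply: dw_D; exact: dw_M.
  by apply/funext => s; rewrite cImM.
rewrite cImD !cImM; ring.
Qed.

Lemma cd_zero_const (J : set R) (z : R -> R[i]) a b : a <= b ->
  (forall t, a <= t <= b -> J t) ->
  (forall t, a <= t <= b -> cderiv J z t 0) -> z a = z b.
Proof.
move=> ab Jab dz; apply: complexP.
  by apply: (@dw_zero_const R^o J (fun s => complex.Re (z s)) a b ab Jab) => t /dz[].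
by apply: (@dw_zero_const R^o J (fun s => complex.Im (z s)) a b ab Jab) => t /dz[].
Qed.

Lemma cd_uniq (J : set R) (z : R -> R[i]) t l l' :
  (forall d, 0 < d -> exists2 s, J s & 0 < `|s - t| < d) ->
  cderiv J z t l -> cderiv J z t l' -> l = l'.
Proof.
move=> acc [h1 h2] [h1' h2']; apply: complexP; first exact: dw_uniq acc h1 h1'.
exact: dw_uniq acc h2 h2'.
Qed.

Lemma dw_N (J : set R) (f : R -> R) t l : dwithin J f t l -> dwithin J (fun s => - f s) t (- l).
Proof.
move=> df; rewrite -scaleN1r (_ : (fun s => _) = (fun s => (-1) *: f s)); first exact: dw_Z.
by apply/funext => s; rewrite scaleN1r.
Qed.

Lemma dw_real_comp (J : set R) (g h : R -> R) t l k :
  is_derive (h t) (1 : R) g k -> dwithin J h t l ->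
  dwithin J (fun s => g (h s)) t (k * l).
Proof.
move=> [dg dgE] dh; have dg' : differentiable g (h t) by exact/derivable1_diffP.
have := dw_comp dh dg'; rewrite (deriveE _ dg').
have -> : 'd g (h t) l = l *: 'd g (h t) (1 : R).
  by rewrite -linearZ; congr ('d g (h t) _); rewrite [RHS]mulr1.
by rewrite -(deriveE _ dg') dgE [_ *: _]mulrC.
Qed.

Lemma cd_V (J : set R) (z : R -> R[i]) t l : z t != 0 -> cderiv J z t l ->
  cderiv J (fun s => (z s)^-1) t (- l / (z t) ^+ 2).
Proof.
move=> zt0 [h1 h2].
pose n s := complex.Re (z s) ^+ 2 + complex.Im (z s) ^+ 2.
have nt0 : n t != 0.
  apply: contra zt0; rewrite /n addr_eq0 => /eqP E.
  have E2 : complex.Re (z t) ^+ 2 = 0.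
    by apply/eqP; rewrite eq_le sqr_ge0 andbT E oppr_le0 sqr_ge0.
  move/eqP: E2 (E); rewrite sqrf_eq0 => /eqP r0.
  rewrite r0 expr0n /= => /eqP; rewrite eq_sym oppr_eq0 sqrf_eq0 => /eqP i0.
  by apply/eqP; apply: complexP.
have dn : dwithin J n t (2 * (complex.Re (z t) * complex.Re l + complex.Im (z t) * complex.Im l)).
  rewrite (_ : 2 * _ = (complex.Re l * complex.Re (z t) + complex.Re (z t) * complex.Re l) +
     (complex.Im l * complex.Im (z t) + complex.Im (z t) * complex.Im l)); last by ring.
  rewrite /n (_ : (fun s => _) = (fun s => complex.Re (z s) * complex.Re (z s) + complex.Im (z s) * complex.Im (z s))) //.
  by apply: dw_D; apply: dw_M.
have dni : dwithin J (fun s => (n s)^-1) t (- (n t) ^- 2 * (2 * (complex.Re (z t) * complex.Re l + complex.Im (z t) * complex.Im l))).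
  apply: (@dw_real_comp J (fun x => x^-1) n) dn.
  apply: is_derive_eq; first exact: (is_deriveV (f := id) nt0 (is_derive_id _ _)).
  by rewrite /GRing.scale /= mulr1.
have E s : (z s)^-1 = (complex.Re (z s) * (n s)^-1) +i* (- complex.Im (z s) * (n s)^-1).
  by rewrite /n; case: (z s) => a b /=; rewrite /GRing.inv /= mulNr.
have El : - l / (z t) ^+ 2 = (complex.Re l * (n t)^-1 + complex.Re (z t) * (- (n t) ^- 2 * (2 * (complex.Re (z t) * complex.Re l + complex.Im (z t) * complex.Im l)))) +i*
   (- complex.Im l * (n t)^-1 + - complex.Im (z t) * (- (n t) ^- 2 * (2 * (complex.Re (z t) * complex.Re l + complex.Im (z t) * complex.Im l)))).
  rewrite expr2 invfM E; move: nt0; rewrite /n.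
  case: l {h1 h2 dn dni} => a b; move: (complex.Re (z t)) (complex.Im (z t)) => x y nt0.
  by apply: complexP; rewrite !(cReM, cImM) /=; field.
rewrite El; split => /=.
  rewrite (_ : (fun s => _) = (fun s => complex.Re (z s) * (n s)^-1)); last by apply/funext => s; rewrite E.
  exact: dw_M.
rewrite (_ : (fun s => _) = (fun s => - complex.Im (z s) * (n s)^-1)).
  by apply: dw_M dni; exact: dw_N.
by apply/funext => s; rewrite E.
Qed.

Lemma cd_real (J : set R) (h : R -> R) t l :
  dwithin J h t l -> cderiv J (fun s => (h s)%:C) t (l%:C).
Proof. by move=> dh; split=> //=; exact: dw_cst. Qed.

Lemma cd_expi (J : set R) (h : R -> R) t l :
  dwithin J h t l -> cderiv J (fun s => expi (h s)) t ((0 +i* l) * expi (h t)).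
Proof.
move=> dh; split; rewrite ?cReM ?cImM /=.
  rewrite mul0r add0r -mulrN mulrC.
  by apply: (dw_real_comp (g := @cos R)) dh; exact: is_derive_cos.
rewrite mul0r add0r mulrC.
by apply: (dw_real_comp (g := @sin R)) dh; exact: is_derive_sin.
Qed.

Definition cexp (w : R[i]) : R[i] := (expR (complex.Re w))%:C * expi (complex.Im w).

Lemma cd_cexp (J : set R) (h : R -> R[i]) t l :
  cderiv J h t l -> cderiv J (fun s => cexp (h s)) t (l * cexp (h t)).
Proof.
move=> [h1 h2].
have d1 := cd_real (dw_real_comp (is_derive_expR (complex.Re (h t))) h1).
have := cd_M d1 (cd_expi h2); congr cderiv; rewrite /cexp.
case: l {h1 h2 d1} => a b; rewrite rmorphM /=.
rewrite (_ : a +i* b = a%:C + (0 +i* b)); last by apply: complexP; rewrite /= ?addr0 ?add0r.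
ring.
Qed.

Lemma expi0 : expi (0 : R) = 1.
Proof. by rewrite /expi cos0 sin0. Qed.

Lemma expiD (a b : R) : expi (a + b) = expi a * expi b.
Proof. by apply: complexP; rewrite ?cReM ?cImM /= ?cosD ?sinD //; ring. Qed.

Lemma expi_neq0 (a : R) : expi a != 0.
Proof.
apply/eqP => E; have := expiD a (- a); rewrite E mul0r subrr expi0.
by move/eqP; rewrite oner_eq0.
Qed.

Lemma cexp_neq0 w : cexp w != 0.
Proof.
by rewrite mulf_neq0 ?expi_neq0 // fmorph_eq0 gt_eqF // expR_gt0.
Qed.

End Within.

(** * Integrals of continuous functions *)

Section Integrals.
Context {R : realType}.
Notation mu := (@lebesgue_measure R).

Definition rint (a b : R) (g : R -> R) : R :=
  (\int[mu]_(x in `[a, b]) g x)%R.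

Lemma continuous_itv_integrable (g : R -> R) c d :
  (forall x, c <= x <= d -> {for x, continuous g}) ->
  mu.-integrable `[c, d] (EFin \o g).
Proof.
move=> cg; apply: continuous_compact_integrable; first exact: segment_compact.
apply/subspace_continuousP => x /=; rewrite in_itv /= => xcd.
by apply: cvg_within_filter; exact: cg.
Qed.

(** The primitive is only claimed to be differentiable in the open interval;
    a segment has to be enlarged before the lemma is used on it. *)
Lemma rint_primitive (g : R -> R) c d :
  (forall x, c <= x <= d -> {for x, continuous g}) ->
  exists F : R -> R, (forall x : R, c < x < d -> is_derive x (1 : R) F (g x)) /\
    (forall a b, c < a -> a <= b -> b < d -> rint a b g = F b - F a).
Proof.
move=> cg; exists (fun x => rint c x g).
have ig u : u <= d -> mu.-integrable `[c, u] (EFin \o g).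
  move=> ud; apply: continuous_itv_integrable => x /andP[cx xu].
  by apply: cg; rewrite cx (le_trans xu).
split=> [x /andP[cx xd]|a b ca ab bd].
  have [||D1 D2] := @continuous_FTC1_closed R g c x d xd _ cx.
  - exact: ig.
  - by apply: cg; rewrite !ltW.
  by apply: DeriveDef; [exact: D1|rewrite -derive1E; exact: D2].
have igb := ig b (ltW bd).
have B1 : (BLeft c <= BRight a)%O by rewrite bnd_simp ltW.
have B2 : (BRight a <= BRight b)%O by rewrite bnd_simp.
rewrite /rint (Rintegral_itvB igb B1 B2) Rintegral_itv_obnd_cbnd //.
apply: integrableS igb => // x /=; rewrite !in_itv /= => /andP[ax ->].
by rewrite andbT ltW // (lt_trans ca).
Qed.

(** F minus a primitive of g has zero derivative within J, hence is
    constant. *)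
Lemma rint_FTC2 (g F : R -> R) (J : set R) c d a b :
  (forall x, c <= x <= d -> {for x, continuous g}) ->
  c < a -> a <= b -> b < d -> (forall t, a <= t <= b -> J t) ->
  (forall t, a <= t <= b -> dwithin J F t (g t)) -> rint a b g = F b - F a.
Proof.
move=> cg ca ab bd Jab dF; have [G [dG ->]] := rint_primitive cg => //.
have : F a + - G a = F b + - G b.
  apply: (@dw_zero_const R R^o J (fun t => F t + - G t) a b ab Jab) => t tab.
  rewrite -(addrN (g t)); apply: dw_D; first exact: dF.
  apply: dw_N; apply: dw_is_derive; apply: dG; case/andP: tab => at_ tb.
  by rewrite (lt_le_trans ca) // (le_lt_trans tb).
by move=> E; lra.
Qed.

Lemma rint_cat (g : R -> R) a b c : (forall x, {for x, continuous g}) ->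
  a <= b -> b <= c -> rint a c g = rint a b g + rint b c g.
Proof.
move=> cg ab bc; have [|G [_ H]] := @rint_primitive g (a - 1) (c + 1); first by move=> x _.
by rewrite !H; lra.
Qed.

Lemma rint_diff (H dH : R -> R -> R) (u0 a b d B : R) : 0 < d ->
  (forall u, `|u - u0| < d -> mu.-integrable `[a, b] (EFin \o H u)) ->
  (forall u v, `|u - u0| < d -> a <= v <= b ->
    is_derive u (1 : R) (H ^~ v) (dH u v)) ->
  (forall u v, `|u - u0| < d -> a <= v <= b -> `|dH u v| <= B) ->
  is_derive u0 (1 : R) (fun u => rint a b (H u)) (rint a b (dH u0)).
Proof.
move=> d0 iH DH bH.
have inI u : `]u0 - d, u0 + d[%classic u -> `|u - u0| < d.
  by rewrite /= in_itv /= ltr_distl.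
have mab : measurable (`[a, b]%classic : set (measurableTypeR R)) by exact: measurable_itv.
have Iu0 : `]u0 - d, u0 + d[%classic u0 by rewrite /= in_itv /=; apply/andP; split; lra.
have dE u v : `]u0 - d, u0 + d[%classic u -> `[a, b]%classic v -> partial1of2 H u v = dH u v.
  move=> /inI uI; rewrite /= in_itv /= => vI; rewrite partial1of2E.
  by have [_ ->] := DH u v uI vI.
pose G := cst (Num.max B 0) : R -> R.
have G0 y : 0 <= G y by rewrite /G /= le_max lexx orbT.
have iG : mu.-integrable `[a, b] (EFin \o G).
  by apply: continuous_itv_integrable => x _; exact: cst_continuous.
have c1 u : `]u0 - d, u0 + d[%classic u -> mu.-integrable `[a, b] (EFin \o H u) by move=> /inI /iH.
have c2 u v : `]u0 - d, u0 + d[%classic u -> `[a, b]%classic v -> derivable (H ^~ v) u 1.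
  by move=> /inI uI; rewrite /= in_itv /= => vI; have [] := DH u v uI vI.
have c3 u v : `]u0 - d, u0 + d[%classic u -> `[a, b]%classic v -> `|partial1of2 H u v| <= G v.
  move=> uI vI; rewrite dE //; move/inI: uI => uI; move: vI; rewrite /= in_itv /= => vI.
  by rewrite le_max bH.
apply: DeriveDef.
  exact: (derivable_under_integral mab Iu0 c1 c2 G0 iG c3).
rewrite -derive1E (differentiation_under_integral mab Iu0 c1 c2 G0 iG c3).
by apply: eq_Rintegral => v /set_mem vI; rewrite dE.
Qed.

End Integrals.

(** * Functions, fields and curves in charts *)

Section Charts.
Context {R : realType} {m : nat} {M : topologicalType} (A : manifold R m M).
Implicit Types (c : chart R m M) (U : set M).

Lemma smooth_on_sub k (B B' : set 'rV[R]_k) f : B' `<=` B -> smooth_on B f -> smooth_on B' f.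
Proof.
move=> sB sf u /sB /sf [V [g [oV Vu Cg fg]]]; exists V, g; split=> // w /sB.
exact: fg.
Qed.

Lemma smooth_on_eq k (B : set 'rV[R]_k) f g : (forall u, B u -> f u = g u) ->
  smooth_on B f -> smooth_on B g.
Proof.
move=> fg sf u /sf [V [h [oV Vu Ch fh]]]; exists V, h; split=> // w Bw Vw.
by rewrite -fg // fh.
Qed.

Lemma cinvK c u : ccod c u -> cdom c (cinv c u) /\ cmap c (cinv c u) = u.
Proof. by move=> [x cx <-]; rewrite cmapK. Qed.

Lemma continuous_within_open (S T : topologicalType) (B : set S) (g : S -> T) u :
  open B -> {within B, continuous g} -> B u -> {for u, continuous g}.
Proof.
by move=> oB; rewrite continuous_open_subspace // => cg Bu; apply: cg; rewrite inE.
Qed.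

Definition cimg c U : set 'rV[R]_m := cmap c @` (cdom c `&` U).

Lemma cimgP c U u : cimg c U u <-> ccod c u /\ U (cinv c u).
Proof.
split=> [[x [cx Ux] <-]|[[x cx <-]]]; first by split; [exists x|rewrite cmapK].
by rewrite cmapK // => Ux; exists x.
Qed.

Lemma cinv_continuous c u : ccod c u -> {for u, continuous (cinv c)}.
Proof. by apply: continuous_within_open; [exact: ccod_open|exact: cinv_cont]. Qed.

Lemma cmap_continuous c x : cdom c x -> {for x, continuous (cmap c)}.
Proof. by apply: continuous_within_open; [exact: cdom_open|exact: cmap_cont]. Qed.

Lemma cimg_open c U : open U -> open (cimg c U).
Proof.
move=> oU; rewrite openE => u /cimgP[cu Uu]; rewrite /interior.
have N1 : nbhs u (ccod c) by apply: open_nbhs_nbhs; split=> //; exact: ccod_open.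
have N2 : nbhs u (cinv c @^-1` U) by apply: (cinv_continuous cu); exact: open_nbhs_nbhs.
by apply: filterS (filterI N1 N2) => v [? ?]; apply/cimgP.
Qed.

Lemma cimg_sub c U V : U `<=` V -> cimg c U `<=` cimg c V.
Proof. by move=> UV u /cimgP[? /UV ?]; apply/cimgP. Qed.

Lemma cimg_mem c U x : cdom c x -> U x -> cimg c U (cmap c x).
Proof. by move=> cx Ux; exists x. Qed.

Lemma cimg_cdom c U u : cimg c U u -> [/\ ccod c u, cdom c (cinv c u), U (cinv c u) & cmap c (cinv c u) = u].
Proof. by move/cimgP => [cu Uu]; have [? ?] := cinvK cu. Qed.

Lemma smooth_fun_sub U V (f : M -> R) : U `<=` V -> smooth_fun A V f -> smooth_fun A U f.
Proof. by move=> UV sf c /sf; apply: smooth_on_sub; exact: cimg_sub. Qed.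

Lemma smooth_fun_eq U (f g : M -> R) : (forall x, U x -> f x = g x) ->
  smooth_fun A U f -> smooth_fun A U g.
Proof. by move=> fg sf c /sf; apply: smooth_on_eq => u /cimgP[_ /fg]. Qed.

Lemma smooth_funP U (f : M -> R) : open U -> smooth_fun A U f <->
  forall c, atlas A c -> forall k, Ck k (cimg c U) (f \o cinv c).
Proof.
move=> oU; split=> sf c Ac; last by apply/smooth_on_openP; [exact: cimg_open|exact: sf].
move=> k; have := sf c Ac; move/(iffLR (smooth_on_openP _ (@cimg_open c _ oU))); exact.
Qed.

Lemma transition_Ck c c' k : atlas A c -> atlas A c' ->
  Ckmap k (cimg c (cdom c')) (cmap c' \o cinv c).
Proof.
move=> Ac Ac' i; have := atlas_compat Ac Ac' i.
by move/(iffLR (smooth_on_openP _ (@cimg_open c _ (cdom_open c')))); exact.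
Qed.

Lemma smooth_fun_chart c U (h : 'rV[R]_m -> R) : atlas A c -> open U -> U `<=` cdom c ->
  (forall k, Ck k (cimg c U) h) -> smooth_fun A U (h \o cmap c).
Proof.
move=> Ac oU Uc Ch; apply/smooth_funP => // c' Ac' k.
apply: (@Ck_comp _ _ _ _ _ (cimg c U) h (cmap c \o cinv c')) => //.
- exact: cimg_open.
- exact: cimg_open.
- by move=> u /cimgP[_ Uu]; apply: cimg_mem => //; exact: Uc.
- move=> i; apply: Ck_sub (transition_Ck k Ac' Ac i).
  exact: cimg_sub.
Qed.

Lemma smooth_coord c i : atlas A c -> smooth_fun A (cdom c) (fun x => cmap c x 0 i).
Proof.
move=> Ac; apply: (@smooth_fun_chart c (cdom c) (fun u => u 0 i)) => // [|k].
  exact: cdom_open.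
exact: Ck_coord.
Qed.

Local Notation cat x := (chart_at A x).

Lemma chart_atlas x : atlas A (cat x). Proof. exact: chart_atP. Qed.

Lemma chart_dom x : cdom (cat x) x. Proof. exact: chart_at_dom. Qed.

Hint Resolve chart_atlas chart_dom : core.

Lemma smooth_fun_diff U (f : M -> R) c u : open U -> smooth_fun A U f -> atlas A c ->
  cimg c U u -> differentiable (f \o cinv c) u.
Proof.
move=> oU sf Ac Uu; move/(iffLR (smooth_funP _ oU)): sf => /(_ c Ac 1%N).
exact: C1_differentiable (@cimg_open c _ oU) Uu.
Qed.

(** The components of tvec are taken in chart_at, so this is the chain rule
    for the transition map from c to chart_at. *)
Lemma mdiff_tvec U (f : M -> R) c u a : open U -> smooth_fun A U f -> atlas A c ->
  cimg c U u -> mdiff A f (cinv c u) (tvec A c u a) = 'D_a (f \o cinv c) u.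
Proof.
move=> oU sf Ac Uu; have [cu cxu Uxu cK] := cimg_cdom Uu.
set x := cinv c u; rewrite /mdiff /tvec -/x.
have E : 'D_a (f \o cinv c) u = 'D_a ((f \o cinv (cat x)) \o (cmap (cat x) \o cinv c)) u.
  apply: near_eq_derive.
  have N : cimg c (cdom (cat x)) u by apply/cimgP.
  apply: filterS (open_nbhs_nbhs (conj (@cimg_open c _ (cdom_open _)) N)) => v.
  by move=> /cimg_cdom[_ _ d _] /=; rewrite cmapK.
have N : cimg c (cdom (cat x)) u by apply/cimgP.
have dg := Ckmap_derivable (v := a) (transition_Ck 1 Ac (chart_atlas x)) N.
have df : differentiable (f \o cinv (cat x)) ((cmap (cat x) \o cinv c) u).
  by apply: smooth_fun_diff sf _ _ => //; exact: cimg_mem.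
by rewrite E; have [_ ->] := is_derive_comp dg df.
Qed.

Lemma mdiff_row n U (g : M -> 'rV[R]_n) x v i : open U -> U x ->
  (forall i, smooth_fun A U (fun x => g x 0 i)) ->
  mdiff A g x v 0 i = mdiff A (fun x => g x 0 i) x v.
Proof.
move=> oU Ux sg; rewrite /mdiff derive_mxE //; apply: derivable_row => j.
by apply: diff_derivable; apply: (smooth_fun_diff oU (sg j)) => //; exact: cimg_mem.
Qed.

Lemma tvec_linear c u k a b : atlas A c -> ccod c u ->
  tvec A c u (k *: a + b) = k *: tvec A c u a + tvec A c u b.
Proof.
move=> Ac cu; rewrite /tvec; set c0 := cat _.
have N : cimg c (cdom c0) u by apply/cimgP; split=> //; exact: chart_dom.
have T := transition_Ck 1 Ac (chart_atlas (cinv c u)).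
have dT d := Ckmap_derivable (v := d) T N.
apply/rowP => i; rewrite [RHS]mxE [X in _ = X + _]mxE !(derive_mxE 0 i (dT _)).
have df := C1_differentiable (@cimg_open c _ (cdom_open _)) N (T i).
by rewrite !(deriveE _ df) linearP.
Qed.

End Charts.

Section Fields.
Context {R : realType} {m : nat} {M : topologicalType} (A : manifold R m M).
Implicit Types (c : chart R m M) (U : set M).
Local Notation cat x := (chart_at A x).
Hint Resolve chart_atlas chart_dom : core.

(** The field with constant components a in the chart c. *)
Definition cfield c (a : 'rV[R]_m) (x : M) := tvec A c (cmap c x) a.

Lemma mdiff_cfield c U (f : M -> R) x a : atlas A c -> cdom c x -> open U -> U x ->
  smooth_fun A U f -> mdiff A f x (cfield c a x) = 'D_a (f \o cinv c) (cmap c x).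
Proof.
move=> Ac cx oU Ux sf; have N : cimg c U (cmap c x) by exact: cimg_mem.
by have := mdiff_tvec a oU sf Ac N; rewrite cmapK.
Qed.

Lemma smooth_cderive c U (f : M -> R) a : atlas A c -> open U -> U `<=` cdom c ->
  smooth_fun A U f -> smooth_fun A U (fun x => 'D_a (f \o cinv c) (cmap c x)).
Proof.
move=> Ac oU Uc sf; apply: (@smooth_fun_chart _ _ _ A c U ('D_a (f \o cinv c))) => // k.
by apply: Ck_derive; move/(iffLR (smooth_funP A f oU)): sf => /(_ c Ac k.+1).
Qed.

Lemma smooth_cfield c U a : atlas A c -> open U -> U `<=` cdom c ->
  smooth_vfield A U (cfield c a).
Proof.
move=> Ac oU Uc c' Ac' i.
have oUc' : open (U `&` cdom c') by apply: openI => //; exact: cdom_open.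
have s1 : smooth_fun A (U `&` cdom c') (fun x => cmap c' x 0 i).
  by apply: smooth_fun_sub (smooth_coord i Ac') => x [].
apply: smooth_fun_eq (smooth_cderive a Ac oUc' _ s1); last by move=> x [/Uc].
move=> x [Ux c'x]; rewrite (@mdiff_row _ _ _ _ _ (cdom c')) //.
- by rewrite (mdiff_cfield _ Ac (Uc _ Ux) oUc' _ s1).
- exact: cdom_open.
- by move=> j; exact: smooth_coord.
Qed.

Lemma mdiff_near U (V : normedModType R) (f g : M -> V) x v : open U -> U x ->
  (forall y, U y -> f y = g y) -> mdiff A f x v = mdiff A g x v.
Proof.
move=> oU Ux fg; rewrite /mdiff; apply: near_eq_derive.
have N : cimg (cat x) U (cmap (cat x) x) by apply: cimg_mem => //; exact: chart_dom.
apply: filterS (open_nbhs_nbhs (conj (@cimg_open _ _ _ (cat x) _ oU) N)) => u.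
by move=> /cimgP[_ /fg].
Qed.

(** The bracket is computed in the chart chart_at x, whereas the fields are
    constant in c: both of its terms are the second derivatives of the
    transition map in the directions a and b, which are symmetric. *)
Lemma lie_bracket_cfield c a b x : atlas A c -> cdom c x ->
  lie_bracket A (cfield c a) (cfield c b) x = 0.
Proof.
move=> Ac cx; set c0 := cat x.
have oc : open (cdom c) by exact: cdom_open.
have oc0 : open (cdom c0) by exact: cdom_open.
pose U := cdom c `&` cdom c0.
have oU : open U by exact: openI.
have Ux : U x by split=> //; exact: chart_dom.
have Uc : U `<=` cdom c by move=> y [].
have sc i : smooth_fun A U (fun y => cmap c0 y 0 i).
  by apply: smooth_fun_sub (smooth_coord i (chart_atlas A x)) => y [].
pose G (e : 'rV[R]_m) (y : M) : 'rV[R]_m := \row_i 'D_e ((fun y => cmap c0 y 0 i) \o cinv c) (cmap c y).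
have sG e i : smooth_fun A U (fun y => G e y 0 i).
  apply: smooth_fun_eq (smooth_cderive e Ac oU Uc (sc i)) => y Uy; by rewrite mxE.
have E e y : U y -> mdiff A (cmap c0) y (cfield c e y) = G e y.
  move=> [cy c0y]; apply/rowP => i; rewrite mxE (@mdiff_row _ _ _ _ _ U) //.
  by rewrite (mdiff_cfield _ Ac cy oU _ (sc i)).
have K e e' i : mdiff A (fun y => mdiff A (cmap c0) y (cfield c e y)) x (cfield c e' x) 0 i =
    'D_e' ('D_e ((fun y => cmap c0 y 0 i) \o cinv c)) (cmap c x).
  rewrite (mdiff_near _ oU Ux (E e)) (@mdiff_row _ _ _ _ _ U) //.
  rewrite (mdiff_cfield _ Ac cx oU Ux (sG e i)); apply: near_eq_derive.
  have N : cimg c U (cmap c x) by exact: cimg_mem.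
  apply: filterS (open_nbhs_nbhs (conj (@cimg_open _ _ _ c _ oU) N)) => u.
  by move=> /cimg_cdom[_ _ _ uK] /=; rewrite mxE uK.
(* The i-th coordinate of H e e' is the mixed derivative of the i-th
   transition function. *)
pose H e e' : 'rV[R]_m := \row_i 'D_e' ('D_e ((fun y => cmap c0 y 0 i) \o cinv c)) (cmap c x).
have KH e e' : mdiff A (fun y => mdiff A (cmap c0) y (cfield c e y)) x (cfield c e' x) = H e e'.
  by apply/rowP => i; rewrite [RHS]mxE; exact: K.
have -> : lie_bracket A (cfield c a) (cfield c b) x = H b a - H a b.
  by rewrite -(KH b a) -(KH a b).
suff -> : H b a = H a b by rewrite subrr.
apply/rowP => i; rewrite [LHS]mxE [RHS]mxE.
have N : cimg c U (cmap c x) by exact: cimg_mem.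
apply: (schwarz _ _ (@cimg_open _ _ _ c _ oU) N).
by move/(iffLR (smooth_funP A _ oU)): (sc i) => /(_ c Ac 2%N).
Qed.

Lemma mvelocity_near J (g : R -> M) t v U : has_mvelocity A J g t v -> open U -> U (g t) ->
  \forall s \near t, J s -> U (g s).
Proof.
move=> [dn dv] oU Ut; set c0 := cat (g t) in dn dv.
have c0t : cdom c0 (g t) by exact: chart_dom.
have N : cimg c0 U (cmap c0 (g t)) by exact: cimg_mem.
have /nbhs_ballP[e /= e0 eU] := open_nbhs_nbhs (conj (@cimg_open _ _ _ c0 _ oU) N).
have dv' : dwithin J (cmap c0 \o g) t v by [].
have C := dw_cvg e0 dv'.
apply: filterS (filterI dn C) => s [H1 H2] Js.
have [] := cimg_cdom (eU (cmap c0 (g s)) _).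
  by rewrite -ball_normE /= distrC; exact: H2.
by move=> _ _ + _; rewrite cmapK //; exact: H1.
Qed.

Lemma mvelocity_fun J (g : R -> M) t v U (f : M -> R) :
  has_mvelocity A J g t v -> open U -> U (g t) -> smooth_fun A U f ->
  dwithin J (f \o g) t (mdiff A f (g t) v).
Proof.
move=> H oU Ut sf; have [dn dv] := H; set c0 := cat (g t) in dn dv.
have dv' : dwithin J (cmap c0 \o g) t v by [].
have c0t : cdom c0 (g t) by exact: chart_dom.
have df : differentiable (f \o cinv c0) ((cmap c0 \o g) t).
  by apply: (smooth_fun_diff oU sf (chart_atlas A (g t))); exact: cimg_mem.
apply: dw_eq (dw_comp dv' df); last by rewrite /= cmapK.
by apply: filterS dn => s H1 /H1 H2 /=; rewrite cmapK.
Qed.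

Lemma mvelocity_chart J (g : R -> M) t v c : has_mvelocity A J g t v -> atlas A c ->
  cdom c (g t) -> dwithin J (cmap c \o g) t (mdiff A (cmap c) (g t) v).
Proof.
move=> H Ac cg; apply/dw_row => i; rewrite (@mdiff_row _ _ _ _ _ (cdom c)) //.
- by apply: (mvelocity_fun H (cdom_open c)) => //; exact: smooth_coord.
- exact: cdom_open.
- by move=> j; exact: smooth_coord.
Qed.

Lemma mvelocity_of_chart J (g : R -> M) (y : R -> 'rV[R]_m) t a c : atlas A c ->
  (\forall s \near t, J s -> g s = cinv c (y s)) -> g t = cinv c (y t) -> ccod c (y t) ->
  dwithin J y t a -> has_mvelocity A J g t (tvec A c (y t) a).
Proof.
move=> Ac gE gt ct dy; rewrite /has_mvelocity; set c0 := cat (g t).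
have N : cimg c (cdom c0) (y t) by apply/cimgP; split=> //; rewrite -gt; exact: chart_dom.
have /nbhs_ballP[e /= e0 eN] := open_nbhs_nbhs (conj (@cimg_open _ _ _ c _ (cdom_open c0)) N).
have C := dw_cvg e0 dy.
have C' : \forall s \near t, J s -> cimg c (cdom c0) (y s).
  by apply: filterS C => s H Js; apply: eN; rewrite -ball_normE /= distrC; exact: H.
split; first by apply: filterS (filterI C' gE) => s [H1 H2] Js; have [_ _ h _] := cimg_cdom (H1 Js); rewrite H2.
suff : dwithin J (cmap c0 \o g) t (tvec A c (y t) a) by [].
apply/dw_row => i; rewrite /tvec -gt -/c0.
have T := transition_Ck 1 Ac (chart_atlas A (g t)).
have df := C1_differentiable (@cimg_open _ _ _ c _ (cdom_open c0)) N (T i).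
rewrite derive_mxE; last exact: Ckmap_derivable T N.
apply: dw_eq (dw_comp dy df); last by rewrite /= -gt.
by apply: filterS gE => s H Js /=; rewrite H.
Qed.

Lemma mvelocity_uniq J (g : R -> M) t v w :
  (forall d, 0 < d -> exists2 s, J s & 0 < `|s - t| < d) ->
  has_mvelocity A J g t v -> has_mvelocity A J g t w -> v = w.
Proof. by move=> acc [_ H1] [_ H2]; exact: dw_uniq acc H1 H2. Qed.

(** The coordinate functions of g extend smoothly around z0, and the m
    extensions are restricted to a common neighbourhood. *)
Lemma smooth_into_chart k (B : set 'rV[R]_k) (g : 'rV[R]_k -> M) z0 :
  smooth_into A B g -> B z0 ->
  exists (W : set 'rV[R]_k) (y : 'rV[R]_k -> 'rV[R]_m),
    [/\ open W, W z0, forall j, Ckmap j W y & forall z, B z -> W z ->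
        cdom (cat (g z0)) (g z) /\ y z = cmap (cat (g z0)) (g z)].
Proof.
move=> [cg sg] Bz0; set c := cat (g z0).
have B1 : (B `&` g @^-1` cdom c) z0 by split=> //; exact: chart_dom.
have /choice[V /choice[h Vh]] : forall i : 'I_m, exists V h,
  [/\ open V, V z0, (forall k, Ck k V h) & forall w, (B `&` g @^-1` cdom c) w -> V w -> cmap c (g w) 0 i = h w].
  by move=> i; have [V [h H]] := sg c (chart_atlas A (g z0)) i z0 B1; exists V, h.
have N : nbhs z0 (fun z => B z -> cdom c (g z)).
  move/subspace_continuousP: cg => /(_ z0 Bz0) cg.
  by apply: cg; apply: open_nbhs_nbhs; split; [exact: cdom_open|exact: chart_dom].
have NV : nbhs z0 (fun z => forall i, V i z).
  by apply: nbhs_forall => i; have [oV Vz _ _] := Vh i; exact: open_nbhs_nbhs.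
have NN : nbhs z0 (fun z => (B z -> cdom c (g z)) /\ forall i, V i z) by exact: (filterI N NV).
move: NN; rewrite nbhsE => -[W0 [oW0 W0z] W0s].
exists W0, (fun z => \row_i h i z); split=> // [j i|z Bz /W0s[cz Vz]].
  have [oV Vz Ch _] := Vh i.
  rewrite (_ : (fun z => _) = h i); last by apply/funext => z; rewrite mxE.
  by apply: Ck_sub (Ch j) => z /W0s[_]; apply.
have cgz := cz Bz; split=> //; apply/rowP => i; rewrite mxE.
by have [_ _ _ ->] := Vh i.
Qed.

End Fields.

(** * The connection form of a frame *)

Section Bundle.
Context {R : realType} {m : nat} {M : topologicalType} {A : manifold R m M}.
Context {L : hermitian_line_bundle A}.
Implicit Types (c : chart R m M) (U : set M) (e : frame (fib L)).

Lemma fcoordZ e x (z : R[i]) (v : fib L x) : fdom e x ->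
  fcoord e (z *: v) = z * fcoord e v.
Proof. by move=> ex; rewrite -{1}(fvecK v ex) scalerA fcoordK. Qed.

Lemma fcoordD e x (v w : fib L x) : fdom e x ->
  fcoord e (v + w) = fcoord e v + fcoord e w.
Proof. by move=> ex; rewrite -{1}(fvecK v ex) -{1}(fvecK w ex) -scalerDl fcoordK. Qed.

Lemma fcoord_fvec e x : fdom e x -> fcoord e (fvec e x) = 1.
Proof. by move=> ex; rewrite -[fvec e x]scale1r fcoordK. Qed.

Lemma fcoord_inj e x (v w : fib L x) : fdom e x -> fcoord e v = fcoord e w -> v = w.
Proof. by move=> ex E; rewrite -(fvecK v ex) E fvecK. Qed.

Lemma fcoord0 e x : fdom e x -> fcoord e (0 : fib L x) = 0.
Proof. by move=> ex; rewrite -(scale0r (0 : fib L x)) fcoordZ // mul0r. Qed.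

Lemma fcoordN e x (v : fib L x) : fdom e x -> fcoord e (- v) = - fcoord e v.
Proof. by move=> ex; rewrite -scaleN1r fcoordZ // mulN1r. Qed.

Lemma fcoord_eq0 e x (v : fib L x) : fdom e x -> (fcoord e v == 0) = (v == 0).
Proof.
move=> ex; apply/eqP/eqP => [E|->]; last exact: fcoord0.
by apply: (fcoord_inj ex); rewrite E fcoord0.
Qed.

Lemma fcoord_change e e' x (v : fib L x) : fdom e x -> fdom e' x ->
  fcoord e' v = fcoord e v * fcoord e' (fvec e x).
Proof. by move=> ex e'x; rewrite -{1}(fvecK v ex) fcoordZ. Qed.

Lemma smooth_cfun_sub U V (h : M -> R[i]) : U `<=` V ->
  smooth_cfun A V h -> smooth_cfun A U h.
Proof. by move=> UV [h1 h2]; split; exact: smooth_fun_sub UV _. Qed.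

Lemma smooth_cfun_eq U (h k : M -> R[i]) : (forall x, U x -> h x = k x) ->
  smooth_cfun A U h -> smooth_cfun A U k.
Proof.
move=> hk [h1 h2]; split.
  by apply: smooth_fun_eq h1 => x /hk ->.
by apply: smooth_fun_eq h2 => x /hk ->.
Qed.

Lemma smooth_section_sub U V (s : forall x, fib L x) : U `<=` V ->
  smooth_section V s -> smooth_section U s.
Proof. by move=> UV ss e /ss; apply: smooth_cfun_sub => x [/UV]. Qed.

Lemma smooth_fvec e : frames e -> smooth_section (fdom e) (fvec e).
Proof. by move=> fe e' fe'; rewrite setIC; exact: frames_compat. Qed.

Definition cmdiff (h : M -> R[i]) x v : R[i] :=
  mdiff A (fun y => complex.Re (h y) : R) x v +i* mdiff A (fun y => complex.Im (h y) : R) x v.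

Context (D : connection L).

(** The connection form of the frame e: D (z e) = (dz + z theta) e. *)
Definition theta e x v : R[i] := fcoord e (cov D x v (fvec e)).

Lemma cov_fcoord U e x v (s : forall x, fib L x) : open U -> U x -> smooth_section U s ->
  frames e -> fdom e x ->
  fcoord e (cov D x v s) =
  cmdiff (fun y => fcoord e (s y)) x v + fcoord e (s x) * theta e x v.
Proof.
move=> oU Ux ss fe ex; pose V := U `&` fdom e.
have oV : open V by apply: openI => //; exact: fdom_open.
have Vx : V x by [].
have sV : smooth_section V s by apply: smooth_section_sub ss => y [].
have seV : smooth_section V (fvec e) by apply: smooth_section_sub (smooth_fvec fe) => y [].
have sg : smooth_cfun A V (fun y => fcoord e (s y)) by exact: ss.
have E y : V y -> s y = fcoord e (s y) *: fvec e y by move=> [_ ey]; rewrite fvecK.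
have sV' : smooth_section V (fun y => fcoord e (s y) *: fvec e y).
  move=> e' fe'; apply: smooth_cfun_eq (sV e' fe') => y [Vy _].
  by rewrite -E.
rewrite (cov_local D v oV Vx sV sV' E) (cov_leibniz D v oV Vx sg seV).
by rewrite fcoordD // !fcoordZ // fcoord_fvec // mulr1.
Qed.

(** Gauge transformation: the logarithmic derivative of a transition function
    is the difference of the two connection forms. *)
Lemma cmdiff_change e e' x v : frames e -> frames e' -> fdom e x -> fdom e' x ->
  cmdiff (fun y => fcoord e' (fvec e y)) x v =
  (theta e x v - theta e' x v) * fcoord e' (fvec e x).
Proof.
move=> fe fe' ex e'x; have oe : open (fdom e) by exact: fdom_open.
have := cov_fcoord v oe ex (smooth_fvec fe) fe' e'x.
rewrite (fcoord_change _ ex e'x) -/(theta e x v) => E.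
by rewrite mulrBl E mulrC [theta e' x v * _]mulrC addrK.
Qed.

Lemma theta_linear e x k v w : frames e -> fdom e x ->
  theta e x (k *: v + w) = k%:C * theta e x v + theta e x w.
Proof.
move=> fe ex; rewrite /theta (cov_linear D _ _ _ (fdom_open e) ex (smooth_fvec fe)).
by rewrite fcoordD // fcoordZ.
Qed.

Lemma cov0 U x (s : forall x, fib L x) : open U -> U x -> smooth_section U s ->
  cov D x 0 s = 0.
Proof.
move=> oU Ux ss; have := cov_linear D (-1) 0 0 oU Ux ss.
by rewrite scaler0 addr0 rmorphN1 scaleN1r addNr.
Qed.

Lemma smooth_theta c e a : atlas A c -> frames e ->
  smooth_cfun A (cdom c `&` fdom e) (fun x => theta e x (cfield A c a x)).
Proof.
move=> Ac fe; set U := cdom c `&` fdom e.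
have oU : open U by apply: openI; [exact: cdom_open|exact: fdom_open].
have sX : smooth_vfield A U (cfield A c a) by apply: smooth_cfield => // x [].
have se : smooth_section U (fvec e) by apply: smooth_section_sub (smooth_fvec fe) => y [].
by have := cov_smooth D oU sX se fe; apply: smooth_cfun_sub => x [].
Qed.

Lemma sub_swap (p q s t : R[i]) : p - q = p + s * t - (q + t * s).
Proof. by ring. Qed.

(** The structure equation d theta = - 2 pi i om.  It is evaluated on
    coordinate fields, whose bracket vanishes, and the products of values of
    theta cancel because the fibre is a line. *)
Lemma curvature om c e a b x : prequantum om D -> atlas A c -> frames e ->
  cdom c x -> fdom e x ->
  cmdiff (fun y => theta e y (cfield A c b y)) x (cfield A c a x) -
  cmdiff (fun y => theta e y (cfield A c a y)) x (cfield A c b x) =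
  0 +i* (- (2 * pi * om x (cfield A c a x) (cfield A c b x))).
Proof.
move=> pq Ac fe cx ex; set U := cdom c `&` fdom e.
have oU : open U by apply: openI; [exact: cdom_open|exact: fdom_open].
have Ux : U x by [].
have sX a' : smooth_vfield A U (cfield A c a') by apply: smooth_cfield => // y [].
have se : smooth_section U (fvec e) by apply: smooth_section_sub (smooth_fvec fe) => y [].
have := pq U (cfield A c a) (cfield A c b) (fvec e) x oU Ux (sX a) (sX b) se.
rewrite lie_bracket_cfield // (cov0 oU Ux se) subr0.
move=> /(congr1 (fun v : fib L x => fcoord e v)).
rewrite fcoordD // fcoordN // fcoordZ // fcoord_fvec // mulr1.
have sc a' := cov_smooth D oU (sX a') se.
have C a1 a2 : fcoord e (cov D x (cfield A c a1 x) (fun y => cov D y (cfield A c a2 y) (fvec e))) =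
    cmdiff (fun y => theta e y (cfield A c a2 y)) x (cfield A c a1 x) +
    theta e x (cfield A c a2 x) * theta e x (cfield A c a1 x).
  exact: cov_fcoord oU Ux (sc a2) fe ex.
by rewrite (C a b) (C b a) => <-; exact: sub_swap.
Qed.

End Bundle.

(** * Covariant derivative along a curve *)

Section Lifts.
Context {R : realType} {m : nat} {M : topologicalType} {A : manifold R m M}.
Context {L : hermitian_line_bundle A} (D : connection L).
Implicit Types (c : chart R m M) (U : set M) (e : frame (fib L)).

Lemma mvelocity_cfun J (g : R -> M) t v U (h : M -> R[i]) :
  has_mvelocity A J g t v -> open U -> U (g t) -> smooth_cfun A U h ->
  cderiv J (h \o g) t (cmdiff (A := A) h (g t) v).
Proof.
move=> Hg oU Ut [h1 h2]; split; first exact: mvelocity_fun Hg oU Ut h1.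
exact: mvelocity_fun Hg oU Ut h2.
Qed.

Definition tfib e (p : tot_space L) : R[i] := fcoord e (projT2 p).

Lemma tfib_change e e' (p : tot_space L) : fdom e (projT1 p) -> fdom e' (projT1 p) ->
  tfib e' p = tfib e p * fcoord e' (fvec e (projT1 p)).
Proof. exact: fcoord_change. Qed.

(** The covariant derivative of p along the curve below it, whose velocity is
    v, is w times p; in a frame e this is the equation z' = (w - theta v) z for
    the fibre coordinate z.  A rate w in R[i] describes it without extending p
    to a section, and the rates of two lifts of one curve can be compared.  The
    lift is horizontal when w = 0. *)
Definition cder (J : set R) (p : R -> tot_space L) t (v : 'rV[R]_m) (w : R[i]) :=
  has_mvelocity A J (fun s => projT1 (p s)) t v /\
  forall e, frames e -> fdom e (projT1 (p t)) ->
    cderiv J (fun s => tfib e (p s)) t ((w - theta D e (projT1 (p t)) v) * tfib e (p t)).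

(** The terms by which the equations in two frames differ agree, by the law
    for the change of theta. *)
Lemma cder_of_frame (J : set R) p t v w e :
  has_mvelocity A J (fun s => projT1 (p s)) t v ->
  frames e -> fdom e (projT1 (p t)) ->
  cderiv J (fun s => tfib e (p s)) t ((w - theta D e (projT1 (p t)) v) * tfib e (p t)) ->
  cder J p t v w.
Proof.
move=> Hv fe et dz; split=> // e' fe' e't.
pose V := fdom e `&` fdom e'.
have oV : open V by apply: openI; exact: fdom_open.
have sg : smooth_cfun A V (fun x => fcoord e' (fvec e x)).
  by rewrite /V setIC; exact: frames_compat.
have dg := mvelocity_cfun Hv oV (conj et e't) sg.
have N := mvelocity_near Hv oV (conj et e't).
have := cd_M dz dg; rewrite (cmdiff_change D _ fe fe' et e't).
have -> : (w - theta D e (projT1 (p t)) v) * tfib e (p t) * ((fun x => fcoord e' (fvec e x)) \o (fun s => projT1 (p s))) t +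
  tfib e (p t) * ((theta D e (projT1 (p t)) v - theta D e' (projT1 (p t)) v) * fcoord e' (fvec e (projT1 (p t)))) =
  (w - theta D e' (projT1 (p t)) v) * tfib e' (p t).
  by rewrite (tfib_change et e't) /=; ring.
apply: cd_eq; last by rewrite [RHS](tfib_change et e't).
by apply: filterS N => s H /H [es e's]; rewrite [RHS](tfib_change es e's).
Qed.

Lemma pt2E (a b : R) : (pt2 a b 0 0 = a) * (pt2 a b 0 1 = b).
Proof.
split; rewrite /pt2 mxE; case: splitP => k //= E; rewrite !ord1 mxE ?eqxx //.
by case: k E => k /=; rewrite ltnS leqn0 => /eqP ->.
Qed.

(** The fibre coordinate, as a complex number, of a tangent vector of the
    total space. *)
Definition fib_part (w : 'rV[R]_(m + 2)) : R[i] := (rsubmx w 0 0) +i* (rsubmx w 0 1).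

Lemma tcoordE x (p : tot_space L) :
  (lsubmx (tcoord x p) = cmap (chart_at A x) (projT1 p)) *
  (fib_part (tcoord x p) = tfib (frame_at L x) p).
Proof.
split; first by rewrite /tcoord row_mxKl.
rewrite /fib_part /tcoord row_mxKr !pt2E /tfib; by case: (fcoord _ _).
Qed.

Lemma dw_lsub (J : set R) (g : R -> 'rV[R]_(m + 2)) t w : dwithin J g t w ->
  dwithin J (fun s => lsubmx (g s)) t (lsubmx w).
Proof.
move=> /dw_row dg; apply/dw_row => i; rewrite mxE.
rewrite (_ : (fun s => _) = (fun s => g s 0 (lshift 2 i))); first exact: dg.
by apply/funext => s; rewrite mxE.
Qed.

Lemma dw_fib_part (J : set R) (g : R -> 'rV[R]_(m + 2)) t w : dwithin J g t w ->
  cderiv J (fun s => fib_part (g s)) t (fib_part w).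
Proof.
move=> /dw_row dg; split=> /=; rewrite mxE.
  rewrite (_ : (fun s => _) = (fun s => g s 0 (rshift m 0))); first exact: dg.
  by apply/funext => s; rewrite mxE.
rewrite (_ : (fun s => _) = (fun s => g s 0 (rshift m 1))); first exact: dg.
by apply/funext => s; rewrite mxE.
Qed.

Lemma tvelocity_parts J (p : R -> tot_space L) t w : has_tvelocity J p t w ->
  has_mvelocity A J (fun s => projT1 (p s)) t (lsubmx w) /\
  cderiv J (fun s => tfib (frame_at L (projT1 (p t))) (p s)) t (fib_part w).
Proof.
move=> [dn dv]; set x := projT1 (p t).
have dw : dwithin J (tcoord x \o p) t w by [].
split; last first.
  have := dw_fib_part dw; congr cderiv; apply/funext => s /=; exact: (tcoordE x (p s)).2.
split; first by apply: filterS dn => s H /H [].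
have : dwithin J (fun s => lsubmx ((tcoord x \o p) s)) t (lsubmx w) by exact: dw_lsub.
rewrite (_ : (fun s => lsubmx _) = cmap (chart_at A x) \o (fun s => projT1 (p s))) //.
by apply/funext => s /=; exact: (tcoordE x (p s)).1.
Qed.

Lemma acc_setT (t d : R) : 0 < d -> exists2 s, [set: R] s & 0 < `|s - t| < d.
Proof.
move=> d0; exists (t + d / 2) => //; rewrite addrAC subrr add0r ger0_norm; last by rewrite divr_ge0 // ltW.
by rewrite divr_gt0 //= ltr_pdivrMr // ltr_pMr // ltr1n.
Qed.

Lemma acc_I01 (t : R) : I01 t -> forall d, 0 < d -> exists2 s, I01 s & 0 < `|s - t| < d.
Proof.
rewrite /I01 /= => /andP[t0 t1] d d0; pose r := Num.min (d / 2) (1 / 2).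
have r0 : 0 < r by rewrite lt_min !divr_gt0.
have rd : r < d by rewrite /r gt_min ltr_pdivrMr // ltr_pMr // ltr1n.
have r2 : r <= 1 / 2 by rewrite /r ge_min lexx orbT.
have [ht|ht] := leP t (1 / 2).
  exists (t + r); first by apply/andP; split; lra.
  by rewrite addrAC subrr add0r ger0_norm ?ltW // r0.
exists (t - r); first by apply/andP; split; lra.
by rewrite addrAC subrr add0r normrN ger0_norm ?ltW // r0.
Qed.

Lemma vertical_fieldE (f : M -> R) (p : tot_space L) w : vertical_field f p w ->
  lsubmx w = 0 /\
  fib_part w = (0 +i* (2 * pi * f (projT1 p))) * tfib (frame_at L (projT1 p)) p.
Proof.
move=> /tvelocity_parts /= [V1 V2]; split.
  apply: mvelocity_uniq (acc_setT 0) V1 _.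
  split; first by exists 1 => //= s _ _; exact: chart_at_dom.
  exact: dw_cst.
apply: cd_uniq (acc_setT 0) V2 _.
set e := frame_at L (projT1 p).
have ex : fdom e (projT1 p) by exact: frame_at_dom.
have E s : tfib e (tscale (expi (2 * pi * s * f (projT1 p))) p) =
   expi (2 * pi * s * f (projT1 p)) * tfib e p.
  by rewrite /tfib /tscale /= fcoordZ.
have d1 : dwithin [set: R] (fun s : R => 2 * pi * s * f (projT1 p)) 0 (2 * pi * f (projT1 p)).
  rewrite (_ : (fun s => _) = (fun s => (2 * pi * f (projT1 p)) *: id s)); last first.
    by apply/funext => s; rewrite /GRing.scale /=; ring.
  have did : dwithin [set: R] (@id R) 0 1 by apply: dw_is_derive; exact: is_derive_id.
  by have := dw_Z (a := 2 * pi * f (projT1 p)) did; rewrite [_ *: 1]mulr1.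
have := cd_M (cd_expi d1) (cd_cst setT (tfib e p) 0).
rewrite !mulr0 mul0r expi0 mulr1 addr0.
by congr cderiv; apply/funext => s; rewrite E.
Qed.

(** For the section s with D_v s = 0 that defines the lift, the Leibniz rule
    gives d (fcoord s) v = - theta(v) fcoord s. *)
Lemma horizontal_liftE (p : tot_space L) v h : horizontal_lift D p v h ->
  lsubmx h = v /\
  fib_part h = - theta D (frame_at L (projT1 p)) (projT1 p) v * tfib (frame_at L (projT1 p)) p.
Proof.
move=> [U [s [oU Ux ss sp [cov0 ->]]]]; set x := projT1 p in Ux cov0 *.
set e := frame_at L x; set c := chart_at A x.
have fe : frames e by exact: frame_atP.
have ex : fdom e x by exact: frame_at_dom.
have cx : cdom c x by exact: chart_at_dom.
have Ac : atlas A c by exact: chart_atP.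
pose V := U `&` (fdom e `&` cdom c).
have oV : open V by apply: openI => //; apply: openI; [exact: fdom_open|exact: cdom_open].
have Vx : V x by [].
pose T := fun y => tcoord x (section_map s y).
have sT i : smooth_fun A V (fun y => T y 0 i).
  rewrite /T /tcoord; case: (split_ordP i) => j ->.
    apply: smooth_fun_eq (smooth_fun_sub _ (smooth_coord j Ac)) => [y _|y [_ []]//].
    by rewrite row_mxEl.
  have [s1 s2] := ss e fe.
  have [->|->] : j = 0 \/ j = 1.
    case: j => -[|[|//]] H; [left|right]; exact: val_inj.
  - apply: smooth_fun_eq (smooth_fun_sub _ s1) => [y _|y [Uy []//]].
    by rewrite row_mxEr pt2E.
  - apply: smooth_fun_eq (smooth_fun_sub _ s2) => [y _|y [Uy []//]].
    by rewrite row_mxEr pt2E.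
have E i : mdiff A T x v 0 i = mdiff A (fun y => T y 0 i) x v by exact: (mdiff_row _ _ oV Vx sT).
have lsubE (w : 'rV[R]_(m + 2)) i : lsubmx w 0 i = w 0 (lshift 2 i) by rewrite mxE.
have rsubE (w : 'rV[R]_(m + 2)) i : rsubmx w 0 i = w 0 (rshift m i) by rewrite mxE.
have vE : mdiff A (cmap c) x v = v.
  rewrite /mdiff; apply/rowP => i.
  have N : cimg c (cdom c) (cmap c x) by exists x.
  rewrite derive_mxE; last exact: Ckmap_derivable (transition_Ck 1 Ac Ac) N.
  have E1 : 'D_v (fun u => (cmap c \o cinv c) u 0 i) (cmap c x) = 'D_v (fun u : 'rV[R]_m => u 0 i) (cmap c x).
    apply: near_eq_derive; apply: filterS (open_nbhs_nbhs (conj (@cimg_open _ _ _ c _ (cdom_open c)) N)) => u.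
    by move=> /cimg_cdom[_ _ _ /= ->].
  by rewrite E1; have [_ ->] := is_derive_coord v (cmap c x) 0 i.
have E2 i : mdiff A (cmap c) x v 0 i = mdiff A (fun y => cmap c y 0 i) x v.
  by apply: (mdiff_row _ _ (cdom_open c) cx) => j; exact: smooth_coord.
split.
  apply/rowP => i; rewrite -[in RHS]vE; apply: etrans (esym (E2 i)).
  apply: etrans (lsubE _ i) _; apply: etrans (E _) _.
  by congr (mdiff A _ x v); apply/funext => y; rewrite /T /tcoord row_mxEl.
have := cov_fcoord D v oU Ux ss fe ex; rewrite cov0 fcoord0 // => K.
have -> : fib_part (mdiff A T x v) = cmdiff (A := A) (fun y => fcoord e (s y)) x v.
  rewrite /fib_part /cmdiff !rsubE !E; congr (_ +i* _).
    by congr (mdiff A _ x v); apply/funext => y; rewrite /T /tcoord row_mxEr pt2E.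
  by congr (mdiff A _ x v); apply/funext => y; rewrite /T /tcoord row_mxEr pt2E.
have -> : tfib e p = fcoord e (s x) by rewrite /tfib -sp.
by apply/eqP; rewrite -subr_eq0 mulNr opprK [theta _ _ _ _ * _]mulrC -K.
Qed.

End Lifts.

(** * The lifted isotopy covers the isotopy *)

Section Flow.
Context {R : realType} {m : nat} {M : topologicalType} {A : manifold R m M}.
Context {L : hermitian_line_bundle A} (D : connection L).
Implicit Types (c : chart R m M) (U : set M) (e : frame (fib L)).

(** The horizontal lift of X_t has rate 0 and the field - W_(f_t) has rate
    - 2 pi i f_t. *)
Lemma lift_isotopy_cder X f F (p : tot_space L) t : lift_isotopy D X f F -> slit p -> I01 t ->
  [/\ F 0 p = p, slit (F t p) &
   cder D I01 (fun s => F s p) t (X t (projT1 (F t p)))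
     (0 +i* (- (2 * pi * f t (projT1 (F t p)))))].
Proof.
move=> HF sp It; have [F0 HFt] := HF p sp; split=> //; first by have [] := HFt t It.
have [sl [h [w [Hh Hw Hv]]]] := HFt t It.
have [V1 V2] := tvelocity_parts Hv.
have [h1 h2] := horizontal_liftE Hh; have [w1 w2] := vertical_fieldE Hw.
set e := frame_at L (projT1 (F t p)) in V2 h2 w2 *.
have E1 : lsubmx (h - w) = X t (projT1 (F t p)) by rewrite raddfB /= h1 w1 subr0.
have E2 : fib_part (h - w) = fib_part h - fib_part w by apply: complexP; rewrite /= !mxE.
rewrite E1 in V1; rewrite E2 h2 w2 in V2.
apply: (@cder_of_frame _ _ _ _ _ _ _ _ _ _ _ e) => //; [exact: frame_atP|exact: frame_at_dom|].
move: V2; congr cderiv; rewrite -mulrBl; congr (_ * _).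
by apply: complexP; rewrite /= ?cReD ?cImD /=; case: (theta _ _ _ _) => a b /=; ring.
Qed.

Lemma mvelocity_ext J (g h : R -> M) t v : J t -> (forall s, J s -> g s = h s) ->
  has_mvelocity A J g t v -> has_mvelocity A J h t v.
Proof.
move=> Jt gh [dn dv]; rewrite /has_mvelocity -(gh t Jt); split.
  by apply: filterS dn => s H Js; rewrite -gh //; exact: H.
have dv' : dwithin J (cmap (chart_at A (g t)) \o g) t v by [].
suff : dwithin J (cmap (chart_at A (g t)) \o h) t v by rewrite /dwithin /= (gh t Jt).
apply: (dw_eq _ _ dv'); last by rewrite /= gh.
by apply: filterS dn => s _ Js /=; rewrite (gh s Js).
Qed.

Lemma mvelocity_cst J (x : M) t : has_mvelocity A J (fun=> x) t 0.
Proof.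
by split; [exists 1 => //= s _ _; exact: chart_at_dom|exact: dw_cst].
Qed.

Lemma mvelocity0_const (g : R -> M) : (forall t, I01 t -> has_mvelocity A I01 g t 0) ->
  forall t, I01 t -> g 0 = g t.
Proof.
move=> Hg r; rewrite /I01 /= => /andP[r0 r1].
apply: (@cousin _ (fun x y => g x = g y) 0 r r0).
  by move=> x y z _ _ _ _ ->.
move=> t /andP[t0 tr]; have It : I01 t by rewrite /I01 /= t0 (le_trans tr).
set c := chart_at A (g t).
have oc : open (cdom c) by exact: cdom_open.
have Ac : atlas A c by exact: chart_atP.
have := mvelocity_near (Hg t It) oc (chart_at_dom A (g t)).
move=> /nbhs_ballP[d /= d0 H]; exists d => // x y x0 y1 /andP[xt ty] xd yd.
have dom s : x <= s <= y -> cdom c (g s).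
  move=> /andP[xs sy]; apply: H; last by apply/andP; split; lra.
  by rewrite -ball_normE /= ltr_norml; apply/andP; split; lra.
have xy : x <= y by lra.
have E : cmap c (g x) = cmap c (g y).
  apply: (@dw_zero_const _ _ I01 (cmap c \o g) x y xy) => [s /andP[xs sy]|s xsy].
    by apply/andP; split; lra.
  have Is : I01 s by move: xsy => /andP[? ?]; apply/andP; split; lra.
  have := mvelocity_chart (Hg s Is) Ac (dom s xsy).
  by rewrite /mdiff derive0.
rewrite -(cmapK (c := c) (x := g x)) ?E ?cmapK //; apply: dom; rewrite ?lexx ?xy //.
Qed.

(** The velocity of s |-> psi_s(g(s)) depends on g through its position and
    velocity alone: in charts it is a directional derivative of a smooth
    extension of psi across the end points of the time interval. *)
Lemma time_map_velocity psi t q : smooth_time_map A psi -> I01 t ->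
  exists Phi : 'rV[R]_m -> 'rV[R]_m, forall g v, g t = q -> has_mvelocity A I01 g t v ->
    has_mvelocity A I01 (fun s => psi s (g s)) t (Phi v).
Proof.
move=> spsi It; set c := chart_at A q; set c' := chart_at A (psi t q).
have Ac : atlas A c by exact: chart_atP.
have Ac' : atlas A c' by exact: chart_atP.
have cq : cdom c q by exact: chart_at_dom.
pose G (w : 'rV[R]_(1 + m)) := psi (lsubmx w 0 0) (cinv c (rsubmx w)).
have sG : smooth_into A (cyl c) G by exact: spsi.
pose w0 : 'rV[R]_(1 + m) := row_mx (t%:M : 'M[R]_1) (cmap c q).
have tM s : (s%:M : 'M[R]_1) 0 0 = s by rewrite mxE.
have Gw0 : G w0 = psi t q by rewrite /G /w0 row_mxKl row_mxKr tM cmapK.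
have B0 : cyl c w0 by rewrite /cyl /= /w0 row_mxKl row_mxKr tM; split=> //; exists q.
have [W [y [oW W0 Cy yE]]] := smooth_into_chart sG B0; rewrite Gw0 -/c' in yE.
exists (fun v => \row_i 'D_(row_mx (1%:M : 'M[R]_1) v) (fun w => y w 0 i) w0) => g v gt Hg.
pose w s : 'rV[R]_(1 + m) := row_mx (s%:M : 'M[R]_1) (cmap c (g s)).
have wt : w t = w0 by rewrite /w /w0 gt.
have dg : dwithin I01 (cmap c \o g) t v by move: Hg => [_]; rewrite gt /dwithin /=; rewrite gt.
have dw : dwithin I01 w t (row_mx (1%:M : 'M[R]_1) v).
  apply/dw_row => i; rewrite /w; case: (split_ordP i) => j ->.
    rewrite row_mxEl mxE ord1 /= (_ : (fun s => _) = id); last first.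
      by apply/funext => s; rewrite row_mxEl mxE eqxx.
    by apply: dw_is_derive; exact: is_derive_id.
  rewrite row_mxEr (_ : (fun s => _) = (fun s => (cmap c \o g) s 0 j)); last first.
    by apply/funext => s; rewrite row_mxEr.
  by move/dw_row: dg; apply.
have Ncyl : \forall s \near t, I01 s -> cyl c (w s) /\ G (w s) = psi s (g s).
  have Ug : cdom c (g t) by rewrite gt.
  have := mvelocity_near Hg (cdom_open c) Ug; apply: filterS => s H Is.
  have cs := H Is; rewrite /G /w row_mxKl row_mxKr tM cmapK //; split=> //.
  by rewrite /cyl /= row_mxKl row_mxKr tM; split=> //; exists (g s).
have NW : \forall s \near t, I01 s -> cdom c' (psi s (g s)) /\ y (w s) = cmap c' (psi s (g s)).
  have /nbhs_ballP[d /= d0 dW] := open_nbhs_nbhs (conj oW W0).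
  apply: filterS (filterI Ncyl (dw_cvg d0 dw)) => s [H1 H2] Is.
  have [cs <-] := H1 Is; apply: yE cs _.
  by apply: dW; rewrite -ball_normE /= distrC -wt; exact: H2.
have E0 : psi t (g t) = psi t q by rewrite gt.
split; rewrite E0 -/c'; first by apply: filterS NW => s H /H[].
suff : dwithin I01 (cmap c' \o (fun s => psi s (g s))) t
    (\row_i 'D_(row_mx (1%:M : 'M[R]_1) v) (fun w => y w 0 i) w0) by rewrite /dwithin /= E0.
apply/dw_row => i; rewrite mxE.
have df : differentiable (fun w => y w 0 i) (w t) by rewrite wt; exact: C1_differentiable oW W0 (Cy 1%N i).
have := dw_comp dw df; rewrite wt; apply: dw_eq.
  by apply: filterS NW => s H /H[_ /= ->].
by have [_ /= ->] := nbhs_singleton NW It.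
Qed.

(** Pull the base curve y_s of s |-> F_s(p) back to psi_s^-1(y_s).  At each
    time it has the velocity that the constant psi_r^-1(psi_r(z)) has, where
    z = psi_s^-1(y_s), since y and r |-> psi_r(z) have the same velocity X_s
    there.  Hence it is constant. *)
Lemma lift_covers om X f psi psiV F (p : tot_space L) t :
  isotopy A psi psiV -> hamiltonian_flow A om f X psi -> lift_isotopy D X f F ->
  slit p -> I01 t -> projT1 (F t p) = psi t (projT1 p).
Proof.
move=> [_ sV psi0 psiK] ham HF sp It.
pose y s := psiV s (projT1 (F s p)).
have y0 s : I01 s -> has_mvelocity A I01 y s 0.
  move=> Is; have [_ _ [Hv _]] := lift_isotopy_cder HF sp Is.
  have [Phi HPhi] := time_map_velocity (projT1 (F s p)) sV Is.
  have K1 := HPhi (fun s => projT1 (F s p)) _ erefl Hv.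
  have psis : psi s (y s) = projT1 (F s p) by have [_] := psiK s Is; apply.
  have [Hpsi _] := ham s (y s) Is; rewrite psis in Hpsi.
  have K2 := HPhi (fun r => psi r (y s)) _ psis Hpsi.
  have K3 : has_mvelocity A I01 (fun=> y s) s (Phi (X s (projT1 (F s p)))).
    by apply: mvelocity_ext K2 => // r Ir; have [H _] := psiK r Ir; exact: H.
  by rewrite -(mvelocity_uniq (acc_I01 Is) K3 (mvelocity_cst _ _ _)).
have I0 : I01 (0 : R) by rewrite /I01 /= lexx ler01.
have E0 : y 0 = projT1 p.
  rewrite /y; have [-> _ _] := lift_isotopy_cder HF sp I0.
  by have [H _] := psiK 0 I0; have := H (projT1 p); rewrite psi0.
have yt : y 0 = y t by exact: mvelocity0_const.
by rewrite -E0 yt; have [_ H] := psiK t It; rewrite /y H.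
Qed.

End Flow.

(** * Curvature in coordinates *)

Section Curl.
Context {R : realType}.

(** The pullback by y of the one-form with coefficients th, evaluated on the
    constant vector d. *)
Definition pull m n (th : 'I_m -> 'rV[R]_m -> R) (y : 'rV[R]_n -> 'rV[R]_m) (d : 'rV[R]_n)
  (w : 'rV[R]_n) : R := \sum_i 'D_d (fun w => y w 0 i) w * th i (y w).

Lemma pull_Ck m n k (V : set 'rV[R]_n) (W : set 'rV[R]_m) y th d : open V -> open W ->
  (forall w, V w -> W (y w)) -> Ckmap k.+1 V y -> (forall i, Ck k W (th i)) ->
  Ck k V (pull th y d).
Proof.
move=> oV oW yW Cy Ct; apply: Ck_sum => // i; apply: Ck_M => //.
  exact: Ck_derive (Cy i).
have Cy' : Ckmap k V y by move=> j; apply: Ck_pred; exact: Cy.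
exact: (Ck_comp oV oW yW (Ct i) Cy').
Qed.

Lemma sub_common (a b c : R) : a + c - (b + c) = a - b.
Proof. by ring. Qed.

Lemma sub_mul_swap (a b p q : R) : a * b * p - b * a * q = a * b * (p - q).
Proof. by ring. Qed.

(** The exterior derivative commutes with pullback: the second derivatives of
    y cancel by symmetry. *)
Lemma curl_pull m n (V : set 'rV[R]_n) (W : set 'rV[R]_m) (y : 'rV[R]_n -> 'rV[R]_m)
    (th : 'I_m -> 'rV[R]_m -> R) w d1 d2 :
  open V -> open W -> V w -> (forall w, V w -> W (y w)) -> Ckmap 2 V y ->
  (forall i, Ck 1 W (th i)) ->
  'D_d1 (pull th y d2) w - 'D_d2 (pull th y d1) w =
  \sum_i \sum_j 'D_d1 (fun w => y w 0 j) w * 'D_d2 (fun w => y w 0 i) w *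
    ('D_(delta_mx 0 j) (th i) (y w) - 'D_(delta_mx 0 i) (th j) (y w)).
Proof.
move=> oV oW Vw yW Cy Ct.
have Dth d i : is_derive w d (th i \o y)
    (\sum_j 'D_d (fun w => y w 0 j) w * 'D_(delta_mx 0 j) (th i) (y w)).
  have dy := Ckmap_derivable (v := d) Cy Vw.
  have dt := C1_differentiable oW (yW _ Vw) (Ct i).
  apply: is_derive_eq (is_derive_comp dy dt) _.
  rewrite (derive_row _ dt); apply: eq_bigr => j _.
  by rewrite (derive_mxE 0 j dy).
have DQ d d' : 'D_d (pull th y d') w = \sum_i (
    'D_d' (fun w => y w 0 i) w * (\sum_j 'D_d (fun w => y w 0 j) w * 'D_(delta_mx 0 j) (th i) (y w)) +
    th i (y w) * 'D_d ('D_d' (fun w => y w 0 i)) w).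
  have dd i : derivable ('D_d' (fun w => y w 0 i)) w d.
    exact: Ck_derivable (Ck_derive d' (Cy i)) Vw.
  have E : pull th y d' = \sum_i (fun w => 'D_d' (fun w => y w 0 i) w * (th i \o y) w).
    by apply/funext => w'; rewrite fct_sumE.
  rewrite E derive_sum => [|i].
    apply: eq_bigr => i _; have [dt <-] := Dth d i.
    exact: (deriveM (dd i) dt).
  by apply: derivableM => //; have [] := Dth d i.
rewrite !DQ -sumrB.
have S i : 'D_d1 ('D_d2 (fun w => y w 0 i)) w = 'D_d2 ('D_d1 (fun w => y w 0 i)) w.
  exact: schwarz oV Vw (Cy i).
rewrite (eq_bigr (fun i => \sum_j 'D_d1 (fun w => y w 0 j) w * 'D_d2 (fun w => y w 0 i) w * 'D_(delta_mx 0 j) (th i) (y w)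
   - \sum_j 'D_d2 (fun w => y w 0 j) w * 'D_d1 (fun w => y w 0 i) w * 'D_(delta_mx 0 j) (th i) (y w))); last first.
  move=> i _; rewrite S sub_common !mulr_sumr; congr (_ - _);
  by apply: eq_bigr => j _; exact: etrans (mulrCA _ _ _) (mulrA _ _ _).
rewrite sumrB [X in _ - X]exchange_big -sumrB; apply: eq_bigr => i _ /=.
rewrite -sumrB; apply: eq_bigr => j _.
exact: sub_mul_swap.
Qed.

End Curl.

Section LocalCurvature.
Context {R : realType} {m : nat} {M : topologicalType} {A : manifold R m M}.
Context {L : hermitian_line_bundle A} (D : connection L).
Context (om : M -> 'rV[R]_m -> 'rV[R]_m -> R).
Hypotheses (om_form : is_two_form A om) (pq : prequantum om D).
Implicit Types (c : chart R m M) (U : set M) (e : frame (fib L)).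

Lemma real_linear_sum (V : lmodType R) (phi : 'rV[R]_m -> V) :
  (forall k a b, phi (k *: a + b) = k *: phi a + phi b) ->
  forall a, phi a = \sum_i a 0 i *: phi (delta_mx 0 i).
Proof.
move=> lphi a; have phi0 : phi 0 = 0.
  by have := lphi (-1) 0 0; rewrite scaler0 addr0 scaleN1r addNr.
rewrite {1}(row_sum_delta a).
elim/big_rec2: _ => [//|i x y _ <-].
by rewrite lphi.
Qed.

(** Coefficients of the connection form in a chart, with their real and
    imaginary parts thr and thi. *)
Definition thc c e i (z : 'rV[R]_m) : R[i] :=
  theta D e (cinv c z) (cfield A c (delta_mx 0 i) (cinv c z)).
Definition thr c e i z := complex.Re (thc c e i z).
Definition thi c e i z := complex.Im (thc c e i z).

Lemma th_Ck c e i k : atlas A c -> frames e ->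
  Ck k (cimg c (fdom e)) (thr c e i) /\ Ck k (cimg c (fdom e)) (thi c e i).
Proof.
move=> Ac fe; have [s1 s2] := smooth_theta D (delta_mx 0 i) Ac fe.
have oU : open (cdom c `&` fdom e) by apply: openI; [exact: cdom_open|exact: fdom_open].
have sub : cimg c (fdom e) `<=` cimg c (cdom c `&` fdom e).
  by move=> z /cimg_cdom[? ? ? ?]; apply/cimgP.
split.
  have := iffLR (smooth_funP A _ oU) s1 c Ac k; exact: Ck_sub.
have := iffLR (smooth_funP A _ oU) s2 c Ac k; exact: Ck_sub.
Qed.

Lemma cRe_lin (k : R) (x y : R[i]) :
  complex.Re (k%:C * x + y) = k * complex.Re x + complex.Re y.
Proof. by case: x y => x1 x2 [y1 y2] /=; ring. Qed.

Lemma cIm_lin (k : R) (x y : R[i]) :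
  complex.Im (k%:C * x + y) = k * complex.Im x + complex.Im y.
Proof. by case: x y => x1 x2 [y1 y2] /=; ring. Qed.

Lemma theta_tvec c e z a : atlas A c -> frames e -> cimg c (fdom e) z ->
  theta D e (cinv c z) (tvec A c z a) =
  (\sum_i a 0 i * thr c e i z) +i* (\sum_i a 0 i * thi c e i z).
Proof.
move=> Ac fe Wz; have [cz cx ex zK] := cimg_cdom Wz.
pose phr a := complex.Re (theta D e (cinv c z) (tvec A c z a)) : R^o.
pose phi a := complex.Im (theta D e (cinv c z) (tvec A c z a)) : R^o.
have lin k a' b : theta D e (cinv c z) (tvec A c z (k *: a' + b)) =
   k%:C * theta D e (cinv c z) (tvec A c z a') + theta D e (cinv c z) (tvec A c z b).
  by rewrite tvec_linear // theta_linear.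
have lr k a' b : phr (k *: a' + b) = k *: phr a' + phr b.
  have H := congr1 (@complex.Re R) (lin k a' b); rewrite cRe_lin in H; exact: H.
have li k a' b : phi (k *: a' + b) = k *: phi a' + phi b.
  have H := congr1 (@complex.Im R) (lin k a' b); rewrite cIm_lin in H; exact: H.
apply: complexP => /=.
  rewrite -[LHS]/(phr a) (real_linear_sum lr); apply: eq_bigr => i _.
  by rewrite /phr /thr /thc /cfield zK.
rewrite -[LHS]/(phi a) (real_linear_sum li); apply: eq_bigr => i _.
by rewrite /phi /thi /thc /cfield zK.
Qed.

Lemma complex_sub_parts (p q r s k : R) :
  (p +i* q) - (r +i* s) = 0 +i* k -> p - r = 0 /\ q - s = k.
Proof. by case. Qed.

Lemma curv_coord c e z i j : atlas A c -> frames e -> cimg c (fdom e) z ->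
  'D_(delta_mx 0 j) (thr c e i) z - 'D_(delta_mx 0 i) (thr c e j) z = 0 /\
  'D_(delta_mx 0 j) (thi c e i) z - 'D_(delta_mx 0 i) (thi c e j) z =
  - (2 * pi * om (cinv c z) (tvec A c z (delta_mx 0 j)) (tvec A c z (delta_mx 0 i))).
Proof.
move=> Ac fe Wz; have [cz cx ex zK] := cimg_cdom Wz.
have oU : open (cdom c `&` fdom e) by apply: openI; [exact: cdom_open|exact: fdom_open].
have Ux : (cdom c `&` fdom e) (cinv c z) by [].
have := curvature (delta_mx 0 j) (delta_mx 0 i) pq Ac fe cx ex.
have E a b : cmdiff (A := A) (fun y => theta D e y (cfield A c a y)) (cinv c z) (cfield A c b (cinv c z)) =
   'D_b (fun z => complex.Re (theta D e (cinv c z) (cfield A c a (cinv c z)))) z +i*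
   'D_b (fun z => complex.Im (theta D e (cinv c z) (cfield A c a (cinv c z)))) z.
  have [s1 s2] := smooth_theta D a Ac fe.
  by rewrite /cmdiff (mdiff_cfield b Ac cx oU Ux s1) (mdiff_cfield b Ac cx oU Ux s2) zK.
move=> /(etrans (esym (congr2 (fun p q => p - q) (E _ _) (E _ _)))) /complex_sub_parts[H1 H2].
split; first exact: H1.
have cf a : cfield A c a (cinv c z) = tvec A c z a by rewrite /cfield zK.
exact: etrans H2 (congr2 (fun v w => - (2 * pi * om (cinv c z) v w)) (cf _) (cf _)).
Qed.

Lemma om_tvec c z a b : atlas A c -> ccod c z ->
  om (cinv c z) (tvec A c z a) (tvec A c z b) =
  \sum_i \sum_j a 0 j * b 0 i * om (cinv c z) (tvec A c z (delta_mx 0 j)) (tvec A c z (delta_mx 0 i)).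
Proof.
move=> Ac cz; have [l1 anti _] := om_form.
pose phi v a := om (cinv c z) (tvec A c z a) v : R^o.
have lphi v k a' b' : phi v (k *: a' + b') = k *: phi v a' + phi v b'.
  by rewrite /phi tvec_linear // l1.
have E1 v d : om (cinv c z) (tvec A c z d) v =
    \sum_i d 0 i * om (cinv c z) (tvec A c z (delta_mx 0 i)) v.
  exact: (real_linear_sum (lphi v) d).
have E2 v d : om (cinv c z) v (tvec A c z d) =
    \sum_i d 0 i * om (cinv c z) v (tvec A c z (delta_mx 0 i)).
  apply: etrans (anti _ _ _) _; rewrite (E1 v d) -sumrN; apply: eq_bigr => i _.
  by rewrite -mulrN; congr (_ * _); exact: esym (anti _ _ _).
apply: etrans (E2 _ b) _; apply: eq_bigr => i _.
apply: etrans (congr1 ( *%R _) (E1 _ a)) _; rewrite mulr_sumr; apply: eq_bigr => j _.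
exact: etrans (mulrCA _ _ _) (mulrA _ _ _).
Qed.

Lemma mul_neg_swap (p q p' q' t o : R) : p' = p -> q' = q ->
  p * q * - (t * o) = - (t * (p' * q' * o)).
Proof. by move=> -> ->; ring. Qed.

(** The equation d theta = - 2 pi i om, pulled back by a map y into the
    chart. *)
Lemma curv_pull n c e (V : set 'rV[R]_n) y w d1 d2 : atlas A c -> frames e -> open V -> V w ->
  (forall w, V w -> cimg c (fdom e) (y w)) -> Ckmap 2 V y ->
  'D_d1 (pull (thr c e) y d2) w - 'D_d2 (pull (thr c e) y d1) w = 0 /\
  'D_d1 (pull (thi c e) y d2) w - 'D_d2 (pull (thi c e) y d1) w =
  - (2 * pi * om (cinv c (y w)) (tvec A c (y w) ('D_d1 y w)) (tvec A c (y w) ('D_d2 y w))).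
Proof.
move=> Ac fe oV Vw yW Cy; have oW : open (cimg c (fdom e)) by apply: cimg_open; exact: fdom_open.
have Wy := yW w Vw; have [cz _ _ _] := cimg_cdom Wy.
have dy d : derivable y w d := Ckmap_derivable (v := d) Cy Vw.
split.
  rewrite (curl_pull _ _ oV oW Vw yW Cy) => [|i]; last by have [] := th_Ck i 1 Ac fe.
  rewrite big1 // => i _; rewrite big1 // => j _.
  by have [-> _] := curv_coord i j Ac fe Wy; rewrite mulr0.
rewrite (curl_pull _ _ oV oW Vw yW Cy) => [|i]; last by have [] := th_Ck i 1 Ac fe.
rewrite (om_tvec _ _ Ac cz) mulr_sumr -sumrN; apply: eq_bigr => i _.
rewrite mulr_sumr -sumrN; apply: eq_bigr => j _.
have [_ ->] := curv_coord i j Ac fe Wy.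
have Dy d k : ('D_d y w) 0 k = 'D_d (fun w => y w 0 k) w by exact: derive_mxE (dy d).
exact: mul_neg_swap (Dy d1 j) (Dy d2 i).
Qed.

End LocalCurvature.

(** * Variation of lifts in a family of curves *)

Section Plane.
Context {R : realType}.

Lemma cexpD (x y : R[i]) : cexp (x + y) = cexp x * cexp y.
Proof. by rewrite /cexp cReD cImD expRD expiD rmorphM /=; ring. Qed.

Lemma subr_shift (p q x b k : R) : p - q = - x -> k = x + b -> b - p = k - q.
Proof. by move=> pq ->; lra. Qed.

Lemma transport_rate (w p q k z1 z2 : R[i]) :
  (w - p) * z1 * z2 + z1 * ((p - q + k) * z2) = (w + k - q) * (z1 * z2).
Proof. by ring. Qed.

Lemma ord2P (i : 'I_2) : i = 0 \/ i = 1.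
Proof. by case: i => -[|[|//]] Hi; [left|right]; exact: val_inj. Qed.

Lemma pt2_line (s u v : R) : pt2 (s + u) v = s *: pt2 1 0 + pt2 u v.
Proof.
apply/rowP => i; rewrite [RHS]mxE [X in _ = X + _]mxE.
by case: (ord2P i) => ->; rewrite !pt2E ?mulr1 ?mulr0 ?add0r.
Qed.

Lemma pt2_line2 (s u v : R) : pt2 u (s + v) = s *: pt2 0 1 + pt2 u v.
Proof.
apply/rowP => i; rewrite [RHS]mxE [X in _ = X + _]mxE.
by case: (ord2P i) => ->; rewrite !pt2E ?mulr1 ?mulr0 ?add0r.
Qed.

Lemma pt2_ball (u v u0 v0 d : R) : 0 < d -> `|u - u0| < d -> `|v - v0| < d ->
  ball (pt2 u0 v0) d (pt2 u v).
Proof.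
move=> d0 ud vd; rewrite -ball_normE /= distrC.
have bnd : `|pt2 u v - pt2 u0 v0| <= Num.max `|u - u0| `|v - v0|.
  apply: norm_row_le => [|i]; first by rewrite le_max normr_ge0.
  rewrite [X in `|X|]mxE [X in _ + X]mxE.
  by case: (ord2P i) => ->; rewrite !pt2E le_max lexx ?orbT.
by apply: le_lt_trans bnd _; rewrite gt_max ud.
Qed.

Lemma is_derive_pt2l (W : normedModType R) (f : 'rV[R]_2 -> W) (u v : R) :
  derivable f (pt2 u v) (pt2 1 0) ->
  is_derive u (1 : R) (fun s => f (pt2 s v)) ('D_(pt2 1 0) f (pt2 u v)).
Proof.
have E s : pt2 s v = s *: pt2 1 0 + pt2 0 v by rewrite -pt2_line addr0.
rewrite E => /is_derive_line; rewrite (_ : (fun s => f (pt2 s v)) = (fun r => f (r *: pt2 1 0 + pt2 0 v))) //.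
by apply/funext => s; rewrite E.
Qed.

Lemma is_derive_pt2r (W : normedModType R) (f : 'rV[R]_2 -> W) (u v : R) :
  derivable f (pt2 u v) (pt2 0 1) ->
  is_derive v (1 : R) (fun s => f (pt2 u s)) ('D_(pt2 0 1) f (pt2 u v)).
Proof.
have E s : pt2 u s = s *: pt2 0 1 + pt2 u 0 by rewrite -pt2_line2 addr0.
rewrite E => /is_derive_line; rewrite (_ : (fun s => f (pt2 u s)) = (fun r => f (r *: pt2 0 1 + pt2 u 0))) //.
by apply/funext => s; rewrite E.
Qed.

Lemma is_derive_cont (W : normedModType R) (f : R -> W) (t : R) l :
  is_derive t (1 : R) f l -> {for t, continuous f}.
Proof. by move=> [/derivable1_diffP df _]; exact: differentiable_continuous. Qed.

End Plane.

Section Variation.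
Context {R : realType} {m : nat} {M : topologicalType} {A : manifold R m M}.
Context {L : hermitian_line_bundle A} (D : connection L).
Context (om : M -> 'rV[R]_m -> 'rV[R]_m -> R).
Hypotheses (om_form : is_two_form A om) (pq : prequantum om D).
Implicit Types (c : chart R m M) (U : set M) (e : frame (fib L)).
Local Notation du := (pt2 1 0).
Local Notation dv := (pt2 0 1).

(** Around (u0, v0) a family of curves sg with rates i al stays in the domain
    of a chart c and of a frame e, where its coordinates are restrictions of
    functions smooth on an open set V of the plane.  As V is not confined to
    the square, derivatives of any order exist at its boundary. *)
Definition local_data (sg : R -> R -> M) (al : R -> R -> R) (u0 v0 : R) c e V
    (y : 'rV[R]_2 -> 'rV[R]_m) (a : 'rV[R]_2 -> R) :=
  [/\ atlas A c /\ frames e, open V /\ V (pt2 u0 v0),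
      (forall k, Ckmap k V y) /\ (forall k, Ck k V a),
      forall w, V w -> cimg c (fdom e) (y w) &
      forall u v, I01 u -> I01 v -> V (pt2 u v) ->
        sg u v = cinv c (y (pt2 u v)) /\ al u v = a (pt2 u v)].

Section Local.
Context (sg : R -> R -> M) (al : R -> R -> R) (u0 v0 : R).
Context (c : chart R m M) (e : frame (fib L)) (V : set 'rV[R]_2).
Context (y : 'rV[R]_2 -> 'rV[R]_m) (a : 'rV[R]_2 -> R).
Hypothesis ld : local_data sg al u0 v0 c e V y a.

Lemma ld_vel_u u v : I01 u -> I01 v -> V (pt2 u v) ->
  has_mvelocity A I01 (sg ^~ v) u (tvec A c (y (pt2 u v)) ('D_du y (pt2 u v))) /\
  dwithin I01 (al ^~ v) u ('D_du a (pt2 u v)).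
Proof.
move=> Iu Iv Vuv; have [[Ac fe] [oV _] [Cy Ca] yW sgE] := ld.
have N : \forall s \near u, V (pt2 s v).
  have /nbhs_ballP[d /= d0 dV] := open_nbhs_nbhs (conj oV Vuv).
  apply/nbhs_ballP; exists d => //= s; rewrite -ball_normE /= distrC => sd.
  by apply: dV; apply: pt2_ball => //; rewrite subrr normr0.
split.
  apply: (mvelocity_of_chart (y := fun s => y (pt2 s v)) Ac).
  - by apply: filterS N => s Vs Is; have [] := sgE s v Is Iv Vs.
  - by have [] := sgE u v Iu Iv Vuv.
  - by have [] := cimg_cdom (yW _ Vuv).
  apply: dw_is_derive; apply: is_derive_pt2l.
  exact: Ckmap_derivable (Cy 1%N) Vuv.
have D1 := dw_is_derive I01 (is_derive_pt2l (Ck_derivable (v := du) (Ca 1%N) Vuv)).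
apply: dw_eq D1; last by have [_ ->] := sgE u v Iu Iv Vuv.
by apply: filterS N => s Vs Is; have [_ ->] := sgE s v Is Iv Vs.
Qed.

Lemma ld_vel_v u v : I01 u -> I01 v -> V (pt2 u v) ->
  has_mvelocity A I01 (sg u) v (tvec A c (y (pt2 u v)) ('D_dv y (pt2 u v))).
Proof.
move=> Iu Iv Vuv; have [[Ac fe] [oV _] [Cy Ca] yW sgE] := ld.
have N : \forall s \near v, V (pt2 u s).
  have /nbhs_ballP[d /= d0 dV] := open_nbhs_nbhs (conj oV Vuv).
  apply/nbhs_ballP; exists d => //= s; rewrite -ball_normE /= distrC => sd.
  by apply: dV; apply: pt2_ball => //; rewrite subrr normr0.
apply: (mvelocity_of_chart (y := fun s => y (pt2 u s)) Ac).
- by apply: filterS N => s Vs Is; have [] := sgE u s Iu Is Vs.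
- by have [] := sgE u v Iu Iv Vuv.
- by have [] := cimg_cdom (yW _ Vuv).
apply: dw_is_derive; apply: is_derive_pt2r.
exact: Ckmap_derivable (Cy 1%N) Vuv.
Qed.

Lemma ld_theta w d : V w -> theta D e (cinv c (y w)) (tvec A c (y w) ('D_d y w)) =
  pull (thr D c e) y d w +i* pull (thi D c e) y d w.
Proof.
move=> Vw; have [[Ac fe] _ [Cy _] yW _] := ld.
have dy := Ckmap_derivable (v := d) (Cy 1%N) Vw.
rewrite (theta_tvec D _ Ac fe (yW _ Vw)); congr (_ +i* _);
  by apply: eq_bigr => i _; rewrite (derive_mxE _ _ dy).
Qed.

Context (r : R -> R -> tot_space L).
Context (su : R -> 'rV[R]_m) (sv : R -> R -> 'rV[R]_m) (au : R -> R) (kap : R -> R).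
Hypothesis Iu0 : I01 u0.
Hypothesis r_sg : forall u v, I01 u -> I01 v -> projT1 (r u v) = sg u v.
Hypothesis r_lift : forall u v, I01 u -> I01 v -> cder D I01 (r u) v (sv u v) (0 +i* al u v).
Hypothesis suP : forall v, I01 v -> has_mvelocity A I01 (sg ^~ v) u0 (su v).
Hypothesis auP : forall v, I01 v -> dwithin I01 (al ^~ v) u0 (au v).
Hypothesis kapC : forall x, {for x, continuous kap}.
Hypothesis kapE : forall v, I01 v -> kap v = 2 * pi * om (sg u0 v) (su v) (sv u0 v) + au v.

Let Hr w := - pull (thr D c e) y dv w.
Let Hi w := a w - pull (thi D c e) y dv w.
Let Pr := pull (thr D c e) y du.
Let Pi := pull (thi D c e) y du.

Lemma ld_pull k d :
  Ck k V (pull (thr D c e) y d) /\ Ck k V (pull (thi D c e) y d).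
Proof.
have [[Ac fe] [oV _] [Cy Ca] yW _] := ld.
have oW : open (cimg c (fdom e)) by apply: cimg_open; exact: fdom_open.
have T1 i := (th_Ck D i k Ac fe).1; have T2 i := (th_Ck D i k Ac fe).2.
split; first exact: (pull_Ck d oV oW yW (Cy k.+1) T1).
exact: (pull_Ck d oV oW yW (Cy k.+1) T2).
Qed.

Lemma ld_Ck k : [/\ Ck k V Hr, Ck k V Hi, Ck k V Pr & Ck k V Pi].
Proof.
have [_ [oV _] [_ Ca] _ _] := ld.
have [r1 i1] := ld_pull k dv; have [r2 i2] := ld_pull k du.
split; [exact: Ck_N oV r1| |exact: r2|exact: i2].
exact: (Ck_D oV (Ca k) (Ck_N oV i1)).
Qed.

(** Hr +i* Hi is the logarithmic derivative in v of the fibre coordinate of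
    the lifts, and Pr +i* Pi the connection form on the u-direction.  By the
    curvature equation the u-derivative of the former is, up to the integrand
    kap of the variation formula, a v-derivative. *)
Lemma ld_du v : I01 v -> V (pt2 u0 v) ->
  'D_du Hr (pt2 u0 v) = - 'D_dv Pr (pt2 u0 v) /\
  'D_du Hi (pt2 u0 v) = kap v - 'D_dv Pi (pt2 u0 v).
Proof.
move=> Iv Vv; have [[Ac fe] [oV _] [Cy Ca] yW sgE] := ld.
have [C1 C2] := curv_pull om_form pq du dv Ac fe oV Vv yW (Cy 2%N).
have [r1 i1] := ld_pull 1 dv.
have dr : derivable (pull (thr D c e) y dv) (pt2 u0 v) du by exact: Ck_derivable r1 Vv.
have di : derivable (pull (thi D c e) y dv) (pt2 u0 v) du by exact: Ck_derivable i1 Vv.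
have da : derivable a (pt2 u0 v) du by exact: Ck_derivable (Ca 1%N) Vv.
have [Vu Va] := ld_vel_u Iu0 Iv Vv; have Vv' := ld_vel_v Iu0 Iv Vv.
have Esu : su v = tvec A c (y (pt2 u0 v)) ('D_du y (pt2 u0 v)).
  exact: mvelocity_uniq (acc_I01 Iu0) (suP Iv) Vu.
have Eau : au v = 'D_du a (pt2 u0 v) by exact: dw_uniq (acc_I01 Iu0) (auP Iv) Va.
have Esv : sv u0 v = tvec A c (y (pt2 u0 v)) ('D_dv y (pt2 u0 v)).
  apply: mvelocity_uniq (acc_I01 Iv) _ Vv'.
  have [Hv _] := r_lift Iu0 Iv; apply: mvelocity_ext Hv => // s Is; exact: r_sg.
have Esg : sg u0 v = cinv c (y (pt2 u0 v)) by have [] := sgE u0 v Iu0 Iv Vv.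
split.
  by rewrite -(subr0_eq C1); exact: deriveN dr.
apply: etrans (deriveB da di) _.
have kE := kapE Iv; rewrite Esg Esu Esv Eau in kE.
exact: subr_shift C2 kE.
Qed.

(** On a short segment the fibre coordinates at its ends are related by
    z(u, b) = z(u, a) exp (\int_a^b H(u, v) dv) with H = Hr +i* Hi.
    Differentiate this in u under the integral: by ld_du the exponent
    contributes i \int kap and boundary terms, and these are the values of
    theta by which the rates differ from logarithmic derivatives. *)
Lemma variation_local : I01 v0 -> exists2 d, 0 < d & forall a' b', 0 <= a' -> b' <= 1 ->
  a' <= v0 <= b' -> v0 - d < a' -> b' < v0 + d -> forall w,
  cder D I01 (r ^~ a') u0 (su a') w ->
  cder D I01 (r ^~ b') u0 (su b') (w + (0 +i* rint a' b' kap)).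
Proof.
move=> Iv0; have [[Ac fe] [oV Vw0] [Cy Ca] yW sgE] := ld.
have [CHr CHi CPr CPi] := ld_Ck 1.
pose B1 := `|'D_du Hr (pt2 u0 v0)| + 1; pose B2 := `|'D_du Hi (pt2 u0 v0)| + 1.
have cr : {for pt2 u0 v0, continuous ('D_du Hr)} by exact: (Ck_cont (Ck_derive du CHr) Vw0).
have ci : {for pt2 u0 v0, continuous ('D_du Hi)} by exact: (Ck_cont (Ck_derive du CHi) Vw0).
have := nbhs_and3 (open_nbhs_nbhs (conj oV Vw0)) (continuous_at_near cr ltr01) (continuous_at_near ci ltr01).
move=> /nbhs_ballP[d /= d0 dV].
have V_ u v : `|u - u0| < d -> `|v - v0| < d -> V (pt2 u v).
  by move=> ud vd; have [] := dV _ (pt2_ball d0 ud vd).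
have b1 u v : `|u - u0| < d -> `|v - v0| < d -> `|'D_du Hr (pt2 u v)| <= B1.
  move=> ud vd; have [_ h _] := dV _ (pt2_ball d0 ud vd).
  rewrite /B1 -lerBlDl (le_trans _ (ltW h)) // distrC.
  by rewrite (le_trans (lerB_dist _ _)).
have b2 u v : `|u - u0| < d -> `|v - v0| < d -> `|'D_du Hi (pt2 u v)| <= B2.
  move=> ud vd; have [_ _ h] := dV _ (pt2_ball d0 ud vd).
  rewrite /B2 -lerBlDl (le_trans _ (ltW h)) // distrC.
  by rewrite (le_trans (lerB_dist _ _)).
exists (d / 2); first by rewrite divr_gt0.
move=> a' b' a0 b1' /andP[av vb] ad bd w Hw.
have ab : a' <= b' by lra.
have u0d : `|u0 - u0| < d by rewrite subrr normr0.
have vd_ v : v0 - d / 2 <= v <= v0 + d / 2 -> `|v - v0| < d.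
  by move=> /andP[v1 v2]; rewrite ltr_norml; apply/andP; split; lra.
have dd : d / 2 < d by rewrite ltr_pdivrMr // ltr_pMr // ltr1n.
have ad' : v0 - d < a' by apply: lt_trans ad; rewrite ltrD2l ltrN2.
have bd' : b' < v0 + d by apply: lt_trans bd _; rewrite ltrD2l.
have abs' v : a' <= v <= b' -> v0 - d < v < v0 + d.
  by move=> /andP[v1 v2]; rewrite (lt_le_trans ad') //= (le_lt_trans v2).
have abs v : a' <= v <= b' -> v0 - d / 2 < v < v0 + d / 2.
  by move=> /andP[v1 v2]; rewrite (lt_le_trans ad) //= (le_lt_trans v2).
have abd v : a' <= v <= b' -> v0 - d / 2 <= v <= v0 + d / 2.
  by move=> /andP[v1 v2]; apply/andP; split; lra.
have Iab v : a' <= v <= b' -> I01 v.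
  by move=> /andP[v1 v2]; rewrite /I01 /=; apply/andP; split; lra.
have aa : a' <= a' <= b' by rewrite lexx.
have bb : a' <= b' <= b' by rewrite lexx andbT.
have contv f u v : Ck 1 V f -> `|u - u0| < d -> v0 - d / 2 <= v <= v0 + d / 2 ->
    {for v, continuous (fun s => f (pt2 u s))}.
  move=> Cf ud /vd_ vd; have Vuv := V_ _ _ ud vd.
  exact: is_derive_cont (is_derive_pt2r (Ck_derivable (v := dv) Cf Vuv)).
(* The equation z' = (Hr +i* Hi) z of the lift is solved by an exponential. *)
have sol u : I01 u -> `|u - u0| < d ->
   tfib e (r u b') = tfib e (r u a') * cexp (rint a' b' (fun v => Hr (pt2 u v)) +i* rint a' b' (fun v => Hi (pt2 u v))).
  move=> Iu ud.
  have [Fr [dFr ->]] := rint_primitive (fun v => contv Hr u v CHr ud) => //.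
  have [Fi [dFi ->]] := rint_primitive (fun v => contv Hi u v CHi ud) => //.
  pose E v := cexp (- Fr v +i* - Fi v).
  have zE : tfib e (r u a') * E a' = tfib e (r u b') * E b'.
    apply: (@cd_zero_const _ I01 (fun v => tfib e (r u v) * E v) a' b' ab Iab) => v vab.
    have vd := vd_ v (abd v vab); have Iv := Iab v vab; have Vuv := V_ u v ud vd.
    have [Esg Eal] := sgE u v Iu Iv Vuv.
    have [Hv Hz] := r_lift Iu Iv.
    have Erg := r_sg Iu Iv.
    have ev : fdom e (projT1 (r u v)) by rewrite Erg Esg; have [] := cimg_cdom (yW _ Vuv).
    have Esv : sv u v = tvec A c (y (pt2 u v)) ('D_dv y (pt2 u v)).
      apply: mvelocity_uniq (acc_I01 Iv) _ (ld_vel_v Iu Iv Vuv).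
      by apply: mvelocity_ext Hv => // s Is; exact: r_sg.
    have dz := Hz e fe ev.
    rewrite Erg Esv Esg (ld_theta _ Vuv) Eal in dz.
    have vin := abs v vab.
    have dE : cderiv I01 E v ((- Hr (pt2 u v) +i* - Hi (pt2 u v)) * E v).
      apply: cd_cexp; split; apply: dw_N; apply: dw_is_derive; [exact: dFr|exact: dFi].
    have := cd_M dz dE; congr cderiv.
    rewrite (_ : (0 +i* a (pt2 u v)) - _ = (Hr (pt2 u v) +i* Hi (pt2 u v))); last first.
      by apply: complexP; rewrite /= /Hr /Hi ?add0r.
    rewrite (_ : (- Hr (pt2 u v) +i* - Hi (pt2 u v)) = - (Hr (pt2 u v) +i* Hi (pt2 u v))) //.
    ring.
  have Eb : E b' != 0 by exact: cexp_neq0.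
  apply: (mulIf Eb); rewrite -zE -mulrA -cexpD; congr (_ * cexp _).
  by apply: complexP; rewrite /=; ring.
(* B bounds the integrands uniformly for u near u0, so that the integral may
   be differentiated under its sign. *)
have Dint f B : Ck 1 V f -> (forall u v, `|u - u0| < d -> `|v - v0| < d -> `|'D_du f (pt2 u v)| <= B) ->
   is_derive u0 (1 : R) (fun u => rint a' b' (fun v => f (pt2 u v))) (rint a' b' (fun v => 'D_du f (pt2 u0 v))).
  move=> Cf bf; apply: (rint_diff (H := fun u v => f (pt2 u v)) (dH := fun u v => 'D_du f (pt2 u v)) d0).
  - by move=> u ud; apply: continuous_itv_integrable => v /abd; exact: contv.
  - move=> u v ud /abd/vd_ vd; apply: is_derive_pt2l.
    exact: Ck_derivable Cf (V_ _ _ ud vd).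
  - move=> u v ud /abd/vd_ vd; exact: bf.
have contD f v : Ck 2 V f -> v0 - d / 2 <= v <= v0 + d / 2 ->
    {for v, continuous (fun s => 'D_du f (pt2 u0 s))}.
  move=> Cf vI; have := contv ('D_du f) u0 v (Ck_derive du Cf) u0d vI; exact.
have [CHr2 CHi2 CPr2 CPi2] := ld_Ck 2.
have IHr : rint a' b' (fun v => 'D_du Hr (pt2 u0 v)) = Pr (pt2 u0 a') - Pr (pt2 u0 b').
  have dF v : a' <= v <= b' -> dwithin I01 (fun v => - Pr (pt2 u0 v)) v ('D_du Hr (pt2 u0 v)).
    move=> vab; have vd := vd_ v (abd v vab); have Vv := V_ _ _ u0d vd.
    have [-> _] := ld_du (Iab v vab) Vv.
    apply: dw_N; apply: dw_is_derive; apply: is_derive_pt2r.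
    exact: Ck_derivable CPr Vv.
  by rewrite (rint_FTC2 (fun v => contD Hr v CHr2) ad ab bd Iab dF) opprK addrC.
have kapC' x : v0 - d <= x <= v0 + d -> {for x, continuous kap} by move=> _; exact: kapC.
have [K [dK Kint]] := rint_primitive kapC'.
have IHi : rint a' b' (fun v => 'D_du Hi (pt2 u0 v)) = rint a' b' kap + (Pi (pt2 u0 a') - Pi (pt2 u0 b')).
  have dF v : a' <= v <= b' -> dwithin I01 (fun v => K v + - Pi (pt2 u0 v)) v ('D_du Hi (pt2 u0 v)).
    move=> vab; have vd := vd_ v (abd v vab); have Vv := V_ _ _ u0d vd.
    have [_ ->] := ld_du (Iab v vab) Vv; apply: dw_D.
      exact: dw_is_derive (dK v (abs' v vab)).
    apply: dw_N; apply: dw_is_derive; apply: is_derive_pt2r.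
    exact: Ck_derivable CPi Vv.
  rewrite (rint_FTC2 (fun v => contD Hi v CHi2) ad ab bd Iab dF) (Kint _ _ ad' ab bd').
  by rewrite opprD opprK addrACA [- Pi _ + _]addrC.
have Vb := V_ _ _ u0d (vd_ _ (abd _ bb)); have Va := V_ _ _ u0d (vd_ _ (abd _ aa)).
have Ib := Iab _ bb; have Ia := Iab _ aa.
have [Esga _] := sgE u0 a' Iu0 Ia Va; have [Esgb _] := sgE u0 b' Iu0 Ib Vb.
have ea : fdom e (projT1 (r u0 a')) by rewrite r_sg // Esga; have [] := cimg_cdom (yW _ Va).
have eb : fdom e (projT1 (r u0 b')) by rewrite r_sg // Esgb; have [] := cimg_cdom (yW _ Vb).
have Hvb : has_mvelocity A I01 (fun s => projT1 (r s b')) u0 (su b').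
  by apply: mvelocity_ext (suP Ib) => // s Is; rewrite (r_sg Is Ib).
apply: (cder_of_frame Hvb fe eb).
have [_ /(_ e fe ea) dza] := Hw.
have dexp : cderiv I01 (fun u => cexp (rint a' b' (fun v => Hr (pt2 u v)) +i* rint a' b' (fun v => Hi (pt2 u v)))) u0
   (((Pr (pt2 u0 a') - Pr (pt2 u0 b')) +i* (rint a' b' kap + (Pi (pt2 u0 a') - Pi (pt2 u0 b')))) *
    cexp (rint a' b' (fun v => Hr (pt2 u0 v)) +i* rint a' b' (fun v => Hi (pt2 u0 v)))).
  apply: cd_cexp; split; apply: dw_is_derive; rewrite /= -?IHr -?IHi.
    exact: Dint CHr b1.
  exact: Dint CHi b2.
have Esu v : I01 v -> V (pt2 u0 v) -> su v = tvec A c (y (pt2 u0 v)) ('D_du y (pt2 u0 v)).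
  by move=> Iv Vv; have [Vu _] := ld_vel_u Iu0 Iv Vv; exact: mvelocity_uniq (acc_I01 Iu0) (suP Iv) Vu.
rewrite (r_sg Iu0 Ia) (Esu _ Ia Va) Esga (ld_theta _ Va) -/Pr -/Pi in dza.
rewrite (r_sg Iu0 Ib) (Esu _ Ib Vb) Esgb (ld_theta _ Vb) -/Pr -/Pi.
have near_sol : \forall u \near u0, I01 u -> tfib e (r u a') *
    cexp (rint a' b' (fun v => Hr (pt2 u v)) +i* rint a' b' (fun v => Hi (pt2 u v))) = tfib e (r u b').
  apply/nbhs_ballP; exists d => //= s; rewrite -ball_normE /= distrC => sd Is.
  by rewrite (sol s Is sd).
apply: cd_eq near_sol (esym (sol u0 Iu0 u0d)) _.
have := cd_M dza dexp; congr cderiv; rewrite (sol u0 Iu0 u0d).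
set z1 := tfib e _; set z2 := cexp _.
rewrite (_ : _ +i* (rint a' b' kap + _) = (Pr (pt2 u0 a') +i* Pi (pt2 u0 a')) - (Pr (pt2 u0 b') +i* Pi (pt2 u0 b')) + (0 +i* rint a' b' kap)).
  exact: transport_rate.
by apply: complexP => /=; rewrite ?addr0 // addrC.
Qed.

End Local.
End Variation.

Section Global.
Context {R : realType} {m : nat} {M : topologicalType} {A : manifold R m M}.
Context {L : hermitian_line_bundle A} (D : connection L).
Context (om : M -> 'rV[R]_m -> 'rV[R]_m -> R).
Hypotheses (om_form : is_two_form A om) (pq : prequantum om D).
Implicit Types (c : chart R m M) (U : set M) (e : frame (fib L)).

(** The family sg, with the rates i al of its lifts in the v-direction, is
    smooth around (u0, v0), up to the boundary of the square. *)
Definition nice_family (sg : R -> R -> M) (al : R -> R -> R) (u0 v0 : R) :=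
  exists c e V y a, local_data (L := L) sg al u0 v0 c e V y a.

(** The variation formula.  Let r(u, .) be lifts of the curves sg(u, .) with
    rates i al.  When the starting points r(u, 0) move with rate w, the end
    points move with rate w + i \int kap, where kap is 2 pi times the pullback
    of om plus the u-derivative of al; the changes over short segments add
    up. *)
Lemma lift_variation (sg : R -> R -> M) (al : R -> R -> R) (u0 : R) (r : R -> R -> tot_space L)
    (su : R -> 'rV[R]_m) (sv : R -> R -> 'rV[R]_m) (au kap : R -> R) w :
  I01 u0 -> (forall v, I01 v -> nice_family sg al u0 v) ->
  (forall u v, I01 u -> I01 v -> projT1 (r u v) = sg u v) ->
  (forall u v, I01 u -> I01 v -> cder D I01 (r u) v (sv u v) (0 +i* al u v)) ->
  (forall v, I01 v -> has_mvelocity A I01 (sg ^~ v) u0 (su v)) ->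
  (forall v, I01 v -> dwithin I01 (al ^~ v) u0 (au v)) ->
  (forall x, {for x, continuous kap}) ->
  (forall v, I01 v -> kap v = 2 * pi * om (sg u0 v) (su v) (sv u0 v) + au v) ->
  cder D I01 (r ^~ 0) u0 (su 0) w ->
  cder D I01 (r ^~ 1) u0 (su 1) (w + (0 +i* rint 0 1 kap)).
Proof.
move=> Iu0 nice rsg rl suP auP kC kE; move: w.
pose P a b := forall w, cder D I01 (r ^~ a) u0 (su a) w ->
  cder D I01 (r ^~ b) u0 (su b) (w + (0 +i* rint a b kap)).
apply: (@cousin _ P 0 1 ler01) => [x y z _ xy yz _ H1 H2 w Hw|t It].
  have := H2 _ (H1 _ Hw); congr cder; rewrite (rint_cat kC xy yz) -addrA; congr (_ + _).
  by apply: complexP => /=; rewrite ?addr0.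
have [c [e [V [y [a ld]]]]] := nice t It.
exact: (variation_local om_form pq ld Iu0 rsg rl suP auP kC kE It).
Qed.

Definition tratio (p q : R -> tot_space L) t : R[i] :=
  tfib (frame_at L (projT1 (p t))) (q t) / tfib (frame_at L (projT1 (p t))) (p t).

Lemma tfib_neq0 e (p : tot_space L) : fdom e (projT1 p) -> slit p -> tfib e p != 0.
Proof. by move=> ep; rewrite /slit /tfib fcoord_eq0. Qed.

Lemma ratio_frame p q t e : projT1 (q t) = projT1 (p t) -> slit (p t) ->
  fdom e (projT1 (p t)) -> tratio p q t = tfib e (q t) / tfib e (p t).
Proof.
move=> qp sp ep; rewrite /tratio; set e0 := frame_at L _.
have e0p : fdom e0 (projT1 (p t)) by exact: frame_at_dom.
have eq : fdom e (projT1 (q t)) by rewrite qp.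
have e0q : fdom e0 (projT1 (q t)) by rewrite qp.
rewrite (tfib_change ep e0p) (tfib_change eq e0q) qp -mulf_div mulfV ?mulr1 //.
have := tfib_neq0 e0p sp; rewrite (tfib_change ep e0p) mulf_eq0 negb_or.
by case/andP.
Qed.

Lemma tscale_ratio p q t : projT1 (q t) = projT1 (p t) -> slit (p t) ->
  q t = tscale (tratio p q t) (p t).
Proof.
move=> qp sp; rewrite /tratio; set e := frame_at L _.
have ep : fdom e (projT1 (p t)) by exact: frame_at_dom.
move: qp sp ep; rewrite /tfib /tscale /slit.
case: (p t) (q t) => x v [x' v'] /= E; subst x' => v0 ex; congr existT.
apply: (fcoord_inj ex); rewrite fcoordZ // divfK //.
by rewrite fcoord_eq0.
Qed.

(** In the quotient of the two fibre coordinates the connection form cancels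
    and the difference of the rates remains. *)
Lemma ratio_cderiv (J : set R) p q t v w w' : J t -> (forall s, J s -> projT1 (q s) = projT1 (p s)) ->
  (forall s, J s -> slit (p s)) -> cder D J p t v w -> cder D J q t v w' ->
  cderiv J (tratio p q) t ((w' - w) * tratio p q t).
Proof.
move=> Jt qp sp [Hp dp] [Hq dq]; set e := frame_at L (projT1 (p t)).
have fe : frames e by exact: frame_atP.
have ep : fdom e (projT1 (p t)) by exact: frame_at_dom.
have eq : fdom e (projT1 (q t)) by rewrite qp.
have N := mvelocity_near Hp (fdom_open e) ep.
have zp0 := tfib_neq0 ep (sp t Jt).
have d1 := dq e fe eq; have d2 := cd_V zp0 (dp e fe ep).
rewrite qp // in d1; have := cd_M d1 d2.
have -> : (w' - theta D e (projT1 (p t)) v) * tfib e (q t) / tfib e (p t) +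
    tfib e (q t) * (- ((w - theta D e (projT1 (p t)) v) * tfib e (p t)) / tfib e (p t) ^+ 2) =
    (w' - w) * tratio p q t.
  by rewrite (ratio_frame (qp t Jt) (sp t Jt) ep); move: zp0 => /= zp0; field.
apply: cd_eq; last by rewrite (ratio_frame (qp t Jt) (sp t Jt) ep).
by apply: filterS N => s H Js; rewrite (ratio_frame (qp s Js) (sp s Js) (H Js)).
Qed.

Lemma cd_cont_expi (z : R -> R[i]) (k : R -> R) a b : a <= b ->
  (forall t, a <= t <= b -> I01 t) -> (forall x, {for x, continuous k}) ->
  (forall t, a <= t <= b -> cderiv I01 z t ((0 +i* k t) * z t)) ->
  z b = z a * expi (rint a b k).
Proof.
move=> ab Iab kC dz.
have kC' x : a - 1 <= x <= b + 1 -> {for x, continuous k} by move=> _; exact: kC.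
have [K [dK Kint]] := rint_primitive kC'.
have a1 : a - 1 < a by rewrite ltrBlDr ltrDl.
have b1 : b < b + 1 by rewrite ltrDl.
rewrite (Kint _ _ a1 ab b1).
have E : z a * expi (- K a) = z b * expi (- K b).
  apply: (@cd_zero_const _ I01 (fun t => z t * expi (- K t)) a b ab Iab) => t tab.
  have dKt : is_derive t (1 : R) K (k t).
    by apply: dK; move/andP: tab => [t1 t2]; rewrite (lt_le_trans a1) //= (le_lt_trans t2).
  have := cd_M (dz t tab) (cd_expi (dw_N (dw_is_derive I01 dKt))).
  congr cderiv; rewrite (_ : 0 +i* - k t = - (0 +i* k t)); last by apply: complexP; rewrite /= ?oppr0.
  ring.
apply: (mulIf (expi_neq0 (- K b))); rewrite -E -mulrA -expiD; congr (_ * expi _).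
by rewrite addrAC subrr add0r.
Qed.

Lemma ratio_expi p q (v : R -> 'rV[R]_m) (w w' : R -> R[i]) (k : R -> R) :
  (forall s, I01 s -> projT1 (q s) = projT1 (p s)) ->
  (forall s, I01 s -> slit (p s)) ->
  (forall t, I01 t -> cder D I01 p t (v t) (w t)) ->
  (forall t, I01 t -> cder D I01 q t (v t) (w' t)) ->
  (forall x, {for x, continuous k}) -> (forall t, I01 t -> w' t - w t = 0 +i* k t) ->
  tratio p q 1 = tratio p q 0 * expi (rint 0 1 k).
Proof.
move=> qp sp dp dq kC kE; apply: cd_cont_expi => // t It.
rewrite -kE //; exact: ratio_cderiv It qp sp (dp t It) (dq t It).
Qed.

Lemma rint0 a b : rint a b (fun _ : R => 0 : R) = 0.
Proof. by rewrite /rint /Rintegral integral0. Qed.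

Lemma ratio_const p q (v : R -> 'rV[R]_m) (w : R -> R[i]) :
  (forall s, I01 s -> projT1 (q s) = projT1 (p s)) ->
  (forall s, I01 s -> slit (p s)) ->
  (forall t, I01 t -> cder D I01 p t (v t) (w t)) ->
  (forall t, I01 t -> cder D I01 q t (v t) (w t)) ->
  tratio p q 1 = tratio p q 0.
Proof.
move=> qp sp dp dq.
rewrite (ratio_expi (k := fun _ => 0) qp sp dp dq); first by rewrite rint0 expi0 mulr1.
  by move=> x; exact: cst_continuous.
by move=> t _; rewrite subrr.
Qed.

End Global.

(** * Existence of lifts *)

Section Existence.
Context {R : realType} {m : nat} {M : topologicalType} {A : manifold R m M}.
Context {L : hermitian_line_bundle A} (D : connection L).
Implicit Types (c : chart R m M) (U : set M) (e : frame (fib L)).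

Lemma dw_sub (V : normedModType R) (J J' : set R) (f : R -> V) t l :
  (\forall s \near t, J' s -> J s) -> dwithin J f t l -> dwithin J' f t l.
Proof.
move=> /nbhs_ballP[d /= d0 JJ] /dwithinP df; apply/dwithinP => e e0.
have [d' d'0 H] := df e e0; exists (Num.min d d') => [|s J's]; first by rewrite lt_min d0.
rewrite lt_min => /andP[sd sd']; apply: H => //; apply: JJ => //.
by rewrite -ball_normE /= distrC.
Qed.

Lemma dw_union (V : normedModType R) (J J1 J2 : set R) (f : R -> V) t l :
  (forall s, J s -> J1 s \/ J2 s) -> dwithin J1 f t l -> dwithin J2 f t l -> dwithin J f t l.
Proof.
move=> JJ /dwithinP d1 /dwithinP d2; apply/dwithinP => e e0.
have [a a0 H1] := d1 e e0; have [b b0 H2] := d2 e e0.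
exists (Num.min a b) => [|s Js]; first by rewrite lt_min a0.
rewrite lt_min => /andP[sa sb].
by case: (JJ s Js) => K; [exact: H1|exact: H2].
Qed.

Lemma cd_sub (J J' : set R) (f : R -> R[i]) t l :
  (\forall s \near t, J' s -> J s) -> cderiv J f t l -> cderiv J' f t l.
Proof. by move=> JJ [h1 h2]; split; [exact: dw_sub h1|exact: dw_sub h2]. Qed.

Lemma cd_union (J J1 J2 : set R) (f : R -> R[i]) t l :
  (forall s, J s -> J1 s \/ J2 s) -> cderiv J1 f t l -> cderiv J2 f t l -> cderiv J f t l.
Proof.
by move=> JJ [h1 h2] [k1 k2]; split; [exact: dw_union h1 k1|exact: dw_union h2 k2].
Qed.

Lemma mvelocity_sub (J J' : set R) (g : R -> M) t v :
  J' `<=` J -> has_mvelocity A J g t v -> has_mvelocity A J' g t v.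
Proof.
move=> JJ [H1 H2]; split; first by apply: filterS H1 => s H /JJ.
have dw : dwithin J (cmap (chart_at A (g t)) \o g) t v by [].
have JJn : \forall s \near t, J' s -> J s by apply: filterS H1 => s _; exact: JJ.
exact: dw_sub JJn dw.
Qed.

Lemma tfib_tscale e z (p : tot_space L) : fdom e (projT1 p) ->
  tfib e (tscale z p) = z * tfib e p.
Proof. by move=> ep; rewrite /tfib /tscale /= fcoordZ. Qed.

Section Lift.
Context (sg : R -> M) (v : R -> 'rV[R]_m) (W : R -> R[i]).
Hypothesis sgv : forall t, I01 t -> has_mvelocity A I01 sg t (v t).

(** Only the fibre equation is relative to J; the velocity of the base curve
    is known on the whole of [0, 1].  In this form lifts over adjacent segments
    can be glued. *)
Definition lift_on (J : set R) (p : R -> tot_space L) := forall t, J t ->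
  [/\ projT1 (p t) = sg t, slit (p t) & forall e, frames e -> fdom e (sg t) ->
    cderiv J (fun s => tfib e (p s)) t ((W t - theta D e (sg t) (v t)) * tfib e (p t))].

Lemma lift_on_scale (J : set R) p z : J `<=` I01 -> z != 0 -> lift_on J p ->
  lift_on J (fun s => tscale z (p s)).
Proof.
move=> JI z0 lp t Jt; have [pt st dp] := lp t Jt; split=> //.
  by rewrite /slit /tscale /= scaler_eq0 negb_or z0.
move=> e fe et; have := cd_M (cd_cst J z t) (dp e fe et).
have ept : fdom e (projT1 (p t)) by rewrite pt.
rewrite mul0r add0r (tfib_tscale _ ept) mulrCA; apply: cd_eq; last first.
  by rewrite tfib_tscale.
have := mvelocity_near (sgv (JI _ Jt)) (fdom_open e) et.
apply: filterS => s H Js; rewrite tfib_tscale //.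
have [-> _ _] := lp s Js; exact: H (JI _ Js).
Qed.

Definition seg (a b : R) : set R := [set t | a <= t <= b].

(** Multiplication of the second lift by a constant makes the two lifts agree
    at the common end point. *)
Lemma lift_on_glue x y z p q : 0 <= x -> x <= y -> y <= z -> z <= 1 ->
  lift_on (seg x y) p -> lift_on (seg y z) q -> exists g, lift_on (seg x z) g.
Proof.
move=> x0 xy yz z1 lp lq.
have I1 : seg x y `<=` I01 by move=> t /= /andP[? ?]; apply/andP; split; lra.
have I2 : seg y z `<=` I01 by move=> t /= /andP[? ?]; apply/andP; split; lra.
have yp : seg x y y by rewrite /seg /= xy lexx.
have yq : seg y z y by rewrite /seg /= yz lexx.
have [py sp _] := lp y yp; have [qy sq _] := lq y yq.
(* k is the factor between the two lifts at y. *)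
have pqy : projT1 (p y) = projT1 (q y) by rewrite py qy.
have E := tscale_ratio pqy sq; set k := tratio q p y in E.
have k0 : k != 0.
  by apply/eqP => k0; move: sp; rewrite E k0 /slit /tscale /= scale0r eqxx.
have lq' := lift_on_scale I2 k0 lq.
pose q' s := tscale k (q s); rewrite -/q' in lq'.
have Ey : p y = q' y by [].
pose g t := if t <= y then p t else q' t.
have gp t : t <= y -> g t = p t by rewrite /g => ->.
have gq t : y <= t -> g t = q' t.
  by rewrite le_eqVlt => /orP[/eqP <-|yt]; rewrite /g ?lexx // leNgt yt.
exists g => t /andP[xt tz].
have [ty|ty|ty] := ltgtP t y.
- have Jt : seg x y t by rewrite /seg /= xt ltW.
  have [pt st dp] := lp t Jt; rewrite gp ?ltW //; split=> // e fe et.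
  have N : \forall s \near t, s < y by exact: lt_nbhsl.
  apply: cd_eq (_ : cderiv _ (fun s => tfib e (p s)) t _); last first.
  + apply: cd_sub (dp e fe et); apply: filterS N => s sy /andP[xs _].
    by rewrite /seg /= xs ltW.
  + by rewrite gp // ltW.
  + by apply: filterS N => s sy _; rewrite gp // ltW.
- have Jt : seg y z t by rewrite /seg /= tz ltW.
  have [pt st dp] := lq' t Jt; rewrite gq ?ltW //; split=> // e fe et.
  have N : \forall s \near t, y < s by exact: lt_nbhsr.
  apply: cd_eq (_ : cderiv _ (fun s => tfib e (q' s)) t _); last first.
  + apply: cd_sub (dp e fe et); apply: filterS N => s sy /andP[_ xs].
    by rewrite /seg /= xs ltW.
  + by rewrite gq // ltW.
  + by apply: filterS N => s sy _; rewrite gq // ltW.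
- subst t; have [pt st dp] := lp y yp; rewrite gp //; split=> // e fe et.
  have [_ _ dq] := lq' y yq.
  have dp' : cderiv (seg x y) (fun s => tfib e (g s)) y ((W y - theta D e (sg y) (v y)) * tfib e (p y)).
    apply: cd_eq (dp e fe et); last by rewrite gp.
    by near=> s => /andP[_ sy]; rewrite gp.
  have dq' : cderiv (seg y z) (fun s => tfib e (g s)) y ((W y - theta D e (sg y) (v y)) * tfib e (p y)).
    rewrite Ey; apply: cd_eq (dq e fe et); last by rewrite gq.
    by near=> s => /andP[sy _]; rewrite gq.
  apply: cd_union dp' dq' => s /andP[xs sz].
  by have [sy|/ltW sy] := leP s y; [left|right]; rewrite /seg /= ?xs ?sz ?sy.
Unshelve. all: by end_near. Qed.

End Lift.

(** In a frame the equation of a lift has an explicit solution, the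
    exponential of a primitive of its coefficient. *)
Lemma local_lift (sg : R -> R -> M) (al : R -> R -> R) u t0 c e V y a (sv : R -> 'rV[R]_m) :
  I01 u -> local_data (L := L) sg al u t0 c e V y a ->
  (forall t, I01 t -> has_mvelocity A I01 (sg u) t (sv t)) ->
  exists2 d, 0 < d & forall a' b', 0 <= a' -> b' <= 1 -> a' <= t0 <= b' ->
    t0 - d < a' -> b' < t0 + d ->
    exists p, lift_on (sg u) sv (fun t => 0 +i* al u t) (seg a' b') p.
Proof.
move=> Iu ld svP; have [[Ac fe] [oV Vw0] [Cy Ca] yW sgE] := ld.
pose Hr w := - pull (thr D c e) y (pt2 0 1) w.
pose Hi w := a w - pull (thi D c e) y (pt2 0 1) w.
have [r1 i1] := ld_pull D ld 1 (pt2 0 1).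
have CHr : Ck 1 V Hr by exact: Ck_N oV r1.
have CHi : Ck 1 V Hi by exact: (Ck_D oV (Ca 1%N) (Ck_N oV i1)).
have /nbhs_ballP[d /= d0 dV] := open_nbhs_nbhs (conj oV Vw0).
have V_ v : `|v - t0| < d -> V (pt2 u v).
  by move=> vd; apply: dV; apply: pt2_ball => //; rewrite subrr normr0.
have dd : d / 2 < d by rewrite ltr_pdivrMr // ltr_pMr // ltr1n.
have vd_ v : t0 - d / 2 <= v <= t0 + d / 2 -> `|v - t0| < d.
  by move=> vI; apply: le_lt_trans dd; rewrite ler_distl.
have contv f v : Ck 1 V f -> t0 - d / 2 <= v <= t0 + d / 2 ->
    {for v, continuous (fun s => f (pt2 u s))}.
  move=> Cf /vd_/V_ Vuv.
  exact: is_derive_cont (is_derive_pt2r (Ck_derivable (v := pt2 0 1) Cf Vuv)).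
exists (d / 2); first by rewrite divr_gt0.
move=> a' b' a0 b1 /andP[av vb] ad bd.
have [Fr [dFr _]] := rint_primitive (fun v => contv Hr v CHr).
have [Fi [dFi _]] := rint_primitive (fun v => contv Hi v CHi).
pose z v := cexp (Fr v +i* Fi v).
pose p v : tot_space L := existT _ (sg u v) (z v *: fvec e (sg u v)).
have sI : seg a' b' `<=` I01.
  by move=> t /= /andP[t1 t2]; rewrite /I01 /= (le_trans a0) // (le_trans t2).
exists p => t Jt; have It := sI t Jt; move/andP: (Jt) => [t1 t2].
have tin : t0 - d / 2 < t < t0 + d / 2 by rewrite (lt_le_trans ad) //= (le_lt_trans t2).
have td : `|t - t0| < d by apply: vd_; move/andP: tin => [h1 h2]; rewrite !ltW.
have Vt := V_ t td; have [Esg Eal] := sgE u t Iu It Vt.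
have et : fdom e (sg u t) by rewrite Esg; have [] := cimg_cdom (yW _ Vt).
have zE s : fdom e (sg u s) -> tfib e (p s) = z s.
  by move=> es; rewrite /tfib /p /= fcoordK.
split=> //.
  rewrite /slit /p /= scaler_eq0 negb_or cexp_neq0 /= -(fcoord_eq0 _ et).
  by rewrite fcoord_fvec // oner_eq0.
have Hv : has_mvelocity A (seg a' b') (fun s => projT1 (p s)) t (sv t).
  exact: mvelocity_sub sI (svP t It).
suff [_ H] : cder D (seg a' b') p t (sv t) (0 +i* al u t) by exact: H.
apply: (cder_of_frame Hv fe et); rewrite zE //.
have Esv : sv t = tvec A c (y (pt2 u t)) ('D_(pt2 0 1) y (pt2 u t)).
  exact: mvelocity_uniq (acc_I01 It) (svP t It) (ld_vel_v ld Iu It Vt).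
have -> : (0 +i* al u t) - theta D e (projT1 (p t)) (sv t) = Hr (pt2 u t) +i* Hi (pt2 u t).
  rewrite /= Esv Esg (ld_theta D ld _ Vt) Eal.
  by apply: complexP; rewrite /= /Hr /Hi ?add0r.
have dz : cderiv (seg a' b') z t ((Hr (pt2 u t) +i* Hi (pt2 u t)) * z t).
  by apply: cd_cexp; split; apply: dw_is_derive; [exact: dFr|exact: dFi].
apply: cd_eq dz; last by rewrite zE.
have := mvelocity_near (svP t It) (fdom_open e) et.
by apply: filterS => s H Js; rewrite zE //; exact: H (sI _ Js).
Qed.

Lemma tscale_ex (p q : tot_space L) : projT1 q = projT1 p -> slit p ->
  exists z, q = tscale z p.
Proof.
move=> qp sp; exists (tratio (fun=> p) (fun=> q) (0 : R)).
exact: (@tscale_ratio _ _ _ _ _ (fun=> p) (fun=> q) 0).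
Qed.

Lemma lift_exists (sg : R -> R -> M) (al : R -> R -> R) u (sv : R -> 'rV[R]_m) (q0 : tot_space L) :
  I01 u -> (forall v0, I01 v0 -> nice_family (L := L) sg al u v0) ->
  (forall t, I01 t -> has_mvelocity A I01 (sg u) t (sv t)) ->
  projT1 q0 = sg u 0 -> slit q0 ->
  exists p, [/\ p 0 = q0, forall t, I01 t -> projT1 (p t) = sg u t,
    forall t, I01 t -> slit (p t) &
    forall t, I01 t -> cder D I01 p t (sv t) (0 +i* al u t)].
Proof.
move=> Iu nice svP q0E sq.
pose W t := 0 +i* al u t.
have [p lp] : exists p, lift_on (sg u) sv W (seg 0 1) p.
  apply: (@cousin _ (fun x y => exists p, lift_on (sg u) sv W (seg x y) p) 0 1 ler01).
    move=> x y z x0 xy yz z1 [p lp] [q lq].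
    have K := lift_on_glue svP x0 xy yz z1 lp lq. exact K.
  move=> t It; have [c [e [V [y [a ld]]]]] := nice t It.
  exact: local_lift Iu ld svP.
have I0 : seg 0 1 0 by rewrite /seg /= lexx ler01.
have [p0 s0 _] := lp 0 I0.
have q0p : projT1 q0 = projT1 (p 0) by rewrite q0E p0.
have [z zE] := tscale_ex q0p s0.
have z0 : z != 0.
  by apply/eqP => k0; move: sq; rewrite zE k0 /slit /tscale /= scale0r eqxx.
have lp' := lift_on_scale svP (fun t It => It) z0 lp.
exists (fun s => tscale z (p s)); split=> // t It; have [pt st dp] := lp' t It => //.
split; last by move=> e fe; rewrite pt; exact: dp.
apply: mvelocity_ext (svP t It) => // s Is.
by have [-> _ _] := lp' s Is.
Qed.

End Existence.

(** * Families given by smooth maps *)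

Section Families.
Context {R : realType} {m : nat} {M : topologicalType} {A : manifold R m M}.
Context {L : hermitian_line_bundle A}.
Implicit Types (c : chart R m M) (U : set M) (e : frame (fib L)).

Lemma Ckmap_preimage_open p q (V : set 'rV[R]_p) (W : set 'rV[R]_q) (y : 'rV[R]_p -> 'rV[R]_q) :
  open V -> open W -> Ckmap 0 V y -> open (V `&` y @^-1` W).
Proof.
move=> oV oW Cy; rewrite openE => w [Vw Ww]; rewrite /interior.
have N1 : nbhs w V by exact: open_nbhs_nbhs.
have N2 : nbhs w (y @^-1` W).
  by apply: (Ckmap_cont Cy Vw); exact: open_nbhs_nbhs.
exact: (filterI N1 N2).
Qed.

(** The local extensions of g that exist by smoothness on B are composed with
    Th. *)
Lemma nice_of_smooth_into k (B : set 'rV[R]_k) (g : 'rV[R]_k -> M) (Th : 'rV[R]_2 -> 'rV[R]_k) u0 v0 :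
  smooth_into A B g -> (forall j, Ckmap j setT Th) ->
  (forall u v, I01 u -> I01 v -> B (Th (pt2 u v))) -> I01 u0 -> I01 v0 ->
  nice_family (L := L) (fun u v => g (Th (pt2 u v))) (fun _ _ => 0) u0 v0.
Proof.
move=> sg CT BT Iu Iv; set z0 := Th (pt2 u0 v0).
have Bz0 : B z0 by exact: BT.
set c := chart_at A (g z0); set e := frame_at L (g z0).
have Ac : atlas A c by exact: chart_atP.
have fe : frames e by exact: frame_atP.
have ez0 : fdom e (g z0) by exact: frame_at_dom.
have [W0 [yh [oW0 W0z Cyh yhE]]] := smooth_into_chart sg Bz0.
have [cz0 yz0] := yhE z0 Bz0 W0z.
pose W1 := W0 `&` yh @^-1` cimg c (fdom e).
have oW1 : open W1.
  by apply: Ckmap_preimage_open => //; apply: cimg_open; exact: fdom_open.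
pose V2 := [set: 'rV[R]_2] `&` Th @^-1` W1.
have oV2 : open V2 by apply: Ckmap_preimage_open => //; exact: openT.
have CT' j : Ckmap j V2 Th by move=> i; exact: Ck_sub (CT j i).
exists c, e, V2, (yh \o Th), (fun=> 0); split=> //.
- by split=> //; split=> //; split=> //=; rewrite yz0; exact: cimg_mem.
- split=> j; last exact: Ck_cst.
  move=> i; apply: (Ck_comp oV2 oW0 _ (Cyh j i) (CT' j)).
  by move=> w [_ []].
- by move=> w [_ []].
- move=> u v Iu' Iv' [_ [W0w _]]; split=> //=.
  by have [cw ->] := yhE _ (BT u v Iu' Iv') W0w; rewrite cmapK.
Qed.

Lemma nice_potential (sg : R -> R -> M) (f : R -> M -> R) u0 v0 :
  smooth_time_fun A f -> I01 u0 -> I01 v0 ->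
  nice_family (L := L) sg (fun _ _ => 0) u0 v0 ->
  nice_family (L := L) sg (fun u v => - (2 * pi * f v (sg u v))) u0 v0.
Proof.
move=> sf Iu Iv [c [e [V [y [a [[Ac fe] [oV Vw] [Cy _] yW sgE]]]]]].
pose G (w : 'rV[R]_2) : 'rV[R]_(1 + m) := row_mx ((w 0 1)%:M : 'M[R]_1) (y w).
have CG j : Ckmap j V G.
  move=> i; rewrite /G; case: (split_ordP i) => l ->.
    rewrite (_ : (fun w => _) = (fun w : 'rV[R]_2 => w 0 1)); first exact: Ck_coord.
    by apply/funext => w; rewrite row_mxEl mxE ord1 eqxx.
  rewrite (_ : (fun w => _) = (fun w : 'rV[R]_2 => y w 0 l)); first exact: Cy.
  by apply/funext => w; rewrite row_mxEr.
have Gcyl u v : I01 v -> V (pt2 u v) -> cyl c (G (pt2 u v)).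
  move=> Iv' Vw'; rewrite /cyl /= /G row_mxKl row_mxKr mxE eqxx pt2E; split=> //.
  by have [] := cimg_cdom (yW _ Vw').
have [V' [h [oV' V'w Ch hE]]] := sf c Ac (G (pt2 u0 v0)) (Gcyl _ _ Iv Vw).
pose V2 := V `&` G @^-1` V'.
have oV2 : open V2 by exact: Ckmap_preimage_open.
have sV : V2 `<=` V by move=> w [].
exists c, e, V2, y, (fun w => (- (2 * pi)) * h (G w)); split=> //.
- split=> j; first by move=> i; exact: Ck_sub sV (Cy j i).
  apply: Ck_M => //; first exact: Ck_cst.
  apply: (Ck_comp oV2 oV' _ (Ch j)) => [w []//|i].
  exact: Ck_sub sV (CG j i).
- by move=> w /sV; exact: yW.
move=> u v Iu' Iv' [Vuv V'uv]; have [E _] := sgE u v Iu' Iv' Vuv; split=> //.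
rewrite -hE //; last exact: Gcyl.
by rewrite /G row_mxKl row_mxKr mxE eqxx pt2E E mulNr.
Qed.

Lemma nice_velocity_v (sg : R -> R -> M) al u : I01 u ->
  (forall v, I01 v -> nice_family (L := L) sg al u v) ->
  exists sv : R -> 'rV[R]_m, forall v, I01 v -> has_mvelocity A I01 (sg u) v (sv v).
Proof.
move=> Iu nice.
have /choice[sv svP] : forall v, exists a, I01 v -> has_mvelocity A I01 (sg u) v a.
  move=> v; have [Iv|nIv] := pselect (I01 v); last by exists 0.
  have [c [e [V [y [a ld]]]]] := nice v Iv; have [_ [_ Vw] _ _ _] := ld.
  by have H := ld_vel_v ld Iu Iv Vw; eexists => _; exact: H.
by exists sv.
Qed.

Lemma nice_velocity_u (sg : R -> R -> M) al :
  (forall u v, I01 u -> I01 v -> nice_family (L := L) sg al u v) ->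
  exists su : R -> R -> 'rV[R]_m, forall u v, I01 u -> I01 v ->
    has_mvelocity A I01 (sg ^~ v) u (su u v).
Proof.
move=> nice.
have /choice[su suP] : forall uv : R * R, exists a, I01 uv.1 -> I01 uv.2 ->
    has_mvelocity A I01 (sg ^~ uv.2) uv.1 a.
  move=> [u v] /=; have [Iu|nIu] := pselect (I01 u); last by exists 0.
  have [Iv|nIv] := pselect (I01 v); last by exists 0.
  have [c [e [V [y [a ld]]]]] := nice u v Iu Iv; have [_ [_ Vw] _ _ _] := ld.
  by have [H _] := ld_vel_u ld Iu Iv Vw; eexists => _ _; exact: H.
by exists (fun u v => su (u, v)) => u v Iu Iv; exact: (suP (u, v) Iu Iv).
Qed.

End Families.

(** * The lifted isotopy at time 1 is a constant factor *)

Section FlowHolonomy.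
Context {R : realType} {m : nat} {M : topologicalType} {A : manifold R m M}.
Context {L : hermitian_line_bundle A} (D : connection L).
Context (om : M -> 'rV[R]_m -> 'rV[R]_m -> R).
Hypotheses (om_form : is_two_form A om) (pq : prequantum om D).
Implicit Types (c : chart R m M) (U : set M) (e : frame (fib L)).
Context (psi psiV : R -> M -> M) (f : R -> M -> R) (X : R -> M -> 'rV[R]_m).
Context (F : R -> tot_space L -> tot_space L).
Hypotheses (psi_isotopy : isotopy A psi psiV) (psi_closed : psi 1 = id)
  (f_smooth : smooth_time_fun A f) (psi_ham : hamiltonian_flow A om f X psi)
  (F_lift : lift_isotopy D X f F).

Lemma smooth_time_slice t : I01 t -> smooth_fun A setT (f t).
Proof.
move=> It c Ac z /cimgP[cz _].
pose G (z : 'rV[R]_m) : 'rV[R]_(1 + m) := row_mx (t%:M : 'M[R]_1) z.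
have CG j : Ckmap j setT G.
  move=> i; rewrite /G; case: (split_ordP i) => l ->.
    rewrite (_ : (fun w => _) = cst t); first exact: Ck_cst.
    by apply/funext => w; rewrite row_mxEl mxE ord1 eqxx.
  rewrite (_ : (fun w => _) = (fun w : 'rV[R]_m => w 0 l)); first exact: Ck_coord.
  by apply/funext => w; rewrite row_mxEr.
have Gl w : (lsubmx (G w) 0 0 = t) * (rsubmx (G w) = w).
  by rewrite /G row_mxKl row_mxKr mxE eqxx.
have Gz : cyl c (G z) by rewrite /cyl /= !Gl.
have [V' [h [oV' V'z Ch hE]]] := f_smooth Ac Gz.
pose V2 := [set: 'rV[R]_m] `&` G @^-1` V'.
have oV2 : open V2 by apply: Ckmap_preimage_open => //; exact: openT.
exists V2, (h \o G); split=> // [k|w /cimgP[cw _] [_ Vw]].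
  apply: (Ck_comp oV2 oV' _ (Ch k)) => [w []//|i].
  exact: Ck_sub (CG k i).
by rewrite /= -hE // ?Gl //; rewrite /cyl /= !Gl.
Qed.

Lemma I01_0 : I01 (0 : R). Proof. by rewrite /I01 /= lexx ler01. Qed.
Lemma I01_1 : I01 (1 : R). Proof. by rewrite /I01 /= lexx ler01. Qed.

(** What the rest of the argument uses of F. *)
Lemma lift_flow (p : tot_space L) : slit p ->
  [/\ F 0 p = p, forall t, I01 t -> projT1 (F t p) = psi t (projT1 p),
      forall t, I01 t -> slit (F t p) &
      forall t, I01 t -> cder D I01 (fun s => F s p) t (X t (psi t (projT1 p)))
        (0 +i* - (2 * pi * f t (psi t (projT1 p))))].
Proof.
move=> sp; have cov t : I01 t -> projT1 (F t p) = psi t (projT1 p).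
  exact: lift_covers psi_isotopy psi_ham F_lift sp.
split=> //; first by have [] := lift_isotopy_cder F_lift sp I01_0.
  by move=> t It; have [] := lift_isotopy_cder F_lift sp It.
by move=> t It; have [_ _] := lift_isotopy_cder F_lift sp It; rewrite cov.
Qed.

Definition flow_holonomy (k : R[i]) x :=
  forall p : tot_space L, slit p -> projT1 p = x -> F 1 p = tscale k p.

Lemma tscaleA z z' (p : tot_space L) : tscale z (tscale z' p) = tscale (z * z') p.
Proof. by rewrite /tscale /= scalerA. Qed.

Lemma tscale_inj z z' (p : tot_space L) : slit p -> tscale z p = tscale z' p -> z = z'.
Proof.
move=> sp E; pose e := frame_at L (projT1 p).
have ep : fdom e (projT1 p) by exact: frame_at_dom.
have : tfib e (tscale z p) = tfib e (tscale z' p) by rewrite E.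
by rewrite !tfib_tscale //; apply: mulIf; exact: tfib_neq0.
Qed.

(** The lifts s |-> F_s(q) and s |-> F_s(p) of one curve have equal rates, so
    their ratio is constant. *)
Lemma flow_holonomy_of_one k (p : tot_space L) : slit p -> F 1 p = tscale k p ->
  flow_holonomy k (projT1 p).
Proof.
move=> sp Fp q sq qp.
have [z qz] := tscale_ex qp sp.
have [p0 cp slp dp] := lift_flow sp; have [q0 cq slq dq] := lift_flow sq.
have qE s : I01 s -> projT1 (F s q) = projT1 (F s p) by move=> Is; rewrite cp // cq // qp.
have dq' t : I01 t -> cder D I01 (fun s => F s q) t (X t (psi t (projT1 p)))
    (0 +i* - (2 * pi * f t (psi t (projT1 p)))) by rewrite -qp; exact: dq.
have := ratio_const qE slp dp dq' => E.
have E1 := @tscale_ratio _ _ _ _ _ (fun s => F s p) (fun s => F s q) 1 (qE 1 I01_1) (slp 1 I01_1).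
have E0 := @tscale_ratio _ _ _ _ _ (fun s => F s p) (fun s => F s q) 0 (qE 0 I01_0) (slp 0 I01_0).
move: E E0; set rho := tratio _ _ 0 => E E0; rewrite p0 q0 in E0.
have z0 : rho = z by apply: (tscale_inj sp); rewrite -E0 qz.
by rewrite E1 E z0 Fp qz !tscaleA mulrC.
Qed.

Lemma nice_flow c (z w : 'rV[R]_m) u v : atlas A c ->
  (forall u, I01 u -> ccod c (z + u *: w)) -> I01 u -> I01 v ->
  nice_family (L := L) (fun u t => psi t (cinv c (z + u *: w))) (fun _ _ => 0) u v.
Proof.
move=> Ac Hseg Iu Iv.
pose Th (q : 'rV[R]_2) : 'rV[R]_(1 + m) := row_mx ((q 0 1)%:M : 'M[R]_1) (z + q 0 0 *: w).
have [sV _ _ _] := psi_isotopy.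
have CT j : Ckmap j setT Th.
  have oT : open [set: 'rV[R]_2] by exact: openT.
  move=> i; rewrite /Th; case: (split_ordP i) => l ->.
    rewrite (_ : (fun w => _) = (fun q : 'rV[R]_2 => q 0 1)); first exact: Ck_coord.
    by apply/funext => q; rewrite row_mxEl mxE ord1 eqxx.
  rewrite (_ : (fun w => _) = (fun q : 'rV[R]_2 => cst (z 0 l) q + q 0 0 * cst (w 0 l) q)).
    by apply: Ck_D => //; [exact: Ck_cst|apply: Ck_M => //; [exact: Ck_coord|exact: Ck_cst]].
  by apply/funext => q; rewrite row_mxEr !mxE.
have Tl u0 v0 : (lsubmx (Th (pt2 u0 v0)) 0 0 = v0) * (rsubmx (Th (pt2 u0 v0)) = z + u0 *: w).
  by rewrite /Th row_mxKl row_mxKr mxE eqxx !pt2E.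
have BT u0 v0 : I01 u0 -> I01 v0 -> cyl c (Th (pt2 u0 v0)).
  by move=> Iu' Iv'; rewrite /cyl /= !Tl; split=> //; exact: Hseg.
have := nice_of_smooth_into (L := L) (sV c Ac) CT BT Iu Iv.
rewrite (_ : (fun u v => psi _ _) = (fun u t => psi t (cinv c (z + u *: w)))) //.
by apply/funext => u'; apply/funext => v'; rewrite !Tl.
Qed.

(** For the curves t |-> psi_t(x_u) over a segment x_u the integrand of the
    variation formula is 2 pi (om(su, X_t) - df_t(su)), which vanishes by
    Hamilton's equation.  So the curves u |-> F_0(p_u) and u |-> F_1(p_u),
    which lie over the same curve because psi_1 = id, have equal rates, and
    their ratio does not depend on u. *)
Lemma flow_holonomy_path (x : M) (w : 'rV[R]_m) :
  let c := chart_at A x in let e := frame_at L x in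
  (forall u, I01 u -> cimg c (fdom e) (cmap c x + u *: w)) ->
  exists k, flow_holonomy k x /\ flow_holonomy k (cinv c (cmap c x + w)).
Proof.
move=> c e Hseg.
have Ac : atlas A c by exact: chart_atP.
have fe : frames e by exact: frame_atP.
pose xu u := cinv c (cmap c x + u *: w).
pose sg u t := psi t (xu u).
pose al u t := - (2 * pi * f t (sg u t)).
have [_ _ psi0 psiK] := psi_isotopy.
have nice0 u v : I01 u -> I01 v -> nice_family (L := L) sg (fun _ _ => 0) u v.
  by apply: nice_flow => // u' /Hseg/cimg_cdom[].
have nice u v : I01 u -> I01 v -> nice_family (L := L) sg al u v.
  by move=> Iu Iv; apply: nice_potential => //; exact: nice0.
have ex u : I01 u -> fdom e (xu u) by move=> /Hseg/cimg_cdom[].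
pose pu u : tot_space L := existT _ (xu u) (fvec e (xu u)).
have spu u : I01 u -> slit (pu u).
  by move=> Iu; rewrite /slit /pu /= -(fcoord_eq0 _ (ex u Iu)) fcoord_fvec ?oner_eq0 //; exact: ex.
pose r u t := F t (pu u).
have rsg u v : I01 u -> I01 v -> projT1 (r u v) = sg u v.
  by move=> Iu Iv; have [_ -> //] := lift_flow (spu u Iu).
have rl u v : I01 u -> I01 v -> cder D I01 (r u) v (X v (sg u v)) (0 +i* al u v).
  by move=> Iu Iv; have [_ _ _] := lift_flow (spu u Iu); exact.
have r0 u : I01 u -> r u 0 = pu u by move=> Iu; have [] := lift_flow (spu u Iu).
have [su suP] := nice_velocity_u nice.
have suE u : I01 u -> su u 1 = su u 0.
  move=> Iu; apply: mvelocity_uniq (acc_I01 Iu) (suP u 1 Iu I01_1) _.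
  have := suP u 0 Iu I01_0; congr has_mvelocity.
  by apply/funext => s; rewrite /sg /= psi0 psi_closed.
have d0 u : I01 u -> cder D I01 (r ^~ 0) u (su u 0) (theta D e (xu u) (su u 0)).
  move=> Iu; have xE : projT1 (r u 0) = xu u by rewrite r0.
  have e0 : fdom e (projT1 (r u 0)) by rewrite xE; exact: ex.
  have Hv : has_mvelocity A I01 (fun s => projT1 (r s 0)) u (su u 0).
    by apply: mvelocity_ext (suP u 0 Iu I01_0) => // s Is; rewrite (rsg s 0 Is I01_0).
  apply: (cder_of_frame Hv fe e0); rewrite xE subrr mul0r.
  have one s : I01 s -> tfib e (r s 0) = 1.
    by move=> Is; rewrite r0 // /tfib /pu /= fcoord_fvec //; exact: ex.
  apply: cd_eq (cd_cst I01 1 u); last by rewrite one.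
  by near=> s => Is; rewrite one.
have d1 u : I01 u -> cder D I01 (r ^~ 1) u (su u 0) (theta D e (xu u) (su u 0)).
  move=> Iu; rewrite -(suE u Iu).
  have := @lift_variation _ _ _ _ _ D om om_form pq sg al u r (su u) (fun u v => X v (sg u v))
    (fun v => - (2 * pi) * mdiff A (f v) (sg u v) (su u v)) (fun=> 0) (theta D e (xu u) (su u 0)).
  rewrite rint0 (_ : _ + (0 +i* 0) = theta D e (xu u) (su u 0)); last first.
    by rewrite -[RHS]addr0.
  rewrite (suE u Iu); apply => //.
  - by move=> v Iv; exact: nice.
  - by move=> v Iv; exact: (suP u v Iu Iv).
  - move=> v Iv; have H := mvelocity_fun (suP u v Iu Iv) openT I (smooth_time_slice Iv).
    have := dw_Z (a := - (2 * pi)) H; congr dwithin.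
    by apply/funext => s; rewrite /al /= [_ *: _]mulNr.
  - by move=> x'; exact: cst_continuous.
  - move=> v Iv; have [_ anti _] := om_form.
    have [_ Hm] := psi_ham (sg u v) Iv.
    by rewrite anti Hm opprK mulNr addrN.
  - exact: d0.
have sl0 u : I01 u -> slit (r u 0) by move=> Iu; rewrite r0 //; exact: spu.
have pE u : I01 u -> projT1 (r u 1) = projT1 (r u 0).
  by move=> Iu; rewrite (rsg u 1 Iu I01_1) (rsg u 0 Iu I01_0) /sg psi0 psi_closed.
have K := ratio_const pE sl0 d0 d1.
have E u : I01 u -> F 1 (pu u) = tscale (tratio (r ^~ 0) (r ^~ 1) u) (pu u).
  by move=> Iu; rewrite -[in RHS](r0 u Iu); exact: (@tscale_ratio _ _ _ _ _ (r ^~ 0) (r ^~ 1) u (pE u Iu) (sl0 u Iu)).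
exists (tratio (r ^~ 0) (r ^~ 1) 0); split.
  have := flow_holonomy_of_one (spu 0 I01_0) (E 0 I01_0).
  by rewrite /pu /xu /= scale0r addr0 cmapK //; exact: chart_at_dom.
rewrite -K; have := flow_holonomy_of_one (spu 1 I01_1) (E 1 I01_1).
by rewrite /pu /xu /= scale1r.
Unshelve. all: by end_near. Qed.

Lemma flow_holonomy_uniq k k' x : flow_holonomy k x -> flow_holonomy k' x -> k = k'.
Proof.
move=> H H'; pose e := frame_at L x.
have ex : fdom e x by exact: frame_at_dom.
pose p : tot_space L := existT _ x (fvec e x).
have sp : slit p by rewrite /slit /= -(fcoord_eq0 _ ex) fcoord_fvec ?oner_eq0.
by apply: (tscale_inj sp); rewrite -(H p sp erefl) -(H' p sp erefl).
Qed.

Lemma flow_holonomy_near x :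
  \forall y \near x, exists k, flow_holonomy k x /\ flow_holonomy k y.
Proof.
pose c := chart_at A x; pose e := frame_at L x.
have cx : cdom c x by exact: chart_at_dom.
have ex : fdom e x by exact: frame_at_dom.
have oW : open (cimg c (fdom e)) by apply: cimg_open; exact: fdom_open.
have /nbhs_ballP[d /= d0 dW] := open_nbhs_nbhs (conj oW (cimg_mem cx ex)).
have N1 : nbhs x (cdom c) by apply: open_nbhs_nbhs; split=> //; exact: cdom_open.
have N2 := continuous_at_near (cmap_continuous cx) d0.
apply: filterS (filterI N1 N2) => y [cy yd].
have [|k [Hx Hy]] := @flow_holonomy_path x (cmap c y - cmap c x).
  move=> u Iu; apply: dW; rewrite -ball_normE /= opprD addNKr normrN normrZ.
  move: Iu; rewrite /I01 /= => /andP[u0 u1]; rewrite ger0_norm // distrC.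
  by apply: le_lt_trans yd; rewrite ler_piMl.
by exists k; split=> //; move: Hy; rewrite addrC subrK cmapK.
Qed.

(** The set of points with holonomy k is open and so is its complement. *)
Lemma flow_holonomy_all k x0 : connected [set: M] -> flow_holonomy k x0 ->
  forall x, flow_holonomy k x.
Proof.
move=> Mc H0; pose S := [set x | flow_holonomy k x].
have oS : open S.
  rewrite openE => x Sx; rewrite /interior; apply: filterS (flow_holonomy_near x).
  by move=> y [k' [Hx Hy]]; rewrite /S /= (flow_holonomy_uniq Sx Hx).
have oSC : open (~` S).
  rewrite openE => x Sx; rewrite /interior; apply: filterS (flow_holonomy_near x).
  move=> y [k' [Hx Hy]] Sy; apply: Sx.
  by rewrite /S /= (flow_holonomy_uniq Sy Hy).
have : S = setT.
  apply: Mc; first by exists x0.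
    by exists S => //; rewrite setTI.
  by exists S; [rewrite -[S]setCK; exact: open_closedC|rewrite setTI].
by move=> E x; have : S x by rewrite E.
Qed.

End FlowHolonomy.

(** * Parallel transport over a square *)

Section Clamp.
Context {R : realType}.

(** Composition with clamp extends a function on [0, 1] by constants, so that
    a function continuous on [0, 1] becomes continuous everywhere. *)
Definition clamp (t : R) : R := Num.max 0 (Num.min t 1).

Lemma clamp_I01 t : I01 (clamp t).
Proof. by rewrite /I01 /= /clamp le_max lexx /= ge_max ler01 ge_min lexx orbT. Qed.

Lemma clamp_id t : I01 t -> clamp t = t.
Proof.
by rewrite /I01 /= /clamp => /andP[t0 t1]; rewrite (min_idPl t1) (max_idPr t0).
Qed.

Lemma clamp_lip s t : `|clamp s - clamp t| <= `|s - t|.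
Proof.
wlog st : s t / s <= t.
  by move=> H; case: (leP s t) => [/H//|/ltW/H]; rewrite distrC [X in _ <= X]distrC.
have H : 0 <= clamp t - clamp s <= t - s.
  rewrite /clamp /Order.max /Order.min.
  case: (ltP s 1) => s1; case: (ltP t 1) => t1; rewrite ?ltr01;
    case: (ltP 0 s) => s0; case: (ltP 0 t) => t0; apply/andP; split; lra.
by case/andP: H => H1 H2; rewrite distrC ger0_norm // distrC ger0_norm // subr_ge0.
Qed.

Definition cont01 (h : R -> R) := forall t0, I01 t0 -> forall e, 0 < e ->
  exists2 d, 0 < d & forall t, I01 t -> `|t - t0| < d -> `|h t - h t0| < e.

Lemma clamp_continuous (h : R -> R) : cont01 h -> forall x, {for x, continuous (h \o clamp)}.
Proof.
move=> ch x; apply/cvgrPdist_lt => e e0; have [d d0 H] := ch (clamp x) (clamp_I01 x) e e0.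
have N : \forall s \near x, ball x d s by exact: nbhsx_ballx.
apply: filterS N => s; rewrite -ball_normE /= distrC => sd.
rewrite distrC; apply: H; first exact: clamp_I01.
exact: le_lt_trans (clamp_lip _ _) sd.
Qed.

Lemma rint_dist (g h : R -> R) e : (forall x, {for x, continuous g}) ->
  (forall x, {for x, continuous h}) ->
  (forall v, I01 v -> `|g v - h v| <= e) -> `|rint 0 1 g - rint 0 1 h| <= e.
Proof.
move=> cg ch gh.
have mI : measurable (`[0, 1]%classic : set (measurableTypeR R)) by exact: measurable_itv.
have ig : (@lebesgue_measure R).-integrable `[0, 1] (EFin \o g) by apply: continuous_itv_integrable => x _; exact: cg.
have ih : (@lebesgue_measure R).-integrable `[0, 1] (EFin \o h) by apply: continuous_itv_integrable => x _; exact: ch.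
have cd x : {for x, continuous (fun x => g x - h x)} by apply: continuousB; [exact: cg|exact: ch].
have igh : (@lebesgue_measure R).-integrable `[0, 1] (EFin \o (fun x => g x - h x)).
  by apply: continuous_itv_integrable => x _; exact: cd.
have inorm : (@lebesgue_measure R).-integrable `[0, 1] (EFin \o (fun x => `|g x - h x|)).
  by apply: continuous_itv_integrable => x _; apply: continuous_comp; [exact: cd|exact: norm_continuous].
have ie : (@lebesgue_measure R).-integrable `[0, 1] (EFin \o cst e).
  by apply: continuous_itv_integrable => x _; exact: cst_continuous.
rewrite /rint -RintegralB //; apply: le_trans (le_normr_Rintegral mI igh) _.
apply: le_trans (le_Rintegral mI inorm ie _) _.
  by move=> x /=; rewrite in_itv /=; exact: gh.
rewrite Rintegral_cst //=.
by rewrite lebesgue_measure_itv /= lte_fin ltr01 /= subr0 mulr1.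
Qed.

End Clamp.

Section Square.
Context {R : realType} {m : nat} {M : topologicalType} {A : manifold R m M}.
Context {L : hermitian_line_bundle A} (D : connection L).
Context (om : M -> 'rV[R]_m -> 'rV[R]_m -> R).
Hypotheses (om_form : is_two_form A om) (pq : prequantum om D).
Implicit Types (c : chart R m M) (U : set M).
Context (sg : R -> R -> M) (su sv : R -> R -> 'rV[R]_m).
Hypothesis nice : forall u v, I01 u -> I01 v -> nice_family (L := L) sg (fun _ _ => 0) u v.
Hypothesis suP : forall u v, I01 u -> I01 v -> has_mvelocity A I01 (sg ^~ v) u (su u v).
Hypothesis svP : forall u v, I01 u -> I01 v -> has_mvelocity A I01 (sg u) v (sv u v).

(** The pullback of om, scaled so that its integral over the square is the
    angle of the holonomy. *)
Definition area_density u v := 2 * pi * om (sg u v) (su u v) (sv u v).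

Lemma area_density_continuous u0 v0 : I01 u0 -> I01 v0 -> forall e, 0 < e ->
  exists2 d, 0 < d & forall u v, I01 u -> I01 v -> `|u - u0| < d -> `|v - v0| < d ->
    `|area_density u v - area_density u0 v0| < e.
Proof.
move=> Iu0 Iv0 e e0; have [c [fr [V [y [a ld]]]]] := nice Iu0 Iv0.
have [[Ac fe] [oV Vw0] [Cy Ca] yW sgE] := ld.
have yc w : V w -> ccod c (y w) by move=> /yW/cimg_cdom[].
pose F w := 2 * pi * \sum_i \sum_j 'D_(pt2 1 0) (fun w => y w 0 j) w *
   'D_(pt2 0 1) (fun w => y w 0 i) w * form_coef A om c (delta_mx 0 j) (delta_mx 0 i) (y w).
have CF : Ck 0 V F.
  apply: Ck_M => //; first exact: Ck_cst.
  apply: Ck_sum => // i; apply: Ck_sum => // j; apply: Ck_M => //.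
    by apply: Ck_M => //; apply: Ck_derive; exact: (Cy 1%N).
  have [_ _ sf] := om_form.
  have oc : open (ccod c) by exact: ccod_open.
  have Cf := iffLR (smooth_on_openP _ oc) (sf c Ac (delta_mx 0 j) (delta_mx 0 i)) 0%N.
  exact: (Ck_comp oV oc yc Cf (Cy 0%N)).
have FE u v : I01 u -> I01 v -> V (pt2 u v) -> area_density u v = F (pt2 u v).
  move=> Iu Iv Vuv; have [Vu _] := ld_vel_u ld Iu Iv Vuv; have Vv := ld_vel_v ld Iu Iv Vuv.
  have Esu := mvelocity_uniq (acc_I01 Iu) (suP Iu Iv) Vu.
  have Esv := mvelocity_uniq (acc_I01 Iv) (svP Iu Iv) Vv.
  have [Esg _] := sgE u v Iu Iv Vuv.
  have dy d := Ckmap_derivable (v := d) (Cy 1%N) Vuv.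
  rewrite /area_density Esu Esv Esg (om_tvec om_form _ _ Ac (yc _ Vuv)) /F; congr (_ * _).
  apply: eq_bigr => i _; apply: eq_bigr => j _.
  by rewrite (derive_mxE _ _ (dy _)) (derive_mxE _ _ (dy _)).
have N := continuous_at_near (Ck_cont CF Vw0) e0.
have NN : nbhs (pt2 u0 v0) (fun w => V w /\ `|F (pt2 u0 v0) - F w| < e).
  exact: (filterI (open_nbhs_nbhs (conj oV Vw0)) N).
have /nbhs_ballP[d /= d0 H] := NN.
exists d => // u v Iu Iv ud vd; have [Vuv K] := H _ (pt2_ball d0 ud vd).
by rewrite (FE u v Iu Iv Vuv) (FE u0 v0 Iu0 Iv0 Vw0) distrC.
Qed.

Definition strip_area u := rint 0 1 (area_density u \o clamp).

Lemma area_density_cont01 u : I01 u -> cont01 (area_density u).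
Proof.
move=> Iu v0 Iv0 e e0; have [d d0 H] := area_density_continuous Iu Iv0 e0.
by exists d => // v Iv vd; apply: H => //; rewrite subrr normr0.
Qed.

(** The density is continuous in u uniformly with respect to v. *)
Lemma strip_area_cont01 : cont01 strip_area.
Proof.
move=> u0 Iu0 e e0; have e2 : 0 < e / 2 by rewrite divr_gt0.
have e4 : 0 < e / 2 / 2 by rewrite divr_gt0.
pose P a b := exists2 d, 0 < d & forall u v, I01 u -> a <= v <= b -> `|u - u0| < d ->
  `|area_density u v - area_density u0 v| <= e / 2.
have [d d0 H] : P 0 1.
  apply: (@cousin _ P 0 1 ler01).
    move=> x y z _ xy yz _ [d1 d10 H1] [d2 d20 H2]; exists (Num.min d1 d2).
      by rewrite lt_min d10.
    move=> u v Iu /andP[xv vz]; rewrite lt_min => /andP[ud1 ud2].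
    have [vy|/ltW yv] := leP v y; first by apply: H1; rewrite ?xv.
    by apply: H2; rewrite ?yv.
  move=> v0 Iv0; have [d d0 H] := area_density_continuous Iu0 Iv0 e4.
  exists d => // x y x0 y1 /andP[xv vy] xd yd; exists d => // u v Iu /andP[xv' vy'] ud.
  have Iv : I01 v by rewrite /I01 /= (le_trans x0) // (le_trans vy').
  have vd : `|v - v0| < d.
    by rewrite ltr_norml; apply/andP; split; [rewrite ltrBrDl (lt_le_trans xd)|rewrite ltrBlDl (le_lt_trans vy')].
  have h1 := H u v Iu Iv ud vd.
  have h2 : `|area_density u0 v - area_density u0 v0| < e / 2 / 2.
    by apply: H => //; rewrite subrr normr0.
  rewrite -(subrK (area_density u0 v0) (area_density u v)) -addrA.
  rewrite (le_trans (ler_normD _ _)) // (splitr (e / 2)) lerD //; first exact: ltW.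
  by rewrite distrC ltW.
exists d => // u Iu ud; apply: (@le_lt_trans _ _ (e / 2)); last by rewrite ltr_pdivrMr // ltr_pMr // ltr1n.
apply: rint_dist.
- exact: clamp_continuous (area_density_cont01 Iu).
- exact: clamp_continuous (area_density_cont01 Iu0).
by move=> v Iv; rewrite /= clamp_id //; exact: H.
Qed.

(** Parallel transport in the v-direction of a curve b over the bottom side:
    the variation formula with al = 0. *)
Lemma square_lift (b : R -> tot_space L) :
  (forall u, I01 u -> projT1 (b u) = sg u 0) -> (forall u, I01 u -> slit (b u)) ->
  (forall u, I01 u -> cder D I01 b u (su u 0) 0) ->
  exists r : R -> R -> tot_space L,
    [/\ forall u, I01 u -> r u 0 = b u,
        forall u v, I01 u -> I01 v -> projT1 (r u v) = sg u v /\ slit (r u v),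
        forall u v, I01 u -> I01 v -> cder D I01 (r u) v (sv u v) 0 &
        forall u, I01 u -> cder D I01 (r ^~ 1) u (su u 1) (0 +i* strip_area u)].
Proof.
move=> bE sb db.
have /choice[r rP] : forall u, exists p : R -> tot_space L, I01 u -> [/\ p 0 = b u,
    forall t, I01 t -> projT1 (p t) = sg u t,
    forall t, I01 t -> slit (p t) &
    forall t, I01 t -> cder D I01 p t (sv u t) (0 +i* 0)].
  move=> u; have [Iu|nIu] := pselect (I01 u); last by exists (fun=> b u).
  have [p Hp] := lift_exists D Iu (fun v Iv => nice Iu Iv) (fun t It => svP Iu It) (bE u Iu) (sb u Iu).
  by exists p.
exists r; split.
- by move=> u /rP[].
- by move=> u v /rP[_ H1 H2 _] Iv; split; [exact: H1|exact: H2].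
- by move=> u v /rP[_ _ _ H] Iv; exact: H.
move=> u Iu.
have rE s : I01 s -> r s 0 = b s by move=> /rP[].
have d0 : cder D I01 (r ^~ 0) u (su u 0) 0.
  have [Hv Hd] := db u Iu; split.
    by apply: mvelocity_ext Hv => // s Is; rewrite rE.
  move=> e fe; rewrite rE // => eu; apply: cd_eq (Hd e fe eu); last by rewrite rE.
  by near=> s => Is; rewrite rE.
have kE v : I01 v -> (area_density u \o clamp) v = 2 * pi * om (sg u v) (su u v) (sv u v) + 0.
  by move=> Iv; rewrite /= clamp_id // addr0.
have := @lift_variation _ _ _ _ _ D om om_form pq sg (fun _ _ => 0) u r (su u) sv (fun=> 0)
  (area_density u \o clamp) 0 Iu (fun v Iv => nice Iu Iv).
rewrite add0r; apply => //.
- by move=> u' v Iu' Iv; have [_ H _ _] := rP u' Iu'; exact: H.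
- by move=> u' v Iu' Iv; have [_ _ _ H] := rP u' Iu'; exact: H.
- by move=> v Iv; exact: suP.
- by move=> v Iv; exact: dw_cst.
- exact: clamp_continuous (area_density_cont01 Iu).
Unshelve. all: by end_near. Qed.

End Square.

(** * Holonomy of curves *)

Section Holonomy.
Context {R : realType} {m : nat} {M : topologicalType} {A : manifold R m M}.
Context {L : hermitian_line_bundle A} (D : connection L).
Implicit Types (g : R -> M) (p q : R -> tot_space L).

Lemma dw_rev (V : normedModType R) (f : R -> V) t l :
  dwithin I01 f (1 - t) l -> dwithin I01 (fun s => f (1 - s)) t (- l).
Proof.
move=> /dwithinP df; apply/dwithinP => e e0; have [d d0 H] := df e e0.
exists d => // s Is sd.
have Is' : I01 (1 - s) by move: Is; rewrite /I01 /= => /andP[? ?]; apply/andP; split; lra.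
have E : (1 - s) - (1 - t) = - (s - t) by ring.
have := H (1 - s) Is'; rewrite E normrN => /(_ sd).
by rewrite scaleNr scalerN.
Qed.

Lemma cd_rev (z : R -> R[i]) t l :
  cderiv I01 z (1 - t) l -> cderiv I01 (fun s => z (1 - s)) t (- l).
Proof.
move=> [h1 h2]; split; [move: (dw_rev h1)|move: (dw_rev h2)];
  by congr dwithin; case: l {h1 h2}.
Qed.

Lemma cder_rev p t v : cder D I01 p (1 - t) v 0 ->
  cder D I01 (fun s => p (1 - s)) t (- v) 0.
Proof.
move=> [[Hn Hv] Hd].
have Hv' : dwithin I01 (cmap (chart_at A (projT1 (p (1 - t)))) \o (fun s => projT1 (p s))) (1 - t) v by [].
have Hm : has_mvelocity A I01 (fun s => projT1 (p (1 - s))) t (- v).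
  split; last exact: (dw_rev Hv').
  move/nbhs_ballP: Hn => [d /= d0 H]; apply/nbhs_ballP; exists d => // s.
  rewrite -ball_normE /= => sd Is; apply: H.
    by rewrite -ball_normE /= (_ : 1 - t - (1 - s) = - (t - s)) ?normrN //; ring.
  by move: Is; rewrite /I01 /= => /andP[? ?]; apply/andP; split; lra.
split=> // e fe et; have [H1 H2] := Hd e fe et.
have lin : theta D e (projT1 (p (1 - t))) (- v) = - theta D e (projT1 (p (1 - t))) v.
  have := theta_linear D (-1) v 0 fe et; rewrite addr0 scaleN1r => ->.
  have th0 : theta D e (projT1 (p (1 - t))) 0 = 0.
    have := theta_linear D (-1) 0 0 fe et; rewrite scaler0 addr0 => E0.
    by rewrite E0 rmorphN1 mulN1r addNr.
  by rewrite th0 addr0 rmorphN1 mulN1r.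
have := cd_rev (conj H1 H2); congr cderiv; rewrite lin /=; ring.
Qed.

Definition hlift g p := exists v : R -> 'rV[R]_m, forall t, I01 t ->
  [/\ projT1 (p t) = g t, slit (p t) & cder D I01 p t (v t) 0].

Definition transport_coef g p : R[i] :=
  tfib (frame_at L (g 1)) (p 1) / tfib (frame_at L (g 0)) (p 0).

(** Parallel transport along g, from the fibre at g 0 to the fibre at g 1,
    read in the frames chosen at these points; the two frames coincide when g
    is a loop, and the number is then independent of them.  The value is 1 for
    curves that have no horizontal lift. *)
Definition hol g : R[i] := xget 1 [set z | exists2 p, hlift g p & z = transport_coef g p].

Lemma hlift_uniq g p q : hlift g p -> hlift g q -> transport_coef g p = transport_coef g q.
Proof.
move=> [v Hp] [w Hq].
have pE t : I01 t -> projT1 (p t) = g t by move=> /Hp[].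
have qE t : I01 t -> projT1 (q t) = g t by move=> /Hq[].
have sp t : I01 t -> slit (p t) by move=> /Hp[].
have sq t : I01 t -> slit (q t) by move=> /Hq[].
have qp t : I01 t -> projT1 (q t) = projT1 (p t) by move=> It; rewrite qE // pE.
have dp t : I01 t -> cder D I01 p t (v t) 0 by move=> /Hp[].
have dq t : I01 t -> cder D I01 q t (v t) 0.
  move=> It; have [_ _ H] := Hq t It; have [H1 _] := H; have [H2 _] := dp t It.
  rewrite (_ : v t = w t) //; apply: mvelocity_uniq (acc_I01 It) H2 _.
  by apply: mvelocity_ext H1 => // s Is; exact: qp.
have e0 : fdom (frame_at L (g 0)) (projT1 (p 0)) by rewrite (pE 0 I01_0); exact: frame_at_dom.
have e1 : fdom (frame_at L (g 1)) (projT1 (p 1)) by rewrite (pE 1 I01_1); exact: frame_at_dom.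
have e0' : fdom (frame_at L (g 0)) (projT1 (q 0)) by rewrite (qp 0 I01_0).
have e1' : fdom (frame_at L (g 1)) (projT1 (q 1)) by rewrite (qp 1 I01_1).
have := ratio_const qp sp dp dq.
rewrite (ratio_frame (qp 1 I01_1) (sp 1 I01_1) e1) (ratio_frame (qp 0 I01_0) (sp 0 I01_0) e0).
have n1 := tfib_neq0 e0 (sp 0 I01_0); have n2 := tfib_neq0 e1 (sp 1 I01_1).
have n3 := tfib_neq0 e0' (sq 0 I01_0); have n4 := tfib_neq0 e1' (sq 1 I01_1).
rewrite /transport_coef => E.
by apply: (mulfI (invr_neq0 n2)); rewrite mulrA mulVf // mul1r mulrA [_^-1 * _]mulrC E mulrAC mulfV // mul1r.
Qed.

Lemma hlift_hol g p : hlift g p ->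
  tfib (frame_at L (g 1)) (p 1) = hol g * tfib (frame_at L (g 0)) (p 0).
Proof.
move=> Hp; have -> : hol g = transport_coef g p.
  rewrite /hol; case: xgetP => [z _ [q Hq ->]|/(_ (transport_coef g p)) []].
    exact: hlift_uniq.
  by exists p.
have [v H] := Hp; have [pE sp _] := H 0 I01_0.
have e0 : fdom (frame_at L (g 0)) (projT1 (p 0)) by rewrite pE; exact: frame_at_dom.
by rewrite /transport_coef divfK //; exact: tfib_neq0.
Qed.

Lemma hol_neq0 g : hol g != 0.
Proof.
rewrite /hol; case: xgetP => [z _ [p [v H] ->]|_]; last exact: oner_neq0.
have [pE sp _] := H 0 I01_0; have [pE1 sp1 _] := H 1 I01_1.
rewrite mulf_neq0 ?invr_neq0 //; apply: tfib_neq0 => //.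
  by rewrite pE1; exact: frame_at_dom.
by rewrite pE; exact: frame_at_dom.
Qed.

Lemma hol_ext g g' : (forall t, I01 t -> g t = g' t) -> hol g = hol g'.
Proof.
move=> E; rewrite /hol; congr xget; apply/seteqP; split=> z [p [v H] ->].
  exists p; last by rewrite /transport_coef !E //; [exact: I01_0|exact: I01_1].
  by exists v => t It; have [? ? ?] := H t It; split=> //; rewrite -E.
exists p; last by rewrite /transport_coef !E //; [exact: I01_0|exact: I01_1].
by exists v => t It; have [? ? ?] := H t It; split=> //; rewrite E.
Qed.

End Holonomy.

(** * Holonomy around a singular simplex *)

Section SimplexHolonomy.
Context {R : realType} {m : nat} {M : topologicalType} {A : manifold R m M}.
Context {L : hermitian_line_bundle A} (D : connection L).
Context (om : M -> 'rV[R]_m -> 'rV[R]_m -> R).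
Hypotheses (om_form : is_two_form A om) (pq : prequantum om D).
Context (sigma : 'rV[R]_2 -> M) (sigma_smooth : smooth_into A (@simplex2 R) sigma).

Lemma simplex2_pt2 (a b : R) : 0 <= a -> 0 <= b -> a + b <= 1 -> simplex2 (pt2 a b).
Proof. by move=> a0 b0 ab; exists a, b. Qed.

Lemma Ckmap_pt2 j (h k : 'rV[R]_2 -> R) : Ck j setT h -> Ck j setT k ->
  Ckmap j setT (fun q => pt2 (h q) (k q)).
Proof.
move=> Ch Cb i; case: (ord2P i) => ->.
  by rewrite (_ : (fun q => _) = h) //; apply/funext => q; rewrite pt2E.
by rewrite (_ : (fun q => _) = k) //; apply/funext => q; rewrite pt2E.
Qed.

Lemma Ck_onem j (h : 'rV[R]_2 -> R) : Ck j setT h -> Ck j setT (fun q => 1 - h q).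
Proof.
by move=> Ch; apply: Ck_D; [exact: openT|exact: Ck_cst|apply: Ck_N => //; exact: openT].
Qed.

(** The square is mapped onto the simplex by collapsing the side u = 1 to the
    vertex (1, 0).  The sides v = 0 and u = 0 become face2 and face1, and v = 1
    becomes face0 with the opposite orientation. *)
Definition cone (u v : R) := sigma (pt2 u (v * (1 - u))).

Lemma cone_simplex (u v : R) : I01 u -> I01 v -> simplex2 (pt2 u (v * (1 - u))).
Proof.
rewrite /I01 /= => /andP[u0 u1] /andP[v0 v1]; apply: simplex2_pt2 => //.
  by rewrite mulr_ge0 // subr_ge0.
by rewrite -lerBrDl ler_piMl // subr_ge0.
Qed.

Lemma nice_simplex (h k : 'rV[R]_2 -> R) u v : (forall j, Ck j setT h) -> (forall j, Ck j setT k) ->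
  (forall u v, I01 u -> I01 v -> simplex2 (pt2 (h (pt2 u v)) (k (pt2 u v)))) ->
  I01 u -> I01 v ->
  nice_family (L := L) (fun u v => sigma (pt2 (h (pt2 u v)) (k (pt2 u v)))) (fun _ _ => 0) u v.
Proof.
move=> Ch Cb Hs Iu Iv.
have CT j : Ckmap j setT (fun q => pt2 (h q) (k q)) by exact: Ckmap_pt2.
exact: (nice_of_smooth_into sigma_smooth CT Hs Iu Iv).
Qed.

Lemma nice_cone u v : I01 u -> I01 v -> nice_family (L := L) cone (fun _ _ => 0) u v.
Proof.
move=> Iu Iv; have := @nice_simplex (fun q => q 0 0) (fun q => q 0 1 * (1 - q 0 0)) u v.
rewrite (_ : (fun u v => sigma _) = cone); last first.
  by apply/funext => u'; apply/funext => v'; rewrite !pt2E.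
apply => // [j|j|u' v' Iu' Iv']; first exact: Ck_coord.
  by apply: Ck_M; [exact: openT|exact: Ck_coord|apply: Ck_onem; exact: Ck_coord].
by rewrite !pt2E; exact: cone_simplex.
Qed.

Lemma nice_edge (h k : R -> R) u v : (forall j, Ck j setT (fun q : 'rV[R]_2 => h (q 0 1))) ->
  (forall j, Ck j setT (fun q : 'rV[R]_2 => k (q 0 1))) ->
  (forall t, I01 t -> simplex2 (pt2 (h t) (k t))) -> I01 u -> I01 v ->
  nice_family (L := L) (fun _ t => sigma (pt2 (h t) (k t))) (fun _ _ => 0) u v.
Proof.
move=> Ch Cb Hs Iu Iv.
have := @nice_simplex (fun q => h (q 0 1)) (fun q => k (q 0 1)) u v.
rewrite (_ : (fun u v => sigma _) = (fun _ t => sigma (pt2 (h t) (k t)))); last first.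
  by apply/funext => u'; apply/funext => v'; rewrite !pt2E.
by apply => // u' v' _ Iv'; rewrite !pt2E; exact: Hs.
Qed.

Lemma edge_lift (h k : R -> R) (v : R -> 'rV[R]_m) (q0 : tot_space L) :
  (forall j, Ck j setT (fun q : 'rV[R]_2 => h (q 0 1))) ->
  (forall j, Ck j setT (fun q : 'rV[R]_2 => k (q 0 1))) ->
  (forall t, I01 t -> simplex2 (pt2 (h t) (k t))) ->
  (forall t, I01 t -> has_mvelocity A I01 (fun t => sigma (pt2 (h t) (k t))) t (v t)) ->
  projT1 q0 = sigma (pt2 (h 0) (k 0)) -> slit q0 ->
  exists p, [/\ p 0 = q0, forall t, I01 t -> projT1 (p t) = sigma (pt2 (h t) (k t)),
    forall t, I01 t -> slit (p t) & forall t, I01 t -> cder D I01 p t (v t) 0].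
Proof.
move=> Ch Cb Hs Hv E sq.
exact: (lift_exists D I01_0 (fun v Iv => nice_edge Ch Cb Hs I01_0 Iv) Hv E sq).
Qed.

Definition frame_point x : tot_space L := existT _ x (fvec (frame_at L x) x).

Lemma slit_fvec x : slit (frame_point x).
Proof.
have ex : fdom (frame_at L x) x by exact: frame_at_dom.
by rewrite /slit /= -(fcoord_eq0 _ ex) fcoord_fvec // oner_eq0.
Qed.

Definition face0 t := sigma (pt2 (1 - t) t).
Definition face1 t := sigma (pt2 0 t).
Definition face2 t := sigma (pt2 t 0).

(** By square_lift the lift r of the square that starts from a horizontal
    lift of face2 is horizontal along each line u = constant, and along v = 1
    it turns against a horizontal lift q by the area. *)
Lemma simplex_hol : exists su sv : R -> R -> 'rV[R]_m,
  [/\ forall u v, I01 u -> I01 v -> has_mvelocity A I01 (cone ^~ v) u (su u v),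
      forall u v, I01 u -> I01 v -> has_mvelocity A I01 (cone u) v (sv u v) &
      hol D face0 * hol D face2 =
      hol D face1 * expi (rint 0 1 (strip_area om cone su sv \o clamp))].
Proof.
have [su suP] := nice_velocity_u nice_cone.
have /choice[sv svP] : forall u, exists sv : R -> 'rV[R]_m,
    I01 u -> forall v, I01 v -> has_mvelocity A I01 (cone u) v (sv v).
  move=> u; have [Iu|nIu] := pselect (I01 u); last by exists (fun=> 0).
  by have [s Hs] := nice_velocity_v Iu (fun v Iv => nice_cone Iu Iv); exists s.
have svP' u v : I01 u -> I01 v -> has_mvelocity A I01 (cone u) v (sv u v).
  by move=> Iu; exact: svP.
exists su, sv; split=> //.
have C1 j : Ck j setT (fun q : 'rV[R]_2 => q 0 1) by exact: Ck_coord.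
have C0 j (a : R) : Ck j setT (fun q : 'rV[R]_2 => a) by exact: Ck_cst.
have C1' j : Ck j setT (fun q : 'rV[R]_2 => 1 - q 0 1) by apply: Ck_onem; exact: C1.
have cone0 t : cone t 0 = face2 t by rewrite /cone mul0r.
have cone1 t : cone t 1 = sigma (pt2 t (1 - t)) by rewrite /cone mul1r.
have cone0l t : cone 0 t = face1 t by rewrite /cone subr0 mulr1.
have cone1l t : cone 1 t = sigma (pt2 1 0) by rewrite /cone subrr mulr0.
have S2 (t : R) : I01 t -> simplex2 (pt2 t 0).
  by move=> /andP[t0 t1]; apply: simplex2_pt2; rewrite ?addr0.
have V2 t : I01 t -> has_mvelocity A I01 (fun t => sigma (pt2 t 0)) t (su t 0).
  by move=> It; apply: mvelocity_ext (suP t 0 It I01_0) => // s _; exact: cone0.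
have [b [b0 bE sb db]] :=
  @edge_lift (fun t => t) (fun=> 0) (su ^~ 0) (frame_point (sigma (pt2 0 0))) C1 (fun j => C0 j 0)
    S2 V2 erefl (slit_fvec _).
have bE' u : I01 u -> projT1 (b u) = cone u 0 by move=> Iu; rewrite bE // cone0.
have [r [rb rE rl rtop]] := square_lift om_form pq nice_cone suP svP' bE' sb db.
(* q runs along the face opposite to (0,0) from (0,1) to (1,0), against the
   orientation of face0. *)
have S0 (t : R) : I01 t -> simplex2 (pt2 t (1 - t)).
  move=> /andP[t0 t1]; apply: simplex2_pt2; rewrite ?subr_ge0 //.
  by rewrite addrC subrK.
have V0 t : I01 t -> has_mvelocity A I01 (fun t => sigma (pt2 t (1 - t))) t (su t 1).
  by move=> It; apply: mvelocity_ext (suP t 1 It I01_1) => // s _; exact: cone1.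
have [q [q0 qE sq dq]] :=
  @edge_lift (fun t => t) (fun t => 1 - t) (su ^~ 1) (frame_point (sigma (pt2 0 (1 - 0)))) C1 C1'
    S0 V0 erefl (slit_fvec _).
have H2 : hlift D face2 b.
  by exists (su ^~ 0) => t It; split; [exact: bE|exact: sb|exact: db].
have H1 : hlift D face1 (r 0).
  exists (sv 0) => t It; have [r1 r2] := rE 0 t I01_0 It.
  by split; [rewrite r1 cone0l|exact: r2|exact: (rl 0 t I01_0 It)].
have Irev (t : R) : I01 t -> I01 (1 - t).
  by rewrite /I01 /= => /andP[? ?]; apply/andP; split; lra.
have H0 : hlift D face0 (fun t => q (1 - t)).
  exists (fun t => - su (1 - t) 1) => t It; have It' := Irev t It; split.
  - by rewrite qE // /face0; congr (sigma (pt2 _ _)); ring.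
  - exact: sq.
  - exact: cder_rev (dq _ It').
(* The side u = 1 of the square is collapsed to the vertex (1,0), where a
   horizontal lift stays put. *)
have Hc : tratio (fun=> b 1) (r 1) 1 = tratio (fun=> b 1) (r 1) 0.
  have sv1 t : I01 t -> sv 1 t = 0.
    move=> It; apply: mvelocity_uniq (acc_I01 It) (svP' 1 t I01_1 It) _.
    by apply: mvelocity_ext (mvelocity_cst (A := A) I01 (sigma (pt2 1 0)) t) => // s _; rewrite cone1l.
  apply: (@ratio_const _ _ _ _ _ D (fun=> b 1) (r 1) (fun=> 0) (fun=> 0)).
  - by move=> s Is; have [-> _] := rE 1 s I01_1 Is; rewrite cone1l (bE 1 I01_1).
  - by move=> s _; apply: sb; exact: I01_1.
  - move=> t It; split; first exact: mvelocity_cst.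
    move=> e fe et; rewrite (_ : theta D e (projT1 (b 1)) 0 = 0).
      by rewrite subrr mul0r; exact: cd_cst.
    have := theta_linear D (-1) 0 0 fe et; rewrite scaler0 addr0 => ->.
    by rewrite rmorphN1 mulN1r addNr.
  - by move=> t It; rewrite -(sv1 t It); exact: (rl 1 t I01_1 It).
have r11 : r 1 1 = b 1.
  have E0 t : I01 t -> projT1 (r 1 t) = projT1 (b 1).
    by move=> It; have [-> _] := rE 1 t I01_1 It; rewrite cone1l (bE 1 I01_1).
  have sb1 : slit (b 1) by apply: sb; exact: I01_1.
  have T1 := @tscale_ratio _ _ _ _ _ (fun=> b 1) (r 1) 1 (E0 1 I01_1) sb1.
  have T0 := @tscale_ratio _ _ _ _ _ (fun=> b 1) (r 1) 0 (E0 0 I01_0) sb1.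
  by rewrite T1 Hc -T0; exact: (rb 1 I01_1).
have Htop : tratio q (r ^~ 1) 1 = tratio q (r ^~ 1) 0 * expi (rint 0 1 (strip_area om cone su sv \o clamp)).
  apply: (@ratio_expi _ _ _ _ _ D q (r ^~ 1) (su ^~ 1) (fun=> 0) (fun u => 0 +i* strip_area om cone su sv u)).
  - by move=> s Is; have [-> _] := rE s 1 Is I01_1; rewrite cone1 (qE _ Is).
  - exact: sq.
  - exact: dq.
  - exact: rtop.
  - exact: clamp_continuous (strip_area_cont01 om_form nice_cone suP svP').
  - by move=> t It; rewrite subr0 /= clamp_id.
have top s : I01 s -> projT1 (r s 1) = projT1 (q s).
  by move=> Is; have [-> _] := rE s 1 Is I01_1; rewrite cone1 (qE _ Is).
have f01 : face0 1 = sigma (pt2 0 1) by rewrite /face0 subrr.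
have f00 : face0 0 = sigma (pt2 1 0) by rewrite /face0 subr0.
have q0v : projT1 (q 0) = face0 1 by rewrite (qE 0 I01_0) f01 subr0.
have q1v : projT1 (q 1) = face0 0 by rewrite (qE 1 I01_1) f00 subrr.
have E0 : fdom (frame_at L (face0 1)) (projT1 (q 0)) by rewrite q0v; exact: frame_at_dom.
have E1 : fdom (frame_at L (face0 0)) (projT1 (q 1)) by rewrite q1v; exact: frame_at_dom.
move: Htop; rewrite (@ratio_frame _ _ _ _ _ q (r ^~ 1) 1 _ (top 1 I01_1) (sq 1 I01_1) E1) (@ratio_frame _ _ _ _ _ q (r ^~ 1) 0 _ (top 0 I01_0) (sq 0 I01_0) E0).
have h2 := hlift_hol H2; have h1 := hlift_hol H1; have h0 := hlift_hol H0.
rewrite /= subrr subr0 in h0; rewrite (rb 0 I01_0) in h1.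
have e11 : face1 1 = face0 1 by rewrite f01.
have e10 : face1 0 = face2 0 by [].
have e21 : face2 1 = face0 0 by rewrite f00.
rewrite e11 e10 in h1; rewrite e21 in h2.
rewrite r11 h1 h2 h0 => K.
have nq := tfib_neq0 E1 (sq 1 I01_1).
have b0n : tfib (frame_at L (face2 0)) (b 0) != 0.
  by apply: tfib_neq0; [rewrite (bE 0 I01_0); exact: frame_at_dom|exact: (sb 0 I01_0)].
have h0n := hol_neq0 D face0.
move: K; move: (tfib _ (b 0)) (tfib _ (q 1)) (expi _) (hol D face0) (hol D face1) (hol D face2) b0n nq h0n.
move=> x y ee g0 g1 g2 x0 y0 g00 K.
have : g2 * x / y * (g0 * y / x) = g1 * x / (g0 * y) * ee * (g0 * y / x) by rewrite K.
rewrite (_ : g2 * x / y * (g0 * y / x) = g0 * g2); last by field; rewrite x0.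
by move=> ->; field; rewrite x0 y0.
Qed.

End SimplexHolonomy.

(** * The area of a simplex in cone coordinates *)

Section OpenIntegrals.
Context {R : realType}.

Lemma rint_open (s : R) (g h : R -> R) : (forall x, {for x, continuous h}) ->
  (forall b, 0 < b < s -> g b = h b) ->
  (\int[@lebesgue_measure R]_(b in [set b : R | (0 < b < s)%R]) g b)%R = rint 0 s h.
Proof.
move=> ch gh.
have -> : [set b : R | (0 < b < s)%R] = `]0, s[%classic by apply/seteqP; split=> x /=; rewrite in_itv.
have ih := @continuous_itv_integrable R h 0 s (fun x _ => ch x).
have iS (i : interval R) : [set` i] `<=` `[0, s]%classic -> (@lebesgue_measure R).-integrable [set` i] (EFin \o h).
  by move=> iS; apply: integrableS ih.
have -> : (\int[@lebesgue_measure R]_(b in `]0, s[%classic) g b)%R = (\int[@lebesgue_measure R]_(b in `]0, s[%classic) h b)%R.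
  by apply: eq_Rintegral => x; rewrite inE /= in_itv /=; exact: gh.
rewrite Rintegral_itv_bndo_bndc; last first.
  by apply: iS => x /=; rewrite !in_itv /= => /andP[x0 xs]; rewrite !ltW.
rewrite Rintegral_itv_obnd_cbnd //.
by apply: iS => x /=; rewrite !in_itv /= => /andP[x0 xs]; rewrite xs ltW.
Qed.

Lemma rintZ (c : R) (h : R -> R) : (forall x, {for x, continuous h}) ->
  rint 0 1 (fun x => c * h x) = c * rint 0 1 h.
Proof.
move=> ch; rewrite /rint RintegralZl //; apply: continuous_itv_integrable => x _; exact: ch.
Qed.

Lemma rint_rescale (k : R -> R) (s : R) : (forall x, {for x, continuous k}) -> 0 < s ->
  rint 0 s (fun b => k (b / s) / s) = rint 0 1 k.
Proof.
move=> ck s0; have cs x : {for x, continuous (fun b : R => k (b / s) / s)}.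
  apply: continuousM; last exact: cst_continuous.
  have c1 : {for x, continuous (fun b : R => b / s)}.
    by apply: continuousM; [exact: cvg_id|exact: cst_continuous].
  exact: (continuous_comp c1 (ck (x / s))).
have [P [dP PE]] := @rint_primitive R k (-1) 2 (fun x _ => ck x).
rewrite (PE 0 1); [|lra|lra|lra].
have sn : s != 0 by rewrite gt_eqF.
rewrite (@rint_FTC2 R (fun b => k (b / s) / s) (fun b => P (b / s)) setT (-1) (s + 1) 0 s) //; first last.
- move=> t /andP[t0 ts]; apply: dw_real_comp.
    apply: dP; have t1 : 0 <= t / s by rewrite divr_ge0 // ltW.
    have t2 : t / s <= 1 by rewrite ler_pdivrMr // mul1r.
    by apply/andP; split; lra.
  have := @dw_Z R R^o setT (fun x : R => x) t 1 s^-1.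
  rewrite /= /GRing.scale /= mulr1 (_ : (fun s0 : R => s^-1 * s0) = (fun b => b / s)).
    by apply; apply: dw_is_derive; exact: is_derive_id.
  by apply/funext => x; rewrite mulrC.
- by rewrite ltrDl.
- exact: ltW.
by rewrite divff // mul0r.
Qed.

End OpenIntegrals.

Section SimplexIntegral.
Context {R : realType} {m : nat} {M : topologicalType} {A : manifold R m M}.
Context {L : hermitian_line_bundle A}.
Context (om : M -> 'rV[R]_m -> 'rV[R]_m -> R).
Hypothesis om_form : is_two_form A om.
Context (sigma : 'rV[R]_2 -> M) (sigma_smooth : smooth_into A (@simplex2 R) sigma).

Lemma simplex2_nbhs (a b : R) : 0 < a -> 0 < b -> a + b < 1 -> nbhs (pt2 a b) (@simplex2 R).
Proof.
move=> a0 b0 ab; pose e := Num.min a (Num.min b ((1 - (a + b)) / 2)).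
have e0 : 0 < e by rewrite !lt_min a0 b0 divr_gt0 // subr_gt0.
have [ea eb ec] : [/\ e <= a, e <= b & e <= (1 - (a + b)) / 2].
  by rewrite /e; split; rewrite !ge_min lexx ?orbT.
apply/nbhs_ballP; exists e => // q; rewrite -ball_normE /= => qe.
have E k : (pt2 a b - q) 0 k = pt2 a b 0 k - q 0 k.
  by rewrite mxE; congr (_ + _); rewrite mxE.
have := le_lt_trans (entry_le_norm (pt2 a b - q) 0) qe.
have := le_lt_trans (entry_le_norm (pt2 a b - q) 1) qe.
rewrite !E !pt2E !ltr_norml => /andP[h1 h2] /andP[h3 h4].
exists (q 0 0), (q 0 1); split; [|lra|lra|lra].
by apply/rowP => i; case: (ord2P i) => ->; rewrite pt2E.
Qed.

Lemma simplex_coord_smooth a b (i : 'I_m) : 0 < a -> 0 < b -> a + b < 1 ->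
  exists g : 'rV[R]_2 -> R, differentiable g (pt2 a b) /\
    nbhs (pt2 a b) (fun z => g z = cmap (chart_at A (sigma (pt2 a b))) (sigma z) 0 i).
Proof.
move=> a0 b0 ab; have N0 := simplex2_nbhs a0 b0 ab.
have [W [y [oW Ww Cy yE]]] := smooth_into_chart sigma_smooth (nbhs_singleton N0).
exists (fun z => y z 0 i); split; first exact: (C1_differentiable oW Ww (Cy 1%N i)).
apply: filterS (filterI N0 (open_nbhs_nbhs (conj oW Ww))) => z [Sz Wz].
by have [_ ->] := yE z Sz Wz.
Qed.

(** Chain rule for sigma at an interior point of the simplex. *)
Lemma simplex_velocity (J : set R) (y : R -> 'rV[R]_2) t l v a b :
  (forall d, 0 < d -> exists2 s, J s & 0 < `|s - t| < d) ->
  y t = pt2 a b -> 0 < a -> 0 < b -> a + b < 1 -> dwithin J y t l ->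
  has_mvelocity A J (sigma \o y) t v ->
  v = l 0 0 *: simplex_diff A sigma (pt2 a b) (pt2 1 0) +
      l 0 1 *: simplex_diff A sigma (pt2 a b) (pt2 0 1).
Proof.
move=> acc yt a0 b0 ab dy [_]; rewrite /= yt => dv.
have {}dv : dwithin J (cmap (chart_at A (sigma (pt2 a b))) \o sigma \o y) t v by rewrite /dwithin /= yt.
apply/rowP => i; have [g [dg gE]] := simplex_coord_smooth i a0 b0 ab.
have dF d : ('D_d (cmap (chart_at A (sigma (pt2 a b))) \o sigma) (pt2 a b)) 0 i = 'D_d g (pt2 a b).
  rewrite derive_mxE; last first.
    apply: derivable_row => j; have [gj [dgj gjE]] := simplex_coord_smooth j a0 b0 ab.
    by apply: near_eq_derivable (diff_derivable dgj); exact: gjE.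
  by apply: near_eq_derive; apply: filterS gE => z ->.
rewrite mxE [X in _ = X + _]mxE [X in _ = _ + X]mxE /simplex_diff !dF.
have dvi := iffRL (dw_row _ _ _ _) dv i.
apply: dw_uniq acc dvi _.
have : dwithin J (g \o y) t ('D_l g (y t)) by apply: dw_comp dy _; rewrite yt.
rewrite yt !deriveE // {1}(_ : l = l 0 0 *: pt2 1 0 + l 0 1 *: pt2 0 1); last first.
  apply/rowP => k; rewrite [RHS]mxE [X in _ = X + _]mxE [X in _ = _ + X]mxE.
  by case: (ord2P k) => ->; rewrite !pt2E ?mulr1 ?mulr0 ?addr0 ?add0r.
rewrite linearD !linearZ; apply: dw_eq; last by rewrite /= yt (nbhs_singleton gE).
have /nbhs_ballP[e /= e0 ge] := gE.
have := dw_cvg e0 dy; apply: filterS => s Hs Js /=.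
by apply: ge; rewrite -ball_normE /= -yt distrC; exact: Hs.
Qed.

(** The Jacobian determinant of (u, v) |-> (u, v (1 - u)) is 1 - u. *)
Lemma area_density_cone su sv a b :
  (forall u v, I01 u -> I01 v -> has_mvelocity A I01 (cone sigma ^~ v) u (su u v)) ->
  (forall u v, I01 u -> I01 v -> has_mvelocity A I01 (cone sigma u) v (sv u v)) ->
  0 < a < 1 -> 0 < b < 1 - a ->
  area_density om (cone sigma) su sv a (b / (1 - a)) / (1 - a) =
  2 * pi * om (sigma (pt2 a b)) (simplex_diff A sigma (pt2 a b) (pt2 1 0))
                                (simplex_diff A sigma (pt2 a b) (pt2 0 1)).
Proof.
move=> suP svP /andP[a0 a1] /andP[b0 ba]; set v := b / (1 - a).
have s0 : 0 < 1 - a by rewrite subr_gt0.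
have sn : 1 - a != 0 by rewrite gt_eqF.
have vE : v * (1 - a) = b by rewrite divfK.
have Ia : I01 a by rewrite /I01 /= !ltW.
have Iv : I01 v.
  by rewrite /I01 /= /v divr_ge0 ?(ltW s0) ?(ltW b0) //= ler_pdivrMr // mul1r ltW.
have ab : a + b < 1 by lra.
have Eu := @simplex_velocity I01 (fun s => pt2 s (v * (1 - s))) a (pt2 1 (- v)) (su a v) a b
  (acc_I01 Ia).
have Ev := @simplex_velocity I01 (fun s => pt2 a (s * (1 - a))) v (pt2 0 (1 - a)) (sv a v) a b
  (acc_I01 Iv).
have dwid c0 c1 t : dwithin I01 (fun s : R => c0 + c1 * s) t c1.
  rewrite -[X in dwithin _ _ _ X]add0r; apply: dw_D; first exact: dw_cst.
  have := @dw_Z R R^o I01 (fun s => s) t 1 c1; rewrite /= /GRing.scale /= mulr1.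
  by apply; apply: dw_is_derive; exact: is_derive_id.
have du : dwithin I01 (fun s => pt2 s (v * (1 - s))) a (pt2 1 (- v)).
  apply/dw_row => i; case: (ord2P i) => ->; rewrite pt2E.
    rewrite (_ : (fun s => _) = (fun s => 0 + 1 * s)); first exact: dwid.
    by apply/funext => s; rewrite pt2E mul1r add0r.
  rewrite (_ : (fun s => _) = (fun s => v + - v * s)); first exact: dwid.
  by apply/funext => s; rewrite pt2E; ring.
have dv : dwithin I01 (fun s => pt2 a (s * (1 - a))) v (pt2 0 (1 - a)).
  apply/dw_row => i; case: (ord2P i) => ->; rewrite pt2E.
    rewrite (_ : (fun s => _) = (fun s => a + 0 * s)); first exact: dwid.
    by apply/funext => s; rewrite pt2E mul0r addr0.
  rewrite (_ : (fun s => _) = (fun s => 0 + (1 - a) * s)); first exact: dwid.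
  by apply/funext => s; rewrite pt2E; ring.
have yE : pt2 a (v * (1 - a)) = pt2 a b by rewrite vE.
have := Eu yE a0 b0 ab du (suP a v Ia Iv); have := Ev yE a0 b0 ab dv (svP a v Ia Iv).
rewrite /area_density /cone vE !pt2E scale0r add0r scale1r.
move: (simplex_diff _ _ _ (pt2 1 0)) (simplex_diff _ _ _ (pt2 0 1)) => p q -> ->.
have [lin anti _] := om_form; set x := sigma _.
have lin0 w : om x 0 w = 0.
  by have := lin x 1 0 0 w; rewrite scaler0 addr0 mul1r; lra.
have qq : om x q q = 0 by have := anti x q q; lra.
have linZ k u w : om x (k *: u) w = k * om x u w by rewrite -[k *: u]addr0 lin lin0 addr0.
have E : om x (p + - v *: q) q = om x p q by rewrite [p + _]addrC lin qq mulr0 add0r.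
by rewrite (anti x _ ((1 - a) *: q)) linZ (anti x q) E; field.
Qed.

Lemma strip_area_simplex_int su sv :
  (forall u v, I01 u -> I01 v -> has_mvelocity A I01 (cone sigma ^~ v) u (su u v)) ->
  (forall u v, I01 u -> I01 v -> has_mvelocity A I01 (cone sigma u) v (sv u v)) ->
  rint 0 1 (strip_area om (cone sigma) su sv \o clamp) = 2 * pi * simplex_int A om sigma.
Proof.
move=> suP svP; have nice := nice_cone (L := L) sigma_smooth.
have cs : forall x, {for x, continuous (strip_area om (cone sigma) su sv \o clamp)}.
  exact: (clamp_continuous (strip_area_cont01 om_form nice suP svP)).
have ca u : I01 u -> forall x, {for x, continuous (area_density om (cone sigma) su sv u \o clamp)}.
  by move=> Iu; exact: (clamp_continuous (area_density_cont01 om_form nice suP svP Iu)).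
have pi2 : 2 * pi != 0 :> R by rewrite mulf_neq0 // gt_eqF // pi_gt0.
have -> : simplex_int A om sigma =
    rint 0 1 (fun u => (2 * pi)^-1 * (strip_area om (cone sigma) su sv \o clamp) u).
  rewrite /simplex_int; apply: rint_open => [x|a /[dup] a01 /andP[a0 a1]].
    by apply: continuousM; [exact: cst_continuous|exact: cs].
  have Ia : I01 a by rewrite /I01 /= !ltW.
  have s0 : 0 < 1 - a by rewrite subr_gt0.
  rewrite [in RHS]/= (clamp_id Ia) /strip_area -(rintZ _ (ca a Ia)).
  pose k v := (2 * pi)^-1 * (area_density om (cone sigma) su sv a \o clamp) v.
  have ck x : {for x, continuous k}.
    by apply: continuousM; [exact: cst_continuous|exact: ca].
  rewrite -(rint_rescale ck s0); apply: rint_open => [x|b b01].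
    have c1 : {for x, continuous (fun b : R => b / (1 - a))}.
      by apply: continuousM; [exact: cvg_id|exact: cst_continuous].
    by apply: continuousM; [exact: (continuous_comp c1 (ck _))|exact: cst_continuous].
  have /andP[b0 ba] := b01.
  have Iv : I01 (b / (1 - a)).
    by rewrite /I01 /= divr_ge0 ?(ltW s0) ?(ltW b0) //= ler_pdivrMr // mul1r ltW.
  rewrite /k /= (clamp_id Iv) -mulrA (area_density_cone suP svP a01 b01).
  by rewrite mulKf.
by rewrite rintZ // mulVKf.
Qed.

End SimplexIntegral.

(** * Holonomy of boundaries *)

Section ChainHolonomy.
Context {R : realType} {m : nat} {M : topologicalType} {A : manifold R m M}.
Context {L : hermitian_line_bundle A} (D : connection L).
Context (om : M -> 'rV[R]_m -> 'rV[R]_m -> R).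
Hypotheses (om_form : is_two_form A om) (pq : prequantum om D).

(** A chain sees a path through its values on [0, 1] alone; path_restr g is a
    canonical representative of the paths that agree with g there. *)
Definition path_restr (g : R -> M) : R -> M := fun t => if `[< I01 t >] then g t else g 0.

Lemma path_restr_id g t : I01 t -> path_restr g t = g t.
Proof. by move=> It; rewrite /path_restr asboolT. Qed.

Lemma path_restr_eq g g' : (path_restr g == path_restr g') = `[< forall t, I01 t -> g t = g' t >].
Proof.
apply/eqP/asboolP => [E t It|E]; first by rewrite -(path_restr_id g It) E path_restr_id.
apply/funext => t; rewrite /path_restr; case: ifP => [/asboolP It|_]; first exact: E.
exact: E I01_0.
Qed.

Definition chain_hol (C : seq (int * (R -> M))) : R[i] := \prod_(p <- C) hol D p.2 ^ p.1.

Lemma path_restr_idem g : path_restr (path_restr g) = path_restr g.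
Proof. by apply/eqP; rewrite path_restr_eq; apply/asboolP => t; exact: path_restr_id. Qed.

Lemma chain_hol_coef C (u : seq (R -> M)) : uniq u -> {in u, forall g, path_restr g = g} ->
  {subset [seq path_restr p.2 | p <- C] <= u} ->
  chain_hol C = \prod_(g <- u) hol D g ^ chain_coef C g.
Proof.
move=> uu ur Cu; have hr g : hol D (path_restr g) = hol D g.
  by apply: hol_ext => t; exact: path_restr_id.
transitivity (\prod_(p <- C) \prod_(g <- u | path_restr p.2 == g) hol D g ^ p.1).
  apply: eq_big_seq => p pC.
  have pu : path_restr p.2 \in u by apply: Cu; apply: (map_f (fun p => path_restr p.2) pC).
  rewrite big_mkcond (bigD1_seq _ pu uu) /= eqxx hr big1 ?mulr1 // => g.
  by rewrite eq_sym => /negPf ->.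
rewrite (exchange_big_dep predT) //=; apply: eq_big_seq => g gu.
rewrite /chain_coef (big_morph (fun n : int => hol D g ^ n) (id1 := 1) (op1 := *%R)) //; last first.
  by move=> a b; rewrite expfzDr // hol_neq0.
by apply: eq_bigl => p; rewrite -[g in LHS](ur g gu) path_restr_eq.
Qed.

Lemma chain_hol_eq C C' : chain_eq C C' -> chain_hol C = chain_hol C'.
Proof.
move=> CC'; pose u := undup [seq path_restr p.2 | p <- C ++ C'].
have uu : uniq u by exact: undup_uniq.
have ur : {in u, forall g, path_restr g = g}.
  by move=> g; rewrite mem_undup => /mapP[p _ ->]; exact: path_restr_idem.
rewrite !(chain_hol_coef uu ur) //.
- by apply: eq_bigr => g _; rewrite CC'.
- by move=> g gC; rewrite mem_undup map_cat mem_cat gC orbT.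
- by move=> g gC; rewrite mem_undup map_cat mem_cat gC.
Qed.

Lemma expi_int (x : R) (n : int) : expi (x * n%:~R) = expi x ^ n.
Proof.
have H k : expi (x * k%:R) = expi x ^+ k.
  elim: k => [|k IH]; first by rewrite mulr0 expi0.
  by rewrite -addn1 natrD mulrDr mulr1 expiD IH addn1 exprSr.
case: n => k; first exact: H.
apply: (mulfI (expi_neq0 (x * k.+1%:R))); rewrite -expiD [in LHS]NegzE mulrNz mulrN subrr expi0.
by rewrite H /= mulfV // expf_neq0 // expi_neq0.
Qed.

(** For each simplex of S the three faces of its boundary contribute the
    factors of simplex_hol, raised to the coefficient of the simplex. *)
Lemma boundary_hol S : smooth_chain2 A S ->
  chain_hol (boundary S) = expi (2 * pi * chain_int A om S).
Proof.
move=> smS; rewrite /chain_hol /boundary big_flatten big_map /chain_int mulr_sumr.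
rewrite (big_morph (@expi R) (id1 := 1) (op1 := *%R)); [|exact: expiD|exact: expi0].
apply: eq_big_seq => p pS; have /asboolP sp := allP smS p pS.
rewrite !big_cons big_nil /= mulr1.
have [su [sv [suP svP E]]] := simplex_hol om_form pq sp.
rewrite (strip_area_simplex_int (L := L) om_form sp suP svP) in E.
rewrite [p.1%:~R * _]mulrC [2 * pi * _]mulrA expi_int.
rewrite -[hol D _]/(hol D (face0 p.2)) -[hol D (fun t => p.2 (pt2 0 t))]/(hol D (face1 p.2)).
rewrite -[hol D (fun t => p.2 (pt2 t 0))]/(hol D (face2 p.2)).
have n1 := hol_neq0 D (face1 p.2).
by rewrite mulrCA -expfzMl E expfzMl mulrA -expfzDr // addNr mul1r.
Qed.

Lemma loop_hol S g : smooth_chain2 A S -> chain_eq (boundary S) [:: (1, g)] ->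
  hol D g = expi (2 * pi * chain_int A om S).
Proof.
move=> smS bS; rewrite -(boundary_hol smS) (chain_hol_eq bS).
by rewrite /chain_hol big_cons big_nil mulr1.
Qed.

End ChainHolonomy.

(** * Holonomy of the lifted isotopy *)

Section NiceContinuity.
Context {R : realType} {m : nat} {M : topologicalType} {A : manifold R m M}.
Context {L : hermitian_line_bundle A}.

Lemma nice_cont01 (sg : R -> R -> M) al u : I01 u ->
  (forall v, I01 v -> nice_family (L := L) sg al u v) -> cont01 (al u).
Proof.
move=> Iu nice v0 Iv0 d d0; have [c [e [V [y [a [_ [oV Vw] [_ Ca] _ sgE]]]]]] := nice v0 Iv0.
have N := continuous_at_near (Ck_cont (Ca 0%N) Vw) d0.
have NN : nbhs (pt2 u v0) (fun w => V w /\ `|a (pt2 u v0) - a w| < d).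
  exact: (filterI (open_nbhs_nbhs (conj oV Vw)) N).
have /nbhs_ballP[r /= r0 H] := NN.
exists r => // v Iv vr; have uu : `|u - u| < r by rewrite subrr normr0.
have [Vuv K] := H _ (pt2_ball r0 uu vr).
have [_ ->] := sgE u v Iu Iv Vuv; have [_ ->] := sgE u v0 Iu Iv0 Vw.
by rewrite distrC.
Qed.

End NiceContinuity.

Section LoopHolonomy.
Context {R : realType} {m : nat} {M : topologicalType} {A : manifold R m M}.
Context {L : hermitian_line_bundle A} (D : connection L).
Context (om : M -> 'rV[R]_m -> 'rV[R]_m -> R).
Context (psi psiV : R -> M -> M) (f : R -> M -> R) (X : R -> M -> 'rV[R]_m).
Context (F : R -> tot_space L -> tot_space L).
Hypotheses (psi_isotopy : isotopy A psi psiV) (psi_closed : psi 1 = id)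
  (f_smooth : smooth_time_fun A f) (psi_ham : hamiltonian_flow A om f X psi)
  (F_lift : lift_isotopy D X f F).

(** F_s(p) and the horizontal lift of the loop that starts at p have rates
    - 2 pi i f_s and 0, so their ratio at time 1 is the exponential of the
    integral of the difference. *)
Lemma flow_lift_loop (p : tot_space L) : slit p ->
  F 1 p = tscale (hol D (fun t => psi t (projT1 p)) *
    expi (- (2 * pi * (\int[lebesgue_measure]_(t in I01) (f t (psi t (projT1 p))))%R))) p.
Proof.
move=> sp; set x := projT1 p; pose c := chart_at A x.
have Ac : atlas A c by exact: chart_atP.
have cx : cdom c x by exact: chart_at_dom.
have [_ _ psi0 _] := psi_isotopy.
pose sg (u t : R) := psi t x.
have nice0 u v : I01 u -> I01 v -> nice_family (L := L) sg (fun _ _ => 0) u v.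
  move=> Iu Iv; rewrite (_ : sg = (fun u t => psi t (cinv c (cmap c x + u *: 0)))).
    by apply: (nice_flow psi_isotopy) => // u' _; rewrite scaler0 addr0; exists x.
  by apply/funext => u'; apply/funext => v'; rewrite scaler0 addr0 cmapK.
have nice u v : I01 u -> I01 v -> nice_family (L := L) sg (fun u v => - (2 * pi * f v (sg u v))) u v.
  by move=> Iu Iv; apply: nice_potential => //; exact: nice0.
have vel t : I01 t -> has_mvelocity A I01 (sg 0) t (X t (psi t x)) by move=> It; have [] := psi_ham x It.
have p0E : projT1 p = sg 0 0 by rewrite /sg psi0.
have [q [q0 qE sq dq]] := lift_exists D I01_0 (fun v Iv => nice0 0 v I01_0 Iv) vel p0E sp.
have [F0 FE sF dF] := lift_flow psi_isotopy psi_ham F_lift sp.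
pose k := (fun t => - (2 * pi * f t (psi t x))) \o clamp.
have kC y : {for y, continuous k}.
  exact: (clamp_continuous (nice_cont01 I01_0 (fun v Iv => nice 0 v I01_0 Iv))).
have FqE s : I01 s -> projT1 (F s p) = projT1 (q s) by move=> Is; rewrite FE // qE.
have E := @ratio_expi _ _ _ _ _ D q (fun s => F s p) (fun t => X t (psi t x)) (fun=> 0 +i* 0)
  (fun t => 0 +i* - (2 * pi * f t (psi t x))) k FqE sq dq dF kC.
have kE t : I01 t -> (0 +i* - (2 * pi * f t (psi t x))) - (0 +i* 0) = 0 +i* k t.
  by move=> It; rewrite /k /= clamp_id //; apply: complexP; rewrite /= subr0.
have {}E := E kE.
have T1 := @tscale_ratio _ _ _ _ _ q (fun s => F s p) 1 (FqE 1 I01_1) (sq 1 I01_1).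
have R0 : tratio q (fun s => F s p) 0 = 1.
  rewrite /tratio F0 q0 divff //; apply: tfib_neq0 => //; exact: frame_at_dom.
have q1 : q 1 = tscale (hol D (fun t => psi t x)) p.
  have q1E : projT1 (q 1) = projT1 p by rewrite (qE 1 I01_1) /sg psi_closed.
  have [z zE] := tscale_ex q1E sp.
  have Hq : hlift D (fun t => psi t x) q by exists (fun t => X t (psi t x)) => t It; split; auto.
  have := hlift_hol Hq; rewrite psi0 psi_closed q0 zE tfib_tscale; last exact: frame_at_dom.
  by move/(mulIf (tfib_neq0 (frame_at_dom L _) sp)) => ->.
rewrite T1 E R0 mul1r q1 tscaleA mulrC; congr (tscale (_ * expi _) _).
have -> : (\int[lebesgue_measure]_(t in I01) (f t (psi t x)))%R = rint 0 1 (fun t => (- (2 * pi))^-1 * k t).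
  rewrite /rint (_ : I01 = `[0, 1]%classic); last by apply/seteqP; split=> t; rewrite /= in_itv.
  apply: eq_Rintegral => t; rewrite inE /= in_itv /= => It.
  by rewrite /k /= clamp_id // -(mulNr (2 * pi)) mulKf // oppr_eq0 mulf_neq0 // gt_eqF // pi_gt0.
by rewrite rintZ // -(mulNr (2 * pi)) mulVKf // oppr_eq0 mulf_neq0 // gt_eqF // pi_gt0.
Qed.

End LoopHolonomy.

Theorem corollary5 (R : realType) (n : nat) (M : topologicalType)
  (A : manifold R n.*2 M) (om : M -> 'rV[R]_n.*2 -> 'rV[R]_n.*2 -> R)
  (M_compact : compact [set: M]) (M_connected : connected [set: M])
  (om_symplectic : symplectic A om) (om_quantizable : integral_class A om)
  (L : hermitian_line_bundle A) (D : connection L)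
  (D_prequantum : prequantum om D)
  (psi psiV : R -> M -> M) (f : R -> M -> R) (X : R -> M -> 'rV[R]_n.*2)
  (psi_isotopy : isotopy A psi psiV) (psi_closed : psi 1 = id)
  (f_smooth : smooth_time_fun A f)
  (psi_hamiltonian : hamiltonian_flow A om f X psi)
  (f_normalized : forall t, I01 t -> is_integral A om (f t) 0)
  (F : R -> tot_space L -> tot_space L) (F_lift : lift_isotopy D X f F)
  (x0 : M) (S : seq (int * ('rV[R]_2 -> M))) (S_smooth : smooth_chain2 A S)
  (S_boundary : chain_eq (boundary S) [:: (1, fun t => psi t x0)])
  (s : forall x, fib L x) (s_smooth : smooth_section setT s) :
  transport psi psiV F (section_map s) 1 =
  section_map (fun x => action_integral A om f psi x0 S *: s x).
Proof.
have [om_form _ _] := om_symplectic.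
have Hall x : flow_holonomy F (action_integral A om f psi x0 S) x.
  apply: (flow_holonomy_all om_form D_prequantum psi_isotopy psi_closed f_smooth
            psi_hamiltonian F_lift M_connected (x0 := x0)).
  apply: (@flow_holonomy_of_one _ _ _ _ _ _ _ _ _ _ _ _ psi_isotopy psi_hamiltonian F_lift _
            (frame_point x0) (slit_fvec x0)).
  rewrite (flow_lift_loop psi_isotopy psi_closed f_smooth psi_hamiltonian F_lift (slit_fvec x0)) /=.
  by rewrite (loop_hol om_form D_prequantum S_smooth S_boundary) -expiD.
have psiV1 x : psiV 1 x = x.
  by have [_ _ _ /(_ 1 I01_1)[+ _]] := psi_isotopy; rewrite psi_closed => /(_ x).
apply/funext => x; rewrite /transport /= psiV1 /extend0 /=; case: eqP => [sx0|/eqP sx0].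
  by rewrite psi_closed /section_map sx0 scaler0.
exact: (Hall x (section_map s x) sx0 erefl).
Qed.
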